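(* Assume Setting (S) and the Distinctness assumptions (D). Assume moreover $\gamma>4\alpha$. Then for every $T>\frac{2\pi}{\sqrt{\gamma^2-16\alpha^2}}$, $$\int_0^T\big(|u_1(t)|^2+|u_2(t)|^2\big)dt\asymp\sum_{n=1}^\infty\big(|C_n|^2+|d_nD_n|^2\big),$$ i.e. there are constants $0<A\le B$ (depending on $T$ and the sequences $\omega_n,\zeta_n,r_n,c_n,d_n$ and the constants in (S), but not on $C_n,D_n,R_n,\mathcal{E}$) such that $A\sum_n(|C_n|^2+|d_nD_n|^2)\le\int_0^T(|u_1|^2+|u_2|^2)dt\le B\sum_n(|C_n|^2+|d_nD_n|^2)$.
   Context: Setting (S): $(\omega_n),(\zeta_n),(C_n),(D_n),(c_n),(d_n)$ ($n\ge1$) are complex sequences and $(r_n),(R_n)$ are real sequences. There are constants $\gamma>0$, $\alpha>0$, $\chi<0$, $n'\in\mathbb{N}$, $\mu>0$, $\nu>1/2$, $M>0$, $0<c_1\le c_2$ such that: (H1) $\liminf_{n\to\infty}(\operatorname{Re}\omega_{n+1}-\operatorname{Re}\omega_n)=\liminf_{n\to\infty}(\operatorname{Re}\zeta_{n+1}-\operatorname{Re}\zeta_n)=\gamma$; (H2) $\operatorname{Im}\omega_n\to\alpha$, $r_n\to\chi$, $\operatorname{Im}\zeta_n\to0$; (H3) $\omega_n\ne0$, $\zeta_n\neq0$, $c_1|\zeta_n|\le|d_n|\le c_2|\zeta_n|$ and $|c_n|\le M/|\omega_n|$ for all $n$; (H4) $|R_n|\le\mu n^{-\nu}(|C_n|^2+|d_nD_n|^2)^{1/2}$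 for $n\ge n'$ and $|R_n|\le\mu(|C_n|^2+|d_nD_n|^2)^{1/2}$ for $n\le n'$; (H5) $\sum_n(|C_n|^2+|d_nD_n|^2)<\infty$. For $n_0\in\mathbb{N}$ and $t\in\mathbb{R}$, $u_1^{n_0}(t)=\sum_{n\ge n_0}\big(C_ne^{i\omega_nt}+\overline{C_n}e^{-i\overline{\omega_n}t}+R_ne^{r_nt}+D_ne^{i\zeta_nt}+\overline{D_n}e^{-i\overline{\zeta_n}t}\big)$, $u_2^{n_0}(t)=\sum_{n\ge n_0}\big(d_nD_ne^{i\zeta_nt}+\overline{d_nD_n}e^{-i\overline{\zeta_n}t}+c_nC_ne^{i\omega_nt}+\overline{c_nC_n}e^{-i\overline{\omega_n}t}\big)$. Distinctness assumptions (D): $\eta\in\mathbb{R}$ and $\mathcal{E}\in\mathbb{R}$ with $|\mathcal{E}|^2\le M\sum_{n\ge1}(|C_n|^2+|d_nD_n|^2)$; the sequences $(\omega_n)$, $(r_n)$, $(\zeta_n)$ each consist of pairwise distinct numbers; $\omega_n\ne\zeta_m$, $\omega_n\ne\overline{\zeta_m}$, $r_n\ne i\omega_m$, $r_n\ne i\zeta_m$, $r_n\ne-\eta$ for all $n,m$; and $\operatorname{Re}\omega_n>0$, $\operatorname{Re}\zeta_n>0$ for all $n$. Set $u_1(t):=u_1^{1}(t)$ and $u_2(t):=u_2^{1}(t)+\mathcal{E}e^{-\eta t}$. *)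

(* Defs.v *)
From Stdlib Require Import Reals Lra Lia ClassicalEpsilon.
Open Scope R_scope.

Definition Cpx : Type := (R * R)%type.
Definition Cre (z : Cpx) : R := fst z.
Definition Cim (z : Cpx) : R := snd z.
Definition RtoC (x : R) : Cpx := (x, 0).
Definition Ci : Cpx := (0, 1).
Definition Cadd (z w : Cpx) : Cpx := (Cre z + Cre w, Cim z + Cim w).
Definition Cmul (z w : Cpx) : Cpx :=
  (Cre z * Cre w - Cim z * Cim w, Cre z * Cim w + Cim z * Cre w).
Definition Copp (z : Cpx) : Cpx := (- Cre z, - Cim z).
Definition Cconj (z : Cpx) : Cpx := (Cre z, - Cim z).
Definition Cnorm2 (z : Cpx) : R := Cre z * Cre z + Cim z * Cim z.
Definition Cmod (z : Cpx) : R := sqrt (Cnorm2 z).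
Definition Cexp (z : Cpx) : Cpx :=
  (exp (Cre z) * cos (Cim z), exp (Cre z) * sin (Cim z)).

Fixpoint Csum1 (f : nat -> Cpx) (N : nat) : Cpx :=
  match N with
  | O => (0, 0)
  | S k => Cadd (Csum1 f k) (f (S k))
  end.

Fixpoint Rsum1 (f : nat -> R) (N : nat) : R :=
  match N with
  | O => 0
  | S k => Rsum1 f k + f (S k)
  end.

Definition liminf_eq (a : nat -> R) (l : R) : Prop :=
  forall eps, eps > 0 ->
    (exists N, forall n, (n >= N)%nat -> a n > l - eps) /\
    (forall N, exists n, (n >= N)%nat /\ a n < l + eps).

(* Riemann integral of f over [a,b] (the value of RiemannInt for any
   integrability proof; all such values agree).  Used only for continuous f. *)
Definition integral (f : R -> R) (a b : R) : R :=
  epsilon (inhabits 0)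
    (fun I => exists pr : Riemann_integrable f a b, RiemannInt pr = I).

Definition u1_term (om ze Cc Dd : nat -> Cpx) (r Rr : nat -> R) (n : nat) (t : R)
  : Cpx :=
  Cadd (Cmul (Cc n) (Cexp (Cmul Ci (Cmul (om n) (RtoC t)))))
  (Cadd (Cmul (Cconj (Cc n)) (Cexp (Copp (Cmul Ci (Cmul (Cconj (om n)) (RtoC t))))))
  (Cadd (RtoC (Rr n * exp (r n * t)))
  (Cadd (Cmul (Dd n) (Cexp (Cmul Ci (Cmul (ze n) (RtoC t)))))
        (Cmul (Cconj (Dd n)) (Cexp (Copp (Cmul Ci (Cmul (Cconj (ze n)) (RtoC t))))))))).

Definition u2_term (om ze c d Cc Dd : nat -> Cpx) (n : nat) (t : R) : Cpx :=
  Cadd (Cmul (Cmul (d n) (Dd n)) (Cexp (Cmul Ci (Cmul (ze n) (RtoC t)))))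
  (Cadd (Cmul (Cconj (Cmul (d n) (Dd n))) (Cexp (Copp (Cmul Ci (Cmul (Cconj (ze n)) (RtoC t))))))
  (Cadd (Cmul (Cmul (c n) (Cc n)) (Cexp (Cmul Ci (Cmul (om n) (RtoC t)))))
        (Cmul (Cconj (Cmul (c n) (Cc n))) (Cexp (Copp (Cmul Ci (Cmul (Cconj (om n)) (RtoC t)))))))).

Definition u1_N om ze Cc Dd r Rr (N : nat) (t : R) : Cpx :=
  Csum1 (fun n => u1_term om ze Cc Dd r Rr n t) N.
Definition u2_N om ze c d Cc Dd (E eta : R) (N : nat) (t : R) : Cpx :=
  Cadd (Csum1 (fun n => u2_term om ze c d Cc Dd n t) N) (RtoC (E * exp (- eta * t))).

Definition coef2 (d Cc Dd : nat -> Cpx) (n : nat) : R :=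
  Cnorm2 (Cc n) + Cnorm2 (Cmul (d n) (Dd n)).

(* Main.v *)
(* Both components are real, u_1 = 2 Re sum (C_n e^(i om_n t) + D_n e^(i ze_n t)) + sum R_n e^(r_n t)
   and similarly for u_2, and the claim is uniform in the length of the finite sums.

   Multiplying by e^(alpha t) brings the exponents om_n close to the real axis, so for the tail
   n >= n0 an Ingham argument with the window sin (PI t / T) on the Gram matrix applies to both
   families as soon as T > 2 PI / gamma; the D_n in u_1, the c_n C_n in u_2 and the R_n are small
   perturbations for large n0.

   The exponents below n0 are handled by Haraux's method: subtracting suitable local averages
   multiplies every e^(z t) by a multiplier M(z) vanishing at the low exponents and costs an
   arbitrarily small length of the time interval.  The bound on R_n survives only if
   |M(r_n)| <= |M(i om_n)|, |M(i ze_n)| on the tail; this is achieved by killing the limit chi of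
   r_n sufficiently many times as well.  The low coefficients are then recovered from the
   independence of finitely many distinct exponentials. *)
From Stdlib Require Import Reals Arith Lra Lia Psatz List.
From Stdlib Require Import ClassicalEpsilon.
From Coquelicot Require Import Coquelicot.
Require Import Defs.
From Stdlib Require Import Reals.
Import ListNotations.
Open Scope R_scope.

(** * Finite sums and integrals of continuous functions *)

(** The imaginary parts of the two families have different limits, [alpha] and 0, so no single
    factor e^(b t) brings both close to the real axis, and one Gram matrix for both is avoided. The
    two components separate them: since |d_n| grows and c_n decays, D_n is small against d_n D_n and
    c_n C_n against C_n, so [u_1] controls the C_n, [u_2] controls the d_n D_n, and each family gets
    its own b. The interval then has to satisfy 2 PI / T < gamma, which the assumption on T implies.
    The sine window has an explicit transform for complex frequencies too, with quadratic decay, so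
    the row sums of the Gram matrix telescope. Low exponents are killed by averages rather than by
    differences: 1 - e^Z vanishes periodically along the imaginary axis, whereas the symbol of an
    average vanishes only at 0 in a whole strip around that axis. One fixed step therefore serves
    infinitely many remaining exponents. Every constant is fixed before the coefficients and the
    length N of the sums; N tends to infinity only at the end, where the energies form a Cauchy
    sequence. *)

Lemma Rabs_le_of_sqr (x y : R) : x * x <= y * y -> 0 <= y -> Rabs x <= y.
Proof. intros H Hy; apply Rabs_le; split; nra. Qed.

Lemma Rsum1_ext (f g : nat -> R) (N : nat) :
  (forall n, (1 <= n <= N)%nat -> f n = g n) -> Rsum1 f N = Rsum1 g N.
Proof.
  induction N as [|N IH]; intros H; simpl; trivial.
  rewrite IH, H; trivial; try lia; intros; apply H; lia.
Qed.

Lemma Rsum1_le (f g : nat -> R) (N : nat) :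
  (forall n, (1 <= n <= N)%nat -> f n <= g n) -> Rsum1 f N <= Rsum1 g N.
Proof.
  induction N as [|N IH]; intros H; simpl; [lra|].
  apply Rplus_le_compat; [apply IH; intros; apply H|apply H]; lia.
Qed.

Lemma Rsum1_plus (f g : nat -> R) (N : nat) :
  Rsum1 (fun n => f n + g n) N = Rsum1 f N + Rsum1 g N.
Proof. induction N as [|N IH]; simpl; [lra|rewrite IH; lra]. Qed.

Lemma Rsum1_scal (c : R) (f : nat -> R) (N : nat) :
  Rsum1 (fun n => c * f n) N = c * Rsum1 f N.
Proof. induction N as [|N IH]; simpl; [lra|rewrite IH; lra]. Qed.

Lemma Rsum1_zero (f : nat -> R) (N : nat) :
  (forall n, (1 <= n <= N)%nat -> f n = 0) -> Rsum1 f N = 0.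
Proof.
  intros H; rewrite (Rsum1_ext f (fun n => 0 * f n)), Rsum1_scal; [lra|].
  intros n Hn; rewrite (H n Hn); lra.
Qed.

Lemma Rsum1_nonneg (f : nat -> R) (N : nat) :
  (forall n, (1 <= n <= N)%nat -> 0 <= f n) -> 0 <= Rsum1 f N.
Proof.
  intros H; rewrite <- (Rsum1_zero (fun _ => 0) N); trivial; now apply Rsum1_le.
Qed.

Lemma Rsum1_abs (f : nat -> R) (N : nat) :
  Rabs (Rsum1 f N) <= Rsum1 (fun n => Rabs (f n)) N.
Proof.
  induction N as [|N IH]; simpl; [rewrite Rabs_R0; lra|].
  eapply Rle_trans; [apply Rabs_triang|lra].
Qed.

Lemma Rsum1_swap (f : nat -> nat -> R) (N K : nat) :
  Rsum1 (fun n => Rsum1 (fun m => f n m) K) N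
  = Rsum1 (fun m => Rsum1 (fun n => f n m) N) K.
Proof.
  induction N as [|N IH]; simpl; [now rewrite Rsum1_zero|].
  now rewrite Rsum1_plus, IH.
Qed.

Lemma Rsum1_sqr (f : nat -> R) (N : nat) :
  Rsum1 f N * Rsum1 f N = Rsum1 (fun n => Rsum1 (fun m => f n * f m) N) N.
Proof.
  rewrite <- Rsum1_scal; apply Rsum1_ext; intros n _; rewrite Rsum1_scal; lra.
Qed.

Lemma Rsum1_cauchy_schwarz (f g : nat -> R) (N : nat) :
  Rsum1 (fun n => f n * g n) N * Rsum1 (fun n => f n * g n) N
  <= Rsum1 (fun n => f n * f n) N * Rsum1 (fun n => g n * g n) N.
Proof.
  induction N as [|N IH]; simpl; [lra|].
  assert (HF : 0 <= Rsum1 (fun n => f n * f n) N) by (apply Rsum1_nonneg; intros; nra).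
  assert (HG : 0 <= Rsum1 (fun n => g n * g n) N) by (apply Rsum1_nonneg; intros; nra).
  revert IH HF HG.
  generalize (Rsum1 (fun n => f n * f n) N) (Rsum1 (fun n => g n * g n) N)
    (Rsum1 (fun n => f n * g n) N) (f (S N)) (g (S N)).
  intros F G A x y IH HF HG.
  (* The cross term of the induction step: A^2 <= F G and the inequality of arithmetic and geometric
     means. *)
  assert (Rabs (2 * A * (x * y)) <= F * (y * y) + G * (x * x)).
  { apply Rabs_le_of_sqr; [|nra].
    assert (0 <= (F * (y * y) - G * (x * x)) * (F * (y * y) - G * (x * x))) by apply Rle_0_sqr.
    assert (0 <= (F * G - A * A) * ((x * y) * (x * y))) by (apply Rmult_le_pos; [lra|apply Rle_0_sqr]).
    nra. }
  apply Rabs_le_between in H; nra.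
Qed.

Lemma Rsum1_cut (f : nat -> R) (N K : nat) :
  (K <= N)%nat -> (forall n, (K < n <= N)%nat -> f n = 0) -> Rsum1 f N = Rsum1 f K.
Proof.
  intros HK; induction HK as [|N HK IH]; intros H; trivial; simpl.
  rewrite H, IH; [lra| |lia]; intros; apply H; lia.
Qed.

Lemma Rsum1_mono (f : nat -> R) (N K : nat) :
  (forall n, (1 <= n)%nat -> 0 <= f n) -> (K <= N)%nat -> Rsum1 f K <= Rsum1 f N.
Proof.
  intros H HK; induction HK as [|N HK IH]; simpl; [lra|].
  specialize (H (S N) ltac:(lia)); lra.
Qed.

Lemma Rsum1_le_of_cv (f : nat -> R) (l : R) :
  (forall n, (1 <= n)%nat -> 0 <= f n) -> Un_cv (Rsum1 f) l -> forall N, Rsum1 f N <= l.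
Proof.
  intros H Hl N; apply (growing_ineq (Rsum1 f)); trivial.
  intros n; simpl; specialize (H (S n) ltac:(lia)); lra.
Qed.

Lemma Rsum1_S (f : nat -> R) (N : nat) : Rsum1 f (S N) = Rsum1 f N + f (S N).
Proof. reflexivity. Qed.

(** [Nat.max n m - Nat.min n m] is the distance |n - m|. Truncated subtraction covers two cases at
    once: for n <= N the middle sum is empty and the row has two sides, for n > N the last sum is
    empty and only a stretch of one side is left. *)
Lemma Rsum1_refl_kernel (h : nat -> R) (n N : nat) :
  h 0%nat = 0 -> (1 <= n)%nat ->
  Rsum1 (fun m => h (Nat.max n m - Nat.min n m)%nat) N
  = Rsum1 h (n - 1) - Rsum1 h (n - 1 - N) + Rsum1 h (N - n).
Proof.
  intros H0 Hn; induction N as [|N IH].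
  - replace (n - 1 - 0)%nat with (n - 1)%nat by lia; simpl; lra.
  - rewrite Rsum1_S, IH; destruct (Nat.le_gt_cases n N) as [H|H].
    + replace (n - 1 - N)%nat with 0%nat by lia.
      replace (n - 1 - S N)%nat with 0%nat by lia.
      replace (Nat.max n (S N) - Nat.min n (S N))%nat with (S (N - n)) by lia.
      replace (S N - n)%nat with (S (N - n)) by lia; rewrite Rsum1_S; lra.
    + destruct (Nat.eq_dec n (S N)) as [->|H'].
      * rewrite Nat.max_id, Nat.min_id, !Nat.sub_diag, H0.
        replace (S N - 1 - N)%nat with 0%nat by lia.
        replace (S N - 1 - S N)%nat with 0%nat by lia.
        replace (N - S N)%nat with 0%nat by lia; simpl; lra.
      * replace (N - n)%nat with 0%nat by lia.
        replace (S N - n)%nat with 0%nat by lia.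
        destruct (Nat.le_exists_sub (S (S N)) n ltac:(lia)) as [k [-> _]].
        replace (k + S (S N) - 1 - N)%nat with (S k) by lia.
        replace (k + S (S N) - 1 - S N)%nat with k by lia.
        replace (Nat.max (k + S (S N)) (S N) - Nat.min (k + S (S N)) (S N))%nat
          with (S k) by lia.
        rewrite Rsum1_S; lra.
Qed.

(* Schur's test for a kernel depending only on the distance to the diagonal. *)
Lemma Rsum1_schur (h x : nat -> R) (ks : R) (N : nat) :
  h 0%nat = 0 -> (forall j, 0 <= h j) -> (forall J, Rsum1 h J <= ks) ->
  (forall n, 0 <= x n) ->
  Rsum1 (fun n => Rsum1 (fun m => h (Nat.max n m - Nat.min n m)%nat * (x n + x m)) N) N
  <= 4 * ks * Rsum1 x N.
Proof.
  intros H0 Hh Hk Hx.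
  assert (Hrow : forall n, (1 <= n)%nat ->
    Rsum1 (fun m => h (Nat.max n m - Nat.min n m)%nat) N <= 2 * ks).
  { intros n Hn; rewrite Rsum1_refl_kernel; trivial.
    assert (0 <= Rsum1 h (n - 1 - N)) by (apply Rsum1_nonneg; auto).
    pose proof (Hk (n - 1)%nat); pose proof (Hk (N - n)%nat); lra. }
  assert (Hhalf : Rsum1 (fun n => Rsum1 (fun m => h (Nat.max n m - Nat.min n m)%nat * x n) N) N
                  <= 2 * ks * Rsum1 x N).
  { rewrite <- Rsum1_scal; apply Rsum1_le; intros n Hn.
    rewrite (Rsum1_ext _ (fun m => x n * h (Nat.max n m - Nat.min n m)%nat)) by (intros; lra).
    rewrite Rsum1_scal; specialize (Hrow n ltac:(lia)); specialize (Hx n); nra. }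
  rewrite (Rsum1_ext _ (fun n =>
    Rsum1 (fun m => h (Nat.max n m - Nat.min n m)%nat * x n) N
    + Rsum1 (fun m => h (Nat.max n m - Nat.min n m)%nat * x m) N)).
  2: { intros n _; rewrite <- Rsum1_plus; apply Rsum1_ext; intros; lra. }
  rewrite Rsum1_plus, (Rsum1_swap (fun n m => h (Nat.max n m - Nat.min n m)%nat * x m)).
  rewrite (Rsum1_ext (fun m => Rsum1 (fun n => h (Nat.max n m - Nat.min n m)%nat * x m) N)
    (fun n => Rsum1 (fun m => h (Nat.max n m - Nat.min n m)%nat * x n) N)); [lra|].
  intros n _; apply Rsum1_ext; intros m _; now rewrite Nat.max_comm, Nat.min_comm.
Qed.

(** * Continuous functions and their integrals *)

Definition cont (f : R -> R) : Prop := forall t, continuous f t.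

Lemma cont_const (c : R) : cont (fun _ => c).
Proof. intros t; apply continuous_const. Qed.
Lemma cont_id : cont (fun t => t).
Proof. intros t; apply continuous_id. Qed.
Lemma cont_plus (f g : R -> R) : cont f -> cont g -> cont (fun t => f t + g t).
Proof. intros Hf Hg t; now apply (continuous_plus f g). Qed.
Lemma cont_minus (f g : R -> R) : cont f -> cont g -> cont (fun t => f t - g t).
Proof. intros Hf Hg t; now apply (continuous_minus f g). Qed.
Lemma cont_opp (f : R -> R) : cont f -> cont (fun t => - f t).
Proof. intros Hf t; now apply (continuous_opp f). Qed.
Lemma cont_mult (f g : R -> R) : cont f -> cont g -> cont (fun t => f t * g t).
Proof. intros Hf Hg t; now apply (continuous_mult f g). Qed.
Lemma cont_comp (g f : R -> R) : cont g -> cont f -> cont (fun t => g (f t)).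
Proof. intros Hg Hf t; now apply (continuous_comp f g). Qed.
Lemma cont_exp (f : R -> R) : cont f -> cont (fun t => exp (f t)).
Proof.
  intros Hf; apply cont_comp; trivial; intros t.
  apply (ex_derive_continuous exp); auto_derive; trivial.
Qed.
Lemma cont_cos (f : R -> R) : cont f -> cont (fun t => cos (f t)).
Proof.
  intros Hf; apply cont_comp; trivial; intros t.
  apply (ex_derive_continuous cos); auto_derive; trivial.
Qed.
Lemma cont_sin (f : R -> R) : cont f -> cont (fun t => sin (f t)).
Proof.
  intros Hf; apply cont_comp; trivial; intros t.
  apply (ex_derive_continuous sin); auto_derive; trivial.
Qed.
Lemma cont_Rsum1 (f : nat -> R -> R) (N : nat) :
  (forall n, cont (f n)) -> cont (fun t => Rsum1 (fun n => f n t) N).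
Proof.
  intros Hf; induction N as [|N IH]; simpl; [apply cont_const|now apply cont_plus].
Qed.
Lemma cont_ext (f g : R -> R) : (forall t, f t = g t) -> cont f -> cont g.
Proof. intros H Hf t; now apply (continuous_ext f). Qed.

Create HintDb cont.
#[export] Hint Resolve cont_const cont_id cont_plus cont_minus cont_opp cont_mult
  cont_exp cont_cos cont_sin cont_Rsum1 : cont.

Lemma cont_ex_RInt (f : R -> R) (a b : R) : cont f -> ex_RInt f a b.
Proof. intros Hf; apply (ex_RInt_continuous (V := R_CompleteNormedModule)); intros; apply Hf. Qed.
#[export] Hint Resolve cont_ex_RInt : cont.

(* Pins the type of the value to [R], which [RInt] leaves as a normed-module carrier. *)
Definition Int (f : R -> R) (a b : R) : R := RInt f a b.

(** Any integrability proof gives the same Riemann integral, so the value picked by [epsilon] is the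
    one computed by [RInt]. *)
Lemma integral_Int (f : R -> R) (a b : R) : cont f -> integral f a b = Int f a b.
Proof.
  intros Hf; unfold integral.
  pose (pr0 := ex_RInt_Reals_0 f a b (cont_ex_RInt f a b Hf)).
  destruct (epsilon_spec (inhabits 0)
    (fun I => exists pr : Riemann_integrable f a b, RiemannInt pr = I)) as [pr Hpr].
  - now exists (RiemannInt pr0), pr0.
  - now rewrite <- Hpr, <- (RInt_Reals f a b pr).
Qed.

Lemma Int_ext (f g : R -> R) (a b : R) : (forall t, f t = g t) -> Int f a b = Int g a b.
Proof. intros H; apply RInt_ext; intros; apply H. Qed.

Lemma Int_plus (f g : R -> R) (a b : R) :
  cont f -> cont g -> Int (fun t => f t + g t) a b = Int f a b + Int g a b.
Proof. intros; apply (RInt_plus f g); now apply cont_ex_RInt. Qed.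

Lemma Int_minus (f g : R -> R) (a b : R) :
  cont f -> cont g -> Int (fun t => f t - g t) a b = Int f a b - Int g a b.
Proof. intros; apply (RInt_minus f g); now apply cont_ex_RInt. Qed.

Lemma Int_scal (c : R) (f : R -> R) (a b : R) :
  cont f -> Int (fun t => c * f t) a b = c * Int f a b.
Proof. intros; apply (RInt_scal f); now apply cont_ex_RInt. Qed.

Lemma Int_const (c a b : R) : Int (fun _ => c) a b = (b - a) * c.
Proof. apply (RInt_const a b c). Qed.

Lemma Int_le (f g : R -> R) (a b : R) :
  a <= b -> cont f -> cont g -> (forall t, a <= t <= b -> f t <= g t) ->
  Int f a b <= Int g a b.
Proof.
  intros Hab Hf Hg H; apply RInt_le; auto with cont; intros; apply H; lra.
Qed.

Lemma Int_nonneg (f : R -> R) (a b : R) :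
  a <= b -> cont f -> (forall t, a <= t <= b -> 0 <= f t) -> 0 <= Int f a b.
Proof. intros Hab Hf H; apply RInt_ge_0; auto with cont; intros; apply H; lra. Qed.

Lemma Int_Chasles (f : R -> R) (a b c : R) :
  cont f -> Int f a b + Int f b c = Int f a c.
Proof. intros; apply (RInt_Chasles f); now apply cont_ex_RInt. Qed.

Lemma Int_sub (f : R -> R) (a a' b' b : R) :
  a <= a' -> a' <= b' -> b' <= b -> cont f -> (forall t, a <= t <= b -> 0 <= f t) ->
  Int f a' b' <= Int f a b.
Proof.
  intros H1 H2 H3 Hf H.
  rewrite <- (Int_Chasles f a a' b), <- (Int_Chasles f a' b' b); trivial.
  assert (0 <= Int f a a') by (apply Int_nonneg; trivial; intros; apply H; lra).
  assert (0 <= Int f b' b) by (apply Int_nonneg; trivial; intros; apply H; lra).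
  lra.
Qed.

Lemma Int_derive (F f : R -> R) (a b : R) :
  cont f -> (forall t, is_derive F t (f t)) -> Int f a b = F b - F a.
Proof.
  intros Hf HF; apply is_RInt_unique, (is_RInt_derive F f); intros; [apply HF|apply Hf].
Qed.

Lemma Int_Rsum1 (f : nat -> R -> R) (N : nat) (a b : R) :
  (forall n, cont (f n)) ->
  Int (fun t => Rsum1 (fun n => f n t) N) a b = Rsum1 (fun n => Int (f n) a b) N.
Proof.
  intros Hf; induction N as [|N IH]; simpl; [rewrite Int_const; lra|].
  rewrite Int_plus, IH; auto with cont.
Qed.

(** The variance of f over [0, 1] is nonnegative. *)
Lemma Int_sqr_le (f : R -> R) : cont f ->
  Int f 0 1 * Int f 0 1 <= Int (fun t => f t * f t) 0 1.
Proof.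
  intros Hf; set (m := Int f 0 1).
  assert (H : 0 <= Int (fun t => f t * f t - 2 * m * f t + m * m) 0 1).
  { apply Int_nonneg; auto 10 with cont; [lra|]; intros t _.
    replace (_ - _ + _) with ((f t - m) * (f t - m)) by ring; apply Rle_0_sqr. }
  rewrite Int_plus, Int_minus, Int_scal, Int_const in H; auto 10 with cont.
  fold m in H; nra.
Qed.

Lemma Int_shift (f : R -> R) (u v a b : R) :
  cont f -> Int (fun t => u * f (u * t + v)) a b = Int f (u * a + v) (u * b + v).
Proof. intros Hf; apply (RInt_comp_lin f); auto with cont. Qed.

(** * Oscillatory integrals against a sine window *)

(** The real part of (x + i y) e^(i (p + i q) t). Hence [osc a l t] is a e^(i l t) plus its
    conjugate, the building block of both components. *)
Definition wave (x y p q t : R) : R :=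
  exp (- (q * t)) * (x * cos (p * t) - y * sin (p * t)).

Definition osc (a l : Cpx) (t : R) : R := 2 * wave (Cre a) (Cim a) (Cre l) (Cim l) t.

Lemma cont_wave (x y p q : R) : cont (wave x y p q).
Proof. unfold wave; auto 15 with cont. Qed.
#[export] Hint Resolve cont_wave : cont.

Lemma cont_osc (a l : Cpx) : cont (osc a l).
Proof. unfold osc; auto with cont. Qed.
#[export] Hint Resolve cont_osc : cont.

(* Real and imaginary part of [(s^2 - w^2) * \int_0^T sin (s t) e^(i w t) dt = s (1 + e^(i w T))]
   for [w = p + i q] and [s = PI / T]. *)
Lemma sine_window_re (T p q : R) : 0 < T -> let s := PI / T in
  Int (fun t => sin (s * t) * (exp (- (q * t)) *
     ((s * s - p * p + q * q) * cos (p * t) + 2 * p * q * sin (p * t)))) 0 T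
  = s * (1 + exp (- (q * T)) * cos (p * T)).
Proof.
  intros HT s.
  assert (Hs : s * T = PI) by (unfold s; field; lra).
  (* Real part of the antiderivative e^(i w t) (i w sin (s t) - s cos (s t)) of (s^2 - w^2) sin (s
     t) e^(i w t). *)
  rewrite (Int_derive (fun t => exp (- (q * t)) *
    ((- q * sin (s * t) - s * cos (s * t)) * cos (p * t) - p * sin (s * t) * sin (p * t)))).
  - rewrite Hs, sin_PI, cos_PI, !Rmult_0_r, Ropp_0, exp_0, sin_0, cos_0; ring.
  - auto 25 with cont.
  - intros t; auto_derive; [trivial|ring].
Qed.

Lemma sine_window_im (T p q : R) : 0 < T -> let s := PI / T in
  Int (fun t => sin (s * t) * (exp (- (q * t)) *
     ((s * s - p * p + q * q) * sin (p * t) - 2 * p * q * cos (p * t)))) 0 T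
  = s * (exp (- (q * T)) * sin (p * T)).
Proof.
  intros HT s.
  assert (Hs : s * T = PI) by (unfold s; field; lra).
  rewrite (Int_derive (fun t => exp (- (q * t)) *
    ((- q * sin (s * t) - s * cos (s * t)) * sin (p * t) + p * sin (s * t) * cos (p * t)))).
  - rewrite Hs, sin_PI, cos_PI, !Rmult_0_r, Ropp_0, exp_0, sin_0, cos_0; ring.
  - auto 25 with cont.
  - intros t; auto_derive; [trivial|ring].
Qed.

Lemma sine_window_diag (T q : R) : 0 < T -> let s := PI / T in
  Int (fun t => sin (s * t) * exp (- (q * t))) 0 T
  = s * (1 + exp (- (q * T))) / (s * s + q * q).
Proof.
  intros HT s; pose proof (sine_window_re T 0 q HT) as H; fold s in H; cbv zeta in H.
  assert (0 < s) by (apply Rdiv_lt_0_compat; [apply PI_RGT_0|lra]).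
  assert (HE : Int (fun t => sin (s * t) * (exp (- (q * t)) *
     ((s * s - 0 * 0 + q * q) * cos (0 * t) + 2 * 0 * q * sin (0 * t)))) 0 T
     = (s * s + q * q) * Int (fun t => sin (s * t) * exp (- (q * t))) 0 T).
  { rewrite <- Int_scal; auto 10 with cont; apply Int_ext; intros t.
    rewrite !Rmult_0_l, cos_0, !Rmult_0_r; ring. }
  rewrite HE, Rmult_0_l, cos_0, Rmult_1_r in H.
  apply Rmult_eq_reg_l with (s * s + q * q); [|nra].
  rewrite H; field; nra.
Qed.

(** By the closed form, the transform at w = p + i q has modulus s |1 + e^(i w T)| / |s^2 - w^2|.
    The numerator is at most s (1 + e^(- q T)), and |s^2 - w^2| >= p^2 - q^2 - s^2 >= D. The
    integral in question is the real part of x + i y times this transform. [D] and [k] stay free so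
    that both sum and difference frequencies can be treated. *)
Lemma sine_window_wave (T x y p q D k r : R) :
  0 < T -> let s := PI / T in
  0 < D -> D <= p * p - q * q - s * s -> s * (1 + exp (- (q * T))) <= k * D ->
  0 <= k -> x * x + y * y <= r * r -> 0 <= r ->
  Rabs (Int (fun t => sin (s * t) * wave x y p q t) 0 T) <= k * r.
Proof.
  intros HT s HD HDp Hk Hk0 Hxy Hr.
  pose proof (sine_window_re T p q HT) as Hre; pose proof (sine_window_im T p q HT) as Him.
  cbv zeta in Hre, Him; fold s in Hre, Him.
  set (e := exp (- (q * T))) in *.
  assert (He : 0 < e) by apply exp_pos.
  assert (Hs : 0 < s) by (apply Rdiv_lt_0_compat; [apply PI_RGT_0|lra]).
  pose (c t := sin (s * t) * (exp (- (q * t)) * cos (p * t))).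
  pose (d t := sin (s * t) * (exp (- (q * t)) * sin (p * t))).
  assert (Hc : cont c) by (unfold c; auto 15 with cont).
  assert (Hd : cont d) by (unfold d; auto 15 with cont).
  set (U := s * s - p * p + q * q) in *; set (V := 2 * p * q) in *.
  rewrite (Int_ext _ (fun t => U * c t + V * d t)), Int_plus, !Int_scal in Hre;
    auto with cont; [|intros; unfold c, d; ring].
  rewrite (Int_ext _ (fun t => U * d t - V * c t)), Int_minus, !Int_scal in Him;
    auto with cont; [|intros; unfold c, d; ring].
  rewrite (Int_ext _ (fun t => x * c t - y * d t)), Int_minus, !Int_scal;
    auto with cont; [|intros; unfold c, d, wave; ring].
  set (Jc := Int c 0 T) in *; set (Jd := Int d 0 T) in *.
  pose proof (sin2_cos2 (p * T)) as Hsc; unfold Rsqr in Hsc.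
  set (C := cos (p * T)) in *; set (S := sin (p * T)) in *.
  assert (HC : C <= 1) by nra.
  (* U - i V is s^2 - w^2 and Jc + i Jd is the transform, so the left side is the squared modulus of
     their product, known from [Hre] and [Him]. *)
  assert (HJ : (U * U + V * V) * (Jc * Jc + Jd * Jd) <= (s * (1 + e)) * (s * (1 + e))).
  { replace ((U * U + V * V) * (Jc * Jc + Jd * Jd)) with
      ((U * Jc + V * Jd) * (U * Jc + V * Jd) + (U * Jd - V * Jc) * (U * Jd - V * Jc)) by ring.
    rewrite Hre, Him.
    replace (_ + _) with (s * s * (1 + 2 * e * C + e * e * (S * S + C * C))) by ring.
    rewrite Hsc; assert (0 <= s * s * (2 * e * (1 - C))).
    { apply Rmult_le_pos; [nra|]; apply Rmult_le_pos; nra. }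
    nra. }
  assert (HDU : D * D <= U * U + V * V).
  { assert (HU : D <= - U) by (unfold U; lra).
    assert (D * D <= U * U) by nra; nra. }
  assert (HkJ : Jc * Jc + Jd * Jd <= k * k).
  { apply Rmult_le_reg_l with (D * D); [nra|].
    apply Rle_trans with ((U * U + V * V) * (Jc * Jc + Jd * Jd)).
    - apply Rmult_le_compat_r; trivial; nra.
    - eapply Rle_trans; [exact HJ|].
      replace (D * D * (k * k)) with ((k * D) * (k * D)) by ring.
      assert (0 <= s * (1 + e)) by (apply Rmult_le_pos; lra).
      apply Rmult_le_compat; lra. }
  apply Rabs_le_of_sqr; [|nra].
  apply Rle_trans with ((x * x + y * y) * (Jc * Jc + Jd * Jd)).
  - assert (0 <= (x * Jd + y * Jc) * (x * Jd + y * Jc)) by apply Rle_0_sqr; nra.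
  - replace (k * r * (k * r)) with ((r * r) * (k * k)) by ring.
    apply Rmult_le_compat; nra.
Qed.

(** The two frequencies are l + m and l - conj m. Imaginary parts add in both, so the damping of the
    product is the same in the two terms. *)
Lemma osc_mul (a l b m : Cpx) (t : R) :
  osc a l t * osc b m t =
  2 * wave (Cre (Cmul a b)) (Cim (Cmul a b)) (Cre l + Cre m) (Cim l + Cim m) t
  + 2 * wave (Cre (Cmul a (Cconj b))) (Cim (Cmul a (Cconj b)))
      (Cre l - Cre m) (Cim l + Cim m) t.
Proof.
  destruct a as [x y], l as [p q], b as [x' y'], m as [p' q']; unfold osc, wave; simpl.
  replace ((p + p') * t) with (p * t + p' * t) by ring.
  replace ((p - p') * t) with (p * t - p' * t) by ring.
  replace (- ((q + q') * t)) with (- (q * t) + - (q' * t)) by ring.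
  rewrite exp_plus, cos_plus, sin_plus, cos_minus, sin_minus; ring.
Qed.

Lemma Cnorm2_mul (a b : Cpx) : Cnorm2 (Cmul a b) = Cnorm2 a * Cnorm2 b.
Proof. destruct a, b; unfold Cnorm2; simpl; ring. Qed.
Lemma Cnorm2_conj (a : Cpx) : Cnorm2 (Cconj a) = Cnorm2 a.
Proof. destruct a; unfold Cnorm2; simpl; ring. Qed.
Lemma Cnorm2_pos (a : Cpx) : 0 <= Cnorm2 a.
Proof. unfold Cnorm2; nra. Qed.

Lemma Rsum1_delta (f : nat -> R) (n N : nat) :
  (1 <= n <= N)%nat -> Rsum1 (fun m => if Nat.eq_dec n m then f m else 0) N = f n.
Proof.
  intros Hn; rewrite (Rsum1_cut _ N n).
  - destruct n as [|n]; [lia|]; rewrite Rsum1_S, Rsum1_zero.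
    + destruct (Nat.eq_dec (S n) (S n)); [lra|easy].
    + intros m Hm; destruct (Nat.eq_dec (S n) m); [lia|trivial].
  - lia.
  - intros m Hm; destruct (Nat.eq_dec n m); [lia|trivial].
Qed.

Lemma Rsum1_telescope (f F : nat -> R) (N : nat) :
  (forall n, (1 <= n)%nat -> f n <= F (n - 1)%nat - F n) -> Rsum1 f N <= F 0%nat - F N.
Proof.
  intros H; induction N as [|N IH]; [simpl; lra|]; rewrite Rsum1_S.
  specialize (H (S N) ltac:(lia)); replace (S N - 1)%nat with N in H by lia; lra.
Qed.

(** Bound for Gram entries at distance j from the diagonal: the first inverse comes from the
    difference frequency, the second from the sum frequency, and [E] bounds the factor e^(- q T).
    The shape 4 j^2 - 1 = (2 j - 1) (2 j + 1) is chosen to telescope; the value 0 at j = 0 leaves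
    the diagonal out of Schur's test. *)
Definition gram_kernel (s th g P E : R) (j : nat) : R :=
  if Nat.eq_dec j 0 then 0 else
  s * (1 + E) * (/ (th * (s * s) * (4 * (INR j * INR j) - 1)) + / ((g * INR j + P) * (g * INR j + P))).

Lemma INR_pos1 (j : nat) : (1 <= j)%nat -> 1 <= INR j.
Proof. intros H; apply (le_INR 1 j H). Qed.

Lemma gram_kernel_nonneg (s th g P E : R) (j : nat) :
  0 < s -> 0 < th -> 0 < g -> 0 < P -> 0 < E -> 0 <= gram_kernel s th g P E j.
Proof.
  intros; unfold gram_kernel; destruct (Nat.eq_dec j 0); [lra|].
  pose proof (INR_pos1 j ltac:(lia)).
  assert (0 < g * INR j + P) by nra.
  assert (0 < 4 * (INR j * INR j) - 1) by nra.
  assert (0 < s * s) by nra.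
  apply Rmult_le_pos; [nra|]; apply Rplus_le_le_0_compat; apply Rlt_le, Rinv_0_lt_compat.
  - repeat apply Rmult_lt_0_compat; trivial.
  - nra.
Qed.

(** Both parts telescope: 1 / (4 j^2 - 1) is half the difference of 1 / (2 j - 1) and 1 / (2 j + 1),
    and 1 / (g j + P)^2 is at most 1 / ((g (j - 1) + P) (g j + P)). [F j] is the resulting bound for
    the sum beyond j. *)
Lemma gram_kernel_sum (s th g P E : R) (J : nat) :
  0 < s -> 0 < th -> 0 < g -> 0 < P -> 0 < E ->
  Rsum1 (gram_kernel s th g P E) J <= s * (1 + E) * (/ (2 * th * (s * s)) + / (g * P)).
Proof.
  intros Hs Hth Hg HP HE.
  pose (F (j : nat) := s * (1 + E) *
          (/ (2 * th * (s * s) * (2 * INR j + 1)) + / (g * (g * INR j + P)))).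
  apply Rle_trans with (F 0%nat - F J).
  - apply Rsum1_telescope; intros n Hn; unfold F, gram_kernel.
    destruct (Nat.eq_dec n 0); [lia|].
    rewrite minus_INR by lia; pose proof (INR_pos1 n Hn) as Hn1; simpl (INR 1).
    generalize dependent (INR n); intros x Hx.
    assert (Hgx : 0 < g * (x - 1) + P) by nra.
    assert (Hgx' : 0 < g * x + P) by nra.
    assert (H1 : / (th * (s * s) * (4 * (x * x) - 1)) =
      / (2 * th * (s * s) * (2 * (x - 1) + 1)) - / (2 * th * (s * s) * (2 * x + 1))).
    { field; repeat split; nra. }
    assert (H2 : / ((g * x + P) * (g * x + P)) <=
      / (g * (g * (x - 1) + P)) - / (g * (g * x + P))).
    { replace (/ (g * (g * (x - 1) + P)) - / (g * (g * x + P)))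
        with (/ ((g * (x - 1) + P) * (g * x + P))) by (field; repeat split; lra).
      apply Rinv_le_contravar; nra. }
    rewrite H1; rewrite <- Rmult_minus_distr_l; apply Rmult_le_compat_l; [nra|lra].
  - assert (HF : 0 <= F J).
    { unfold F; pose proof (pos_INR J); assert (0 < s * s) by nra.
      apply Rmult_le_pos; [nra|]; apply Rplus_le_le_0_compat; apply Rlt_le, Rinv_0_lt_compat.
      - repeat apply Rmult_lt_0_compat; lra.
      - apply Rmult_lt_0_compat; nra. }
    assert (HF0 : F 0%nat = s * (1 + E) * (/ (2 * th * (s * s)) + / (g * P))).
    { unfold F; simpl; rewrite !Rmult_0_r, !Rplus_0_l, Rmult_1_r; reflexivity. }
    lra.
Qed.

Lemma exp_le (x y : R) : x <= y -> exp x <= exp y.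
Proof.
  intros [H|H]; [apply Rlt_le, exp_increasing, H|rewrite H; lra].
Qed.

(** From n0 on, the exponents lie in a strip of half-width [eps] with uniform gap [g]. The lower
    bound [P] on real parts is there to make the sum frequencies l_n + l_m harmless. *)
Definition separated (l : nat -> Cpx) (n0 : nat) (g eps P : R) : Prop :=
  (forall n, (n0 <= n)%nat -> Rabs (Cim (l n)) <= eps /\ P <= Cre (l n)) /\
  (forall n m, (n0 <= m)%nat -> (m <= n)%nat ->
     g * (INR n - INR m) <= Cre (l n) - Cre (l m)).

(** At index distance j the difference frequency is at least g j and the sum frequency at least g j
    + 2 P, so both oscillatory integrals are covered by the window estimate. The amplitude |a_n|
    |a_m| is replaced by the mean [r] of the two squares, as Schur's test wants. *)
Lemma gram_offdiag (T g eps P : R) (l a : nat -> Cpx) (n0 n m : nat) :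
  0 < T -> let s := PI / T in let th := (g * g - 4 * (eps * eps)) / (4 * (s * s)) in
  1 <= th -> 0 < g -> 0 <= eps -> 0 < P -> 4 * (eps * eps) + s * s <= P * P ->
  separated l n0 g eps P -> (forall k, (k < n0)%nat -> a k = (0, 0)) -> n <> m ->
  Rabs (Int (fun t => sin (s * t) * (osc (a n) (l n) t * osc (a m) (l m) t)) 0 T)
  <= gram_kernel s th g P (exp (2 * eps * T)) (Nat.max n m - Nat.min n m)
     * (Cnorm2 (a n) + Cnorm2 (a m)).
Proof.
  intros HT s th Hth Hg Heps HP HPs Hsep Ha.
  assert (Hs : 0 < s) by (apply Rdiv_lt_0_compat; [apply PI_RGT_0|lra]).
  assert (Hz : forall n m, (n < n0)%nat \/ (m < n0)%nat ->
    Int (fun t => sin (s * t) * (osc (a n) (l n) t * osc (a m) (l m) t)) 0 T = 0).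
  { intros i j Hij; rewrite (Int_ext _ (fun _ => 0)), Int_const; [ring|].
    intros t; unfold osc, wave; destruct Hij as [Hij|Hij]; rewrite (Ha _ Hij); simpl; ring. }
  assert (Hker : forall j, 0 <= gram_kernel s th g P (exp (2 * eps * T)) j)
    by (intros; apply gram_kernel_nonneg; trivial; [lra|apply exp_pos]).
  assert (main : forall n m, (n0 <= m)%nat -> (m < n)%nat ->
    Rabs (Int (fun t => sin (s * t) * (osc (a n) (l n) t * osc (a m) (l m) t)) 0 T)
    <= gram_kernel s th g P (exp (2 * eps * T)) (n - m) * (Cnorm2 (a n) + Cnorm2 (a m))).
  { clear n m; intros n m Hm Hn; destruct Hsep as [Hl Hgap].
    destruct (Hl n ltac:(lia)) as [Hqn Hpn]; destruct (Hl m ltac:(lia)) as [Hqm Hpm].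
    apply Rabs_le_between in Hqn; apply Rabs_le_between in Hqm.
    specialize (Hgap n m Hm ltac:(lia)).
    rewrite <- minus_INR in Hgap by lia.
    pose proof (INR_pos1 (n - m) ltac:(lia)) as Hj.
    unfold gram_kernel; destruct (Nat.eq_dec (n - m) 0); [lia|].
    set (j := INR (n - m)) in *; set (E := exp (2 * eps * T)).
    assert (HE : exp (- ((Cim (l n) + Cim (l m)) * T)) <= E) by (apply exp_le; nra).
    set (q := Cim (l n) + Cim (l m)) in *.
    assert (Hq : q * q <= 4 * (eps * eps)) by (unfold q; nra).
    set (D1 := (g * j + P) * (g * j + P)).
    set (D2 := th * (s * s) * (4 * (j * j) - 1)).
    assert (Hgj : 0 < g * j) by (apply Rmult_lt_0_compat; lra).
    assert (HD1 : 0 < D1) by (unfold D1; apply Rmult_lt_0_compat; lra).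
    assert (Hth' : th * (4 * (s * s)) = g * g - 4 * (eps * eps)) by (unfold th; field; lra).
    assert (Hjj : 1 <= j * j) by nra.
    assert (HD2 : 0 < D2).
    { unfold D2; apply Rmult_lt_0_compat; [apply Rmult_lt_0_compat; [lra|nra]|lra]. }
    pose proof (Cnorm2_pos (a n)) as Xn; pose proof (Cnorm2_pos (a m)) as Xm.
    set (r := (Cnorm2 (a n) + Cnorm2 (a m)) / 2).
    assert (Hr : Cnorm2 (a n) * Cnorm2 (a m) <= r * r).
    { pose proof (Rle_0_sqr (Cnorm2 (a n) - Cnorm2 (a m))) as Hsq.
      unfold Rsqr in Hsq; unfold r; lra. }
    rewrite (Int_ext _ (fun t =>
      2 * (sin (s * t) * wave (Cre (Cmul (a n) (a m))) (Cim (Cmul (a n) (a m)))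
         (Cre (l n) + Cre (l m)) q t)
      + 2 * (sin (s * t) * wave (Cre (Cmul (a n) (Cconj (a m)))) (Cim (Cmul (a n) (Cconj (a m))))
         (Cre (l n) - Cre (l m)) q t))).
    2: { intros t; rewrite osc_mul; fold q; ring. }
    rewrite Int_plus, !Int_scal by auto 15 with cont.
    assert (HsE : 0 <= s * (1 + E))
      by (apply Rmult_le_pos; [|pose proof (exp_pos (2 * eps * T)); unfold E]; lra).
    assert (B1 : Rabs (Int (fun t => sin (s * t) * wave (Cre (Cmul (a n) (a m))) (Cim (Cmul (a n) (a m)))
         (Cre (l n) + Cre (l m)) q t) 0 T) <= s * (1 + E) * / D1 * r).
    { apply sine_window_wave with D1; trivial; fold s.
      - unfold D1.
        (* One of the two copies of P stays in [D1]; the square of the other pays for 4 eps^2 +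
           s^2. *)
        assert ((g * j + 2 * P) * (g * j + 2 * P) <=
                (Cre (l n) + Cre (l m)) * (Cre (l n) + Cre (l m))).
        { apply Rmult_le_compat; nra. }
        nra.
      - replace (s * (1 + E) * / D1 * D1) with (s * (1 + E)) by (field; lra).
        apply Rmult_le_compat_l; lra.
      - apply Rmult_le_pos; trivial; apply Rlt_le, Rinv_0_lt_compat, HD1.
      - change (Cnorm2 (Cmul (a n) (a m)) <= r * r); now rewrite Cnorm2_mul.
      - unfold r; lra. }
    assert (B2 : Rabs (Int (fun t => sin (s * t) * wave (Cre (Cmul (a n) (Cconj (a m))))
        (Cim (Cmul (a n) (Cconj (a m)))) (Cre (l n) - Cre (l m)) q t) 0 T) <= s * (1 + E) * / D2 * r).
    { apply sine_window_wave with D2; trivial; fold s.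
      - unfold D2.
        assert ((g * j) * (g * j) <=
                (Cre (l n) - Cre (l m)) * (Cre (l n) - Cre (l m))).
        { apply Rmult_le_compat; nra. }
        (* [th] is defined so that 4 th s^2 = g^2 - 4 eps^2; with th >= 1 and j >= 1 this gives D2
           <= g^2 j^2 - 4 eps^2 - s^2. *)
        assert (0 <= (th - 1) * (s * s)) by (apply Rmult_le_pos; nra).
        assert (4 * (eps * eps) <= 4 * (eps * eps) * (j * j)).
        { assert (0 <= (eps * eps) * (j * j - 1)) by (apply Rmult_le_pos; nra); nra. }
        replace (th * (s * s) * (4 * (j * j) - 1))
          with (th * (4 * (s * s)) * (j * j) - th * (s * s)) by ring.
        rewrite Hth'; nra.
      - replace (s * (1 + E) * / D2 * D2) with (s * (1 + E)) by (field; lra).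
        apply Rmult_le_compat_l; lra.
      - apply Rmult_le_pos; trivial; apply Rlt_le, Rinv_0_lt_compat, HD2.
      - change (Cnorm2 (Cmul (a n) (Cconj (a m))) <= r * r);
          now rewrite Cnorm2_mul, Cnorm2_conj.
      - unfold r; lra. }
    apply Rabs_le_between in B1; apply Rabs_le_between in B2.
    assert (Hrr : Cnorm2 (a n) + Cnorm2 (a m) = 2 * r) by (unfold r; lra).
    rewrite Hrr; apply Rabs_le; split; nra. }
  intros Hnm.
  destruct (Nat.lt_ge_cases (Nat.min n m) n0) as [Hlt|Hge].
  - rewrite Hz, Rabs_R0 by lia; apply Rmult_le_pos; auto.
    pose proof (Cnorm2_pos (a n)); pose proof (Cnorm2_pos (a m)); lra.
  - destruct (Nat.lt_ge_cases m n) as [H|H].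
    + rewrite Nat.max_l, Nat.min_r by lia; apply main; lia.
    + rewrite Nat.max_r, Nat.min_l by lia; rewrite Rplus_comm.
      rewrite (Int_ext _ (fun t => sin (s * t) * (osc (a m) (l m) t * osc (a n) (l n) t)))
        by (intros; ring).
      apply main; lia.
Qed.

(** * Ingham's inequality for exponents close to the real axis *)

Definition fam (a l : nat -> Cpx) (N : nat) (t : R) : R :=
  Rsum1 (fun n => osc (a n) (l n) t) N.

Lemma cont_fam (a l : nat -> Cpx) (N : nat) : cont (fam a l N).
Proof. unfold fam; auto with cont. Qed.
#[export] Hint Resolve cont_fam : cont.

(** [osc] is twice the real part of a number of modulus e^(- Im l t) |a|. *)
Lemma osc_sqr_le (a l : Cpx) (t : R) :
  osc a l t * osc a l t <= 4 * exp (- (2 * Cim l * t)) * Cnorm2 a.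
Proof.
  unfold osc, wave, Cnorm2; destruct a as [x y], l as [p q]; simpl.
  replace (- (2 * q * t)) with (- (q * t) + - (q * t)) by ring; rewrite exp_plus.
  pose proof (sin2_cos2 (p * t)) as H; unfold Rsqr in H.
  set (e := exp (- (q * t))); set (c := cos (p * t)) in *; set (s := sin (p * t)) in *.
  assert (Hxy : (x * c - y * s) * (x * c - y * s) <= x * x + y * y).
  { replace (x * x + y * y) with ((x * x + y * y) * (s * s + c * c)) by (rewrite H; ring).
    pose proof (Rle_0_sqr (x * s + y * c)) as Hq; unfold Rsqr in Hq; nra. }
  pose proof (Rmult_le_compat_l (4 * (e * e)) _ _ ltac:(nra) Hxy); nra.
Qed.

(** The windowed energy is the quadratic form of the Gram matrix, and Schur's test bounds its
    off-diagonal part independently of N. The diagonal is kept exact, because it is estimated from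
    below for one inequality and from above for the other. *)
Lemma window_gram (T g eps P : R) (l a : nat -> Cpx) (n0 N : nat) :
  0 < T -> let s := PI / T in let th := (g * g - 4 * (eps * eps)) / (4 * (s * s)) in
  1 <= th -> 0 < g -> 0 <= eps -> 0 < P -> 4 * (eps * eps) + s * s <= P * P ->
  separated l n0 g eps P -> (forall k, (k < n0)%nat -> a k = (0, 0)) ->
  Rabs (Int (fun t => sin (s * t) * (fam a l N t * fam a l N t)) 0 T
        - Rsum1 (fun n => Int (fun t => sin (s * t) * (osc (a n) (l n) t * osc (a n) (l n) t)) 0 T) N)
  <= 4 * (s * (1 + exp (2 * eps * T)) * (/ (2 * th * (s * s)) + / (g * P)))
     * Rsum1 (fun n => Cnorm2 (a n)) N.
Proof.
  intros HT s th Hth Hg Heps HP HPs Hsep Ha.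
  assert (Hs : 0 < s) by (apply Rdiv_lt_0_compat; [apply PI_RGT_0|lra]).
  pose (G n m := Int (fun t => sin (s * t) * (osc (a n) (l n) t * osc (a m) (l m) t)) 0 T).
  assert (HG : Int (fun t => sin (s * t) * (fam a l N t * fam a l N t)) 0 T
               = Rsum1 (fun n => Rsum1 (fun m => G n m) N) N).
  { rewrite (Int_ext _ (fun t => Rsum1 (fun n => Rsum1 (fun m =>
      sin (s * t) * (osc (a n) (l n) t * osc (a m) (l m) t)) N) N)).
    2: { intros t; unfold fam; rewrite Rsum1_sqr, <- Rsum1_scal.
         apply Rsum1_ext; intros; now rewrite <- Rsum1_scal. }
    rewrite Int_Rsum1; auto 10 with cont; apply Rsum1_ext; intros.
    rewrite Int_Rsum1; auto 10 with cont. }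
  rewrite HG; fold G.
  assert (HD : Rsum1 (fun n => Rsum1 (fun m => G n m) N) N - Rsum1 (fun n => G n n) N
    = Rsum1 (fun n => Rsum1 (fun m => G n m + -1 * (if Nat.eq_dec n m then G m m else 0)) N) N).
  { rewrite (Rsum1_ext (fun n => Rsum1 (fun m => _ + _) N)
      (fun n => Rsum1 (fun m => G n m) N + -1 * G n n)).
    2: { intros n Hn; rewrite Rsum1_plus, Rsum1_scal, Rsum1_delta; trivial. }
    rewrite Rsum1_plus, Rsum1_scal; ring. }
  change (Rsum1 (fun n => Int _ 0 T) N) with (Rsum1 (fun n => G n n) N).
  rewrite HD; eapply Rle_trans; [apply Rsum1_abs|].
  eapply Rle_trans; [|apply (Rsum1_schur (gram_kernel s th g P (exp (2 * eps * T))))].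
  - apply Rsum1_le; intros n Hn; eapply Rle_trans; [apply Rsum1_abs|].
    apply Rsum1_le; intros m Hm; destruct (Nat.eq_dec n m) as [->|Hnm].
    + replace (_ + _) with 0 by ring; rewrite Rabs_R0.
      apply Rmult_le_pos; [apply gram_kernel_nonneg; trivial; [lra|apply exp_pos]|].
      pose proof (Cnorm2_pos (a m)); lra.
    + replace (G n m + -1 * 0) with (G n m) by ring; now apply (gram_offdiag T g eps P l a n0).
  - reflexivity.
  - intros; apply gram_kernel_nonneg; trivial; [lra|apply exp_pos].
  - intros; apply gram_kernel_sum; trivial; [lra|apply exp_pos].
  - intros; apply Cnorm2_pos.
Qed.

(** The square of one oscillation is 2 |a|^2 e^(- 2 Im l t) plus a wave of frequency at least 2 P.
    The former gives the main term, the latter the error with 1 / P^2. *)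
Lemma window_diag_lower (T eps P : R) (a l : Cpx) :
  0 < T -> let s := PI / T in
  0 <= eps -> 0 < P -> 4 * (eps * eps) + s * s <= P * P ->
  Rabs (Cim l) <= eps -> P <= Cre l ->
  (2 * (s * (1 + exp (- (2 * eps * T))) / (s * s + 4 * (eps * eps)))
   - 2 * (s * (1 + exp (2 * eps * T)) / (P * P))) * Cnorm2 a
  <= Int (fun t => sin (s * t) * (osc a l t * osc a l t)) 0 T.
Proof.
  intros HT s Heps HP HPs Hq Hp.
  assert (Hs : 0 < s) by (apply Rdiv_lt_0_compat; [apply PI_RGT_0|lra]).
  apply Rabs_le_between in Hq.
  set (q := Cim l + Cim l).
  assert (Hqq : q * q <= 4 * (eps * eps)) by (unfold q; nra).
  rewrite (Int_ext _ (fun t =>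
    2 * (sin (s * t) * wave (Cre (Cmul a a)) (Cim (Cmul a a)) (Cre l + Cre l) q t)
    + 2 * Cnorm2 a * (sin (s * t) * exp (- (q * t))))).
  2: { intros t; rewrite osc_mul; fold q; replace (Cre l - Cre l) with 0 by ring.
       unfold wave at 2; rewrite Rmult_0_l, cos_0, sin_0; unfold Cnorm2; destruct a; simpl; ring. }
  rewrite Int_plus, !Int_scal by auto 15 with cont.
  pose proof (sine_window_diag T q HT) as Hdiag; cbv zeta in Hdiag; fold s in Hdiag.
  rewrite Hdiag; clear Hdiag.
  pose proof (exp_pos (2 * eps * T)) as HE; set (E := exp (2 * eps * T)) in *.
  pose proof (Cnorm2_pos a) as Hx.
  assert (HEq : exp (- (q * T)) <= E) by (apply exp_le; unfold q; nra).
  assert (HEq' : exp (- (2 * eps * T)) <= exp (- (q * T))) by (apply exp_le; unfold q; nra).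
  assert (B : Rabs (Int (fun t => sin (s * t) *
     wave (Cre (Cmul a a)) (Cim (Cmul a a)) (Cre l + Cre l) q t) 0 T)
     <= s * (1 + E) / (P * P) * Cnorm2 a).
  { apply sine_window_wave with (P * P); trivial; fold s.
    - nra.
    - nra.
    - replace (s * (1 + E) / (P * P) * (P * P)) with (s * (1 + E)) by (field; lra).
      apply Rmult_le_compat_l; lra.
    - apply Rlt_le, Rdiv_lt_0_compat; nra.
    - change (Cnorm2 (Cmul a a) <= Cnorm2 a * Cnorm2 a); rewrite Cnorm2_mul; lra. }
  apply Rabs_le_between in B.
  assert (Hd : s * (1 + exp (- (2 * eps * T))) / (s * s + 4 * (eps * eps))
               <= s * (1 + exp (- (q * T))) / (s * s + q * q)).
  { pose proof (exp_pos (- (2 * eps * T))).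
    unfold Rdiv; apply Rmult_le_compat.
    - nra.
    - apply Rlt_le, Rinv_0_lt_compat; nra.
    - nra.
    - apply Rinv_le_contravar; nra. }
  pose proof (Rmult_le_compat_r _ _ _ Hx Hd); lra.
Qed.

Lemma fam_energy_shift (a l : nat -> Cpx) (N : nat) (T : R) :
  Int (fun t => fam a l N t * fam a l N t) 0 T
  = Int (fun t => fam a l N (t - T) * fam a l N (t - T)) T (2 * T).
Proof.
  pose proof (Int_shift (fun t => fam a l N t * fam a l N t) 1 (- T) T (2 * T)
    ltac:(auto with cont)) as H.
  replace (1 * T + - T) with 0 in H by ring.
  replace (1 * (2 * T) + - T) with T in H by ring.
  rewrite <- H; apply Int_ext; intros t.
  replace (1 * t + - T) with (t - T) by ring; ring.
Qed.

Definition cshift (l : Cpx) (T : R) (a : Cpx) : Cpx :=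
  Cmul a (Cexp (Cmul Ci (Cmul l (RtoC (- T))))).

Lemma osc_shift (a l : Cpx) (T t : R) : osc (cshift l T a) l t = osc a l (t - T).
Proof.
  unfold osc, wave, cshift; destruct a as [x y], l as [p q]; unfold Cexp; simpl.
  replace (0 * (p * - T - q * 0) + 1 * (p * 0 + q * - T)) with (- (q * T)) by ring.
  replace (0 * (p * 0 + q * - T) + 1 * (p * - T - q * 0)) with (- (p * T)) by ring.
  replace (0 * (p * - T - q * 0) - 1 * (p * 0 + q * - T)) with (q * T) by ring.
  rewrite cos_neg, sin_neg.
  replace (p * (t - T)) with (p * t - p * T) by ring.
  replace (- (q * (t - T))) with (- (q * t) + q * T) by ring.
  rewrite exp_plus, cos_minus, sin_minus; ring.
Qed.

Lemma Cnorm2_cshift (a l : Cpx) (T : R) :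
  Cnorm2 (cshift l T a) = exp (2 * Cim l * T) * Cnorm2 a.
Proof.
  unfold cshift; rewrite Cnorm2_mul; destruct a as [x y], l as [p q]; unfold Cnorm2 at 2, Cexp; simpl.
  replace (0 * (p * - T - q * 0) - 1 * (p * 0 + q * - T)) with (q * T) by ring.
  replace (2 * q * T) with (q * T + q * T) by ring; rewrite exp_plus.
  set (z := 0 * (p * 0 + q * - T) + 1 * (p * - T - q * 0)).
  pose proof (sin2_cos2 z) as H; unfold Rsqr in H.
  replace (exp (q * T) * cos z * (exp (q * T) * cos z) + exp (q * T) * sin z * (exp (q * T) * sin z))
    with (exp (q * T) * exp (q * T) * (sin z * sin z + cos z * cos z)) by ring.
  rewrite H; ring.
Qed.

Lemma sin_ge_half (x : R) : PI / 3 <= x <= 2 * (PI / 3) -> 1 / 2 <= sin x.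
Proof.
  pose proof PI_RGT_0; intros [H1 H2]; rewrite <- sin_PI6.
  destruct (Rle_dec x (PI / 2)) as [H3|H3].
  - apply sin_incr_1; lra.
  - rewrite <- (sin_PI_x x); apply sin_incr_1; lra.
Qed.

(** As eps -> 0 and P -> infinity, the diagonal bound minus the Schur bound tends to phi 0 = 4 (g^2
    - 4 s^2) / (s g^2), which is positive exactly when g > 2 s = 2 PI / T. This is the source of the
    threshold on T. Continuity of [phi] provides eps, and P is taken large afterwards. *)
Lemma ingham_parameters (T g : R) :
  0 < T -> 2 * PI / T < g -> let s := PI / T in
  exists eps P c, 0 < eps /\ 0 < P /\ 0 < c /\
    4 * (s * s) <= g * g - 4 * (eps * eps) /\ 4 * (eps * eps) + s * s <= P * P /\
    c <= 2 * (s * (1 + exp (- (2 * eps * T))) / (s * s + 4 * (eps * eps)))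
      - 2 * (s * (1 + exp (2 * eps * T)) / (P * P))
      - 4 * (s * (1 + exp (2 * eps * T)) *
          (/ (2 * ((g * g - 4 * (eps * eps)) / (4 * (s * s))) * (s * s)) + / (g * P))).
Proof.
  intros HT Hg s.
  assert (Hs : 0 < s) by (apply Rdiv_lt_0_compat; [apply PI_RGT_0|lra]).
  replace (2 * PI / T) with (2 * s) in Hg by (unfold s; field; lra).
  pose (phi e := 2 * (s * (1 + exp (- (2 * e * T))) / (s * s + 4 * (e * e)))
     - 4 * (s * (1 + exp (2 * e * T)) * (2 / (g * g - 4 * (e * e))))).
  assert (Hphi : continuous phi 0).
  { apply (ex_derive_continuous phi); unfold phi; auto_derive; repeat split; nra. }
  assert (Hphi0 : 0 < phi 0).
  { unfold phi; rewrite !Rmult_0_r, !Rmult_0_l, Ropp_0, exp_0.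
    replace (_ - _) with (4 * (g * g - 4 * (s * s)) / (s * (g * g))).
    - apply Rdiv_lt_0_compat; [nra|apply Rmult_lt_0_compat; nra].
    - field; split; nra. }
  destruct (proj1 (filterlim_locally _ _) Hphi (mkposreal _ (Rlt_mult_inv_pos _ 2 Hphi0 ltac:(lra))))
    as [d Hd].
  (* The first entry keeps phi eps above phi 0 / 2, the second keeps 4 s^2 + 4 eps^2 below g^2. *)
  set (eps := Rmin (d / 2) ((g - 2 * s) / 4)).
  pose proof (cond_pos d) as Hdp.
  assert (He0 : 0 < eps) by (apply Rmin_glb_lt; lra).
  assert (He1 : eps <= d / 2) by apply Rmin_l.
  assert (He2 : eps <= (g - 2 * s) / 4) by apply Rmin_r.
  assert (Hpe : phi 0 / 2 < phi eps).
  { specialize (Hd eps).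
    assert (Hb : ball 0 d eps).
    { change (Rabs (eps - 0) < d); rewrite Rminus_0_r, Rabs_right; lra. }
    specialize (Hd Hb); change (Rabs (phi eps - phi 0) < phi 0 * / 2) in Hd.
    apply Rabs_lt_between in Hd; lra. }
  assert (Hge : 4 * (s * s) < g * g - 4 * (eps * eps)) by nra.
  set (K := s * (1 + exp (2 * eps * T))).
  assert (HK : 0 < K) by (pose proof (exp_pos (2 * eps * T)); unfold K; nra).
  (* The summand 1 gives 1 / P^2 <= 1 / P, 2 eps + s gives 4 eps^2 + s^2 <= P^2, and the last one
     makes the errors containing P at most phi 0 / 8. *)
  set (P := 1 + 2 * eps + s + 8 * (2 * K + 4 * K / g) / phi 0).
  assert (Hkg : 0 < 4 * K / g) by (apply Rdiv_lt_0_compat; lra).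
  assert (HP' : 0 < 8 * (2 * K + 4 * K / g) / phi 0) by (apply Rdiv_lt_0_compat; lra).
  assert (HP1 : 1 <= P) by (unfold P; lra).
  exists eps, P, (phi 0 / 4); repeat split; trivial; try lra.
  - assert (2 * eps + s <= P) by (unfold P; lra); nra.
  - replace (/ (2 * ((g * g - 4 * (eps * eps)) / (4 * (s * s))) * (s * s)))
      with (2 / (g * g - 4 * (eps * eps))) by (field; split; nra).
    fold K.
    assert (E1 : 2 * (K / (P * P)) <= 2 * K / P).
    { replace (2 * K / P) with (2 * (K / P)) by (field; lra).
      apply Rmult_le_compat_l; [lra|]; unfold Rdiv; apply Rmult_le_compat_l; [lra|].
      apply Rinv_le_contravar; nra. }
    assert (E2 : 4 * (K * / (g * P)) = 4 * K / g / P) by (field; lra).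
    assert (E3 : 2 * K / P + 4 * K / g / P <= phi 0 / 8).
    { replace (2 * K / P + 4 * K / g / P) with ((2 * K + 4 * K / g) / P) by (field; lra).
      apply Rle_div_l; [lra|].
      assert (8 * (2 * K + 4 * K / g) / phi 0 <= P) by (unfold P; lra).
      apply Rle_div_l in H; lra. }
    unfold phi in Hpe at 2; fold K in Hpe.
    rewrite Rmult_plus_distr_l; lra.
Qed.

(** The window is at most 1, so the windowed energy on [0, T] bounds the energy from below. For the
    upper bound a window three times as long is at least 1/2 on its middle third, onto which the
    family is translated. [eps] and [P] are produced before [l]: an exponent sequence can then be
    cut where it becomes separated. *)
Lemma ingham (T g : R) :
  0 < T -> 2 * PI / T < g -> exists eps P c B, 0 < eps /\ 0 < c /\ 0 <= B /\
  forall (l : nat -> Cpx) (n0 : nat), separated l n0 g eps P ->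
  forall (a : nat -> Cpx) (N : nat), (forall k, (k < n0)%nat -> a k = (0, 0)) ->
    c * Rsum1 (fun n => Cnorm2 (a n)) N <= Int (fun t => fam a l N t * fam a l N t) 0 T /\
    Int (fun t => fam a l N t * fam a l N t) 0 T <= B * Rsum1 (fun n => Cnorm2 (a n)) N.
Proof.
  intros HT Hg; destruct (ingham_parameters T g HT Hg)
    as (eps & P & c & Heps & HP & Hc & Hth & HPs & Hcb); cbv zeta in *.
  set (s := PI / T) in *.
  assert (Hs : 0 < s) by (apply Rdiv_lt_0_compat; [apply PI_RGT_0|lra]).
  replace (2 * PI / T) with (2 * s) in Hg by (unfold s; field; lra).
  assert (Hg0 : 0 < g) by lra.
  (* On [T, 2 T] the argument s3 t runs through [PI / 3, 2 PI / 3], where the sine is at least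
     1/2. *)
  set (T3 := 3 * T); set (s3 := PI / T3).
  assert (Hs3 : s3 = s / 3) by (unfold s3, s, T3; field; lra).
  set (th3 := (g * g - 4 * (eps * eps)) / (4 * (s3 * s3))).
  set (k3 := s3 * (1 + exp (2 * eps * T3)) * (/ (2 * th3 * (s3 * s3)) + / (g * P))).
  set (B0 := T3 * (4 * exp (2 * eps * T3)) + 4 * k3).
  assert (Hth3 : 1 <= th3).
  { unfold th3; rewrite Hs3; apply Rle_div_r; nra. }
  assert (HB0 : 0 <= B0).
  { pose proof (exp_pos (2 * eps * T3)); unfold B0, k3.
    assert (0 < / (2 * th3 * (s3 * s3))).
    { apply Rinv_0_lt_compat, Rmult_lt_0_compat; [lra|rewrite Hs3; nra]. }
    assert (0 < / (g * P)) by (apply Rinv_0_lt_compat, Rmult_lt_0_compat; lra).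
    apply Rplus_le_le_0_compat; [apply Rmult_le_pos; [unfold T3|]; lra|].
    apply Rmult_le_pos; [lra|]; apply Rmult_le_pos; [apply Rmult_le_pos|]; lra. }
  exists eps, P, c, (2 * B0 * exp (2 * eps * T)); repeat split; trivial.
  { pose proof (exp_pos (2 * eps * T)); apply Rmult_le_pos; lra. }
  - set (S := Rsum1 (fun n => Cnorm2 (a n)) N).
    assert (HS : 0 <= S) by (apply Rsum1_nonneg; intros; apply Cnorm2_pos).
    pose proof (window_gram T g eps P l a n0 N HT) as HW; cbv zeta in HW; fold s in HW.
    specialize (HW ltac:(apply Rle_div_r; nra) ltac:(lra) ltac:(lra) HP HPs H H0).
    fold S in HW; apply Rabs_le_between in HW.
    assert (HD : (2 * (s * (1 + exp (- (2 * eps * T))) / (s * s + 4 * (eps * eps)))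
      - 2 * (s * (1 + exp (2 * eps * T)) / (P * P))) * S
      <= Rsum1 (fun n => Int (fun t => sin (s * t) * (osc (a n) (l n) t * osc (a n) (l n) t)) 0 T) N).
    { unfold S; rewrite <- Rsum1_scal; apply Rsum1_le; intros n Hn.
      destruct (Nat.lt_ge_cases n n0) as [Hlt|Hge].
      - rewrite (H0 n Hlt), (Int_ext _ (fun _ => 0)), Int_const.
        + unfold Cnorm2; simpl; lra.
        + intros t; unfold osc, wave; simpl; ring.
      - destruct H as [Hl _]; destruct (Hl n Hge); apply window_diag_lower; trivial; lra. }
    apply Rle_trans with (Int (fun t => sin (s * t) * (fam a l N t * fam a l N t)) 0 T).
    + pose proof (Rmult_le_compat_r _ _ _ HS Hcb); lra.
    + apply Int_le; auto 10 with cont; [lra|]; intros t Ht.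
      pose proof (SIN_bound (s * t)); pose proof (Rle_0_sqr (fam a l N t)) as Hsq.
      unfold Rsqr in Hsq; nra.
  (* Coefficients of the family translated by T; their squares grow at most by the factor e^(2 eps
     T). *)
  - pose (b n := cshift (l n) T (a n)).
    assert (Hb : forall k, (k < n0)%nat -> b k = (0, 0)).
    { intros k Hk; unfold b, cshift; rewrite (H0 k Hk); unfold Cmul; simpl; f_equal; ring. }
    set (S := Rsum1 (fun n => Cnorm2 (b n)) N).
    assert (HSb : S <= exp (2 * eps * T) * Rsum1 (fun n => Cnorm2 (a n)) N).
    { unfold S; rewrite <- Rsum1_scal; apply Rsum1_le; intros n Hn; unfold b.
      rewrite Cnorm2_cshift; destruct (Nat.lt_ge_cases n n0) as [Hlt|Hge].
      - rewrite (H0 n Hlt); unfold Cnorm2; simpl; lra.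
      - destruct H as [Hl _]; destruct (Hl n Hge) as [Hq _]; apply Rabs_le_between in Hq.
        apply Rmult_le_compat_r; [apply Cnorm2_pos|]; apply exp_le; nra. }
    assert (HS : 0 <= S) by (apply Rsum1_nonneg; intros; apply Cnorm2_pos).
    assert (HT3 : 0 < T3) by (unfold T3; lra).
    pose proof (window_gram T3 g eps P l b n0 N HT3) as HW; cbv zeta in HW; fold s3 in HW.
    fold th3 in HW; fold k3 in HW.
    specialize (HW Hth3 ltac:(lra) ltac:(lra) HP ltac:(rewrite Hs3; nra) H Hb).
    fold S in HW; apply Rabs_le_between in HW.
    assert (HD : Rsum1 (fun n => Int (fun t => sin (s3 * t) * (osc (b n) (l n) t * osc (b n) (l n) t)) 0 T3) N
      <= T3 * (4 * exp (2 * eps * T3)) * S).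
    { unfold S; rewrite <- Rsum1_scal; apply Rsum1_le; intros n Hn.
      destruct (Nat.lt_ge_cases n n0) as [Hlt|Hge].
      - rewrite (Hb n Hlt), (Int_ext _ (fun _ => 0)), Int_const.
        + unfold Cnorm2; simpl; lra.
        + intros t; unfold osc, wave; simpl; ring.
      - apply Rle_trans with (Int (fun _ => 4 * exp (2 * eps * T3) * Cnorm2 (b n)) 0 T3).
        + apply Int_le; auto 10 with cont; [lra|]; intros t Ht.
          pose proof (osc_sqr_le (b n) (l n) t) as Ho.
          pose proof (Rle_0_sqr (osc (b n) (l n) t)) as Hsq; unfold Rsqr in Hsq.
          pose proof (SIN_bound (s3 * t)).
          apply Rle_trans with (osc (b n) (l n) t * osc (b n) (l n) t); [nra|].
          eapply Rle_trans; [exact Ho|].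
          apply Rmult_le_compat_r; [apply Cnorm2_pos|]; apply Rmult_le_compat_l; [lra|].
          destruct H as [Hl _]; destruct (Hl n Hge) as [Hq _]; apply Rabs_le_between in Hq.
          apply exp_le; nra.
        + rewrite Int_const; lra. }
    rewrite fam_energy_shift.
    apply Rle_trans with (2 * Int (fun t => sin (s3 * t) * (fam b l N t * fam b l N t)) 0 T3).
    + rewrite <- Int_scal by auto 10 with cont.
      apply Rle_trans with (Int (fun t => 2 * (sin (s3 * t) * (fam b l N t * fam b l N t))) T (2 * T)).
      * assert (Hf : forall t, fam a l N (t - T) = fam b l N t).
        { intros t; unfold fam; apply Rsum1_ext; intros n _; unfold b; now rewrite osc_shift. }
        rewrite (Int_ext _ (fun t => fam b l N t * fam b l N t)) by (intros; now rewrite Hf).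
        apply Int_le; auto 10 with cont; [lra|]; intros t Ht.
        assert (1 / 2 <= sin (s3 * t)).
        { assert (Hst : PI / 3 = s3 * T) by (unfold s3, T3; field; lra).
          assert (0 < s3) by (rewrite Hs3; lra).
          apply sin_ge_half; rewrite Hst; nra. }
        pose proof (Rle_0_sqr (fam b l N t)) as Hsq; unfold Rsqr in Hsq; nra.
      * apply Int_sub; try (unfold T3; lra); auto 10 with cont; intros t Ht.
        assert (0 <= sin (s3 * t)).
        { assert (Hst : PI = s3 * T3) by (unfold s3; field; lra).
          assert (0 < s3) by (rewrite Hs3; lra).
          apply sin_ge_0; [nra|rewrite Hst; nra]. }
        pose proof (Rle_0_sqr (fam b l N t)) as Hsq; unfold Rsqr in Hsq; nra.
    + apply Rle_trans with (2 * (B0 * S)); [unfold B0; lra|].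
      replace (2 * B0 * exp (2 * eps * T) * _) with
        (2 * (B0 * (exp (2 * eps * T) * Rsum1 (fun n => Cnorm2 (a n)) N))) by ring.
      apply Rmult_le_compat_l; [lra|]; now apply Rmult_le_compat_l.
Qed.

(** * Exponents with a limiting imaginary part *)

Lemma liminf_gap (u : nat -> R) (g g' : R) :
  liminf_eq (fun n => u (S n) - u n) g -> g' < g ->
  exists n0, forall n m, (n0 <= m)%nat -> (m <= n)%nat -> g' * (INR n - INR m) <= u n - u m.
Proof.
  intros H Hg; destruct (H (g - g') ltac:(lra)) as [[n0 Hn0] _]; exists n0.
  intros n m Hm Hn; induction Hn as [|n Hn IH]; [lra|].
  specialize (Hn0 n ltac:(lia)); rewrite S_INR; lra.
Qed.

Lemma INR_unbounded (x : R) : exists n, x <= INR n.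
Proof.
  destruct (INR_archimed 1 x ltac:(lra)) as [n Hn]; exists n; lra.
Qed.

Lemma gap_unbounded (u : nat -> R) (g : R) (n0 : nat) : 0 < g ->
  (forall n m, (n0 <= m)%nat -> (m <= n)%nat -> g * (INR n - INR m) <= u n - u m) ->
  forall P, exists n1, forall n, (n1 <= n)%nat -> P <= u n.
Proof.
  intros Hg H P; destruct (INR_unbounded ((P - u n0) / g + INR n0)) as [k Hk].
  exists (Nat.max k n0); intros n Hn; specialize (H n n0 ltac:(lia) ltac:(lia)).
  assert (INR k <= INR n) by (apply le_INR; lia).
  assert (Hd : (P - u n0) / g <= INR n - INR n0) by lra.
  apply Rle_div_l in Hd; lra.
Qed.

Lemma liminf_unbounded (u : nat -> R) (g : R) :
  0 < g -> liminf_eq (fun n => u (S n) - u n) g ->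
  forall P, exists n1, forall n, (n1 <= n)%nat -> P <= u n.
Proof.
  intros Hg H; destruct (liminf_gap u g (g / 2) H ltac:(lra)) as [n0 Hn0].
  apply (gap_unbounded u (g / 2) n0); trivial; lra.
Qed.

Definition undamp (b : R) (l : nat -> Cpx) (n : nat) : Cpx := (Cre (l n), Cim (l n) - b).

Lemma separated_tail (l : nat -> Cpx) (gamma b g eps P : R) :
  0 < g -> g < gamma -> liminf_eq (fun n => Cre (l (S n)) - Cre (l n)) gamma ->
  Un_cv (fun n => Cim (l n)) b -> 0 < eps ->
  exists n0, (1 <= n0)%nat /\ separated (undamp b l) n0 g eps P.
Proof.
  intros Hg Hgg Hlim Hcv Heps.
  destruct (liminf_gap (fun n => Cre (l n)) gamma g Hlim Hgg) as [n1 Hn1].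
  destruct (gap_unbounded (fun n => Cre (l n)) g n1 Hg Hn1 P) as [n2 Hn2].
  destruct (Hcv eps Heps) as [n3 Hn3].
  exists (Nat.max 1 (Nat.max n1 (Nat.max n2 n3))); split; [lia|split].
  - intros n Hn; split; [apply Rlt_le, (Hn3 n); lia|apply (Hn2 n); lia].
  - intros n m Hm Hn; apply (Hn1 n m); lia.
Qed.

Lemma fam_undamp (b : R) (a l : nat -> Cpx) (N : nat) (t : R) :
  fam a (undamp b l) N t = exp (b * t) * fam a l N t.
Proof.
  unfold fam; rewrite <- Rsum1_scal; apply Rsum1_ext; intros n _.
  unfold osc, wave, undamp; simpl.
  replace (- ((Cim (l n) - b) * t)) with (b * t + - (Cim (l n) * t)) by ring.
  rewrite exp_plus; ring.
Qed.

(** Truncation by zeros instead of a shift of the index: sums keep running from 1 to N, and every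
    estimate for arbitrary coefficients applies to the parts. *)
Definition low (n0 : nat) (a : nat -> Cpx) (n : nat) : Cpx := if lt_dec n n0 then a n else (0, 0).
Definition high (n0 : nat) (a : nat -> Cpx) (n : nat) : Cpx := if lt_dec n n0 then (0, 0) else a n.

Lemma osc_0 (l : Cpx) (t : R) : osc (0, 0) l t = 0.
Proof. unfold osc, wave; simpl; ring. Qed.

Lemma Cnorm2_0 : Cnorm2 (0, 0) = 0.
Proof. unfold Cnorm2; simpl; ring. Qed.

Lemma fam_low_high (n0 : nat) (a l : nat -> Cpx) (N : nat) (t : R) :
  fam a l N t = fam (low n0 a) l N t + fam (high n0 a) l N t.
Proof.
  unfold fam; rewrite <- Rsum1_plus; apply Rsum1_ext; intros n _.
  unfold low, high; destruct (lt_dec n n0); rewrite osc_0; ring.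
Qed.

Lemma Rsum1_indicator (n0 N : nat) :
  Rsum1 (fun n => if lt_dec n n0 then 1 else 0) N <= INR n0.
Proof.
  apply Rle_trans with (Rsum1 (fun n => if lt_dec n n0 then 1 else 0) (N + n0)).
  - apply Rsum1_mono; [intros n _; destruct (lt_dec n n0); lra|lia].
  - rewrite (Rsum1_cut _ (N + n0) n0); [|lia|].
    + assert (H : forall k, Rsum1 (fun _ => 1) k = INR k).
      { intros k; induction k as [|k IH]; [reflexivity|]; rewrite Rsum1_S, IH, S_INR; ring. }
      rewrite <- (H n0); apply Rsum1_le; intros n _; destruct (lt_dec n n0); lra.
    + intros n Hn; destruct (lt_dec n n0); [lia|trivial].
Qed.

Lemma sqr_plus_le (x y : R) : (x + y) * (x + y) <= 2 * (x * x) + 2 * (y * y).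
Proof. pose proof (Rle_0_sqr (x - y)) as H; unfold Rsqr in H; nra. Qed.

(** Cauchy-Schwarz against the indicator of the indices below n0 costs at most the factor n0,
    whatever N is. *)
Lemma fam_low_le (K T : R) (n0 : nat) (a l : nat -> Cpx) (N : nat) (t : R) :
  (forall n, Rabs (Cim (l n)) <= K) -> 0 <= t <= T ->
  fam (low n0 a) l N t * fam (low n0 a) l N t
  <= INR n0 * (4 * exp (2 * K * T)) * Rsum1 (fun n => Cnorm2 (a n)) N.
Proof.
  intros HK Ht.
  assert (HE : fam (low n0 a) l N t =
    Rsum1 (fun n => (if lt_dec n n0 then 1 else 0) * osc (a n) (l n) t) N).
  { apply Rsum1_ext; intros n _; unfold low; destruct (lt_dec n n0); rewrite ?osc_0; ring. }
  rewrite HE; eapply Rle_trans; [apply Rsum1_cauchy_schwarz|].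
  rewrite Rmult_assoc; apply Rmult_le_compat.
  - apply Rsum1_nonneg; intros; nra.
  - apply Rsum1_nonneg; intros; apply Rle_0_sqr.
  - eapply Rle_trans; [|apply (Rsum1_indicator n0 N)]; apply Rsum1_le; intros n _.
    destruct (lt_dec n n0); lra.
  - rewrite <- Rsum1_scal; apply Rsum1_le; intros n _; eapply Rle_trans; [apply osc_sqr_le|].
    apply Rmult_le_compat_r; [apply Cnorm2_pos|]; apply Rmult_le_compat_l; [lra|].
    specialize (HK n); apply Rabs_le_between in HK; apply exp_le.
    assert (- Cim (l n) * t <= K * t) by (apply Rmult_le_compat_r; lra).
    assert (K * t <= K * T) by (apply Rmult_le_compat_l; lra); lra.
Qed.

Lemma Un_cv_bounded (u : nat -> R) (l : R) :
  Un_cv u l -> exists K, 0 < K /\ forall n, Rabs (u n) <= K.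
Proof. intros H; apply maj_by_pos; now exists l. Qed.

(** Multiplication by e^(b t) moves the tail into the strip of [ingham], and on [0, T] the factor
    e^(2 b t) lies between 1 and e^(2 b T), so both inequalities carry over. The upper one extends
    to all coefficients because finitely many low terms are bounded pointwise; the lower one stays
    restricted to the tail. *)
Lemma fam_estimates (l : nat -> Cpx) (gamma b T : R) :
  0 < T -> 2 * PI / T < gamma -> 0 <= b ->
  liminf_eq (fun n => Cre (l (S n)) - Cre (l n)) gamma ->
  Un_cv (fun n => Cim (l n)) b ->
  exists n0 c B, (1 <= n0)%nat /\ 0 < c /\ 0 <= B /\
    (forall a N, (forall k, (k < n0)%nat -> a k = (0, 0)) ->
      c * Rsum1 (fun n => Cnorm2 (a n)) N <= Int (fun t => fam a l N t * fam a l N t) 0 T) /\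
    (forall a N,
      Int (fun t => fam a l N t * fam a l N t) 0 T <= B * Rsum1 (fun n => Cnorm2 (a n)) N).
Proof.
  intros HT HTg Hb Hlim Hcv.
  (* Midpoint, so that 2 PI / T < g < gamma: the gap g holds from some index on and is still large
     enough for [ingham]. *)
  set (g := (gamma + 2 * PI / T) / 2).
  assert (Hpt : 0 < 2 * PI / T) by (apply Rdiv_lt_0_compat; [pose proof PI_RGT_0|]; lra).
  destruct (ingham T g HT ltac:(unfold g; lra)) as (eps & P & c & B & Heps & Hc & HB & Hing).
  destruct (separated_tail l gamma b g eps P ltac:(unfold g; lra) ltac:(unfold g; lra) Hlim Hcv Heps)
    as [n0 [Hn0 Hsep]].
  specialize (Hing _ _ Hsep).
  destruct (Un_cv_bounded _ _ Hcv) as [K [HK0 HK]].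
  assert (He : 0 < exp (2 * b * T)) by apply exp_pos.
  assert (Hsq : forall a N t, fam a (undamp b l) N t * fam a (undamp b l) N t
     = exp (2 * b * t) * (fam a l N t * fam a l N t)).
  { intros; rewrite fam_undamp; replace (2 * b * t) with (b * t + b * t) by ring.
    rewrite exp_plus; ring. }
  assert (Hup : forall a N, (forall k, (k < n0)%nat -> a k = (0, 0)) ->
     Int (fun t => fam a l N t * fam a l N t) 0 T <= B * Rsum1 (fun n => Cnorm2 (a n)) N).
  { intros a N Ha; eapply Rle_trans; [|apply (proj2 (Hing a N Ha))].
    apply Int_le; auto with cont; [lra|]; intros t Ht; rewrite Hsq.
    pose proof (Rle_0_sqr (fam a l N t)) as Hs; unfold Rsqr in Hs.
    assert (1 <= exp (2 * b * t)) by (rewrite <- exp_0; apply exp_le; nra); nra. }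
  exists n0, (c / exp (2 * b * T)), (2 * (T * (INR n0 * (4 * exp (2 * K * T)))) + 2 * B).
  pose proof (pos_INR n0) as Hn0'; pose proof (exp_pos (2 * K * T)) as HeK.
  repeat split; trivial.
  - now apply Rdiv_lt_0_compat.
  - assert (0 <= T * (INR n0 * (4 * exp (2 * K * T)))).
    { apply Rmult_le_pos; [lra|]; apply Rmult_le_pos; lra. }
    lra.
  - intros a N Ha; replace (c / exp (2 * b * T) * _) with
      (/ exp (2 * b * T) * (c * Rsum1 (fun n => Cnorm2 (a n)) N)) by (field; lra).
    apply Rmult_le_reg_l with (exp (2 * b * T)); trivial.
    rewrite <- Rmult_assoc, Rinv_r, Rmult_1_l by lra.
    eapply Rle_trans; [apply (proj1 (Hing a N Ha))|].
    rewrite <- Int_scal by auto with cont.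
    apply Int_le; auto with cont; [lra|]; intros t Ht; rewrite Hsq.
    pose proof (Rle_0_sqr (fam a l N t)) as Hs; unfold Rsqr in Hs.
    apply Rmult_le_compat_r; trivial; apply exp_le; nra.
  - intros a N; set (S := Rsum1 (fun n => Cnorm2 (a n)) N).
    apply Rle_trans with (Int (fun t => 2 * (INR n0 * (4 * exp (2 * K * T)) * S)
      + 2 * (fam (high n0 a) l N t * fam (high n0 a) l N t)) 0 T).
    + apply Int_le; auto 10 with cont; [lra|]; intros t Ht.
      rewrite (fam_low_high n0); eapply Rle_trans; [apply sqr_plus_le|].
      pose proof (fam_low_le K T n0 a l N t HK Ht) as Hl; fold S in Hl; lra.
    + rewrite Int_plus, !Int_scal, Int_const by auto 10 with cont.
      assert (Hh : Int (fun t => fam (high n0 a) l N t * fam (high n0 a) l N t) 0 T <= B * S).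
      { eapply Rle_trans; [apply Hup|].
        - intros k Hk; unfold high; destruct (lt_dec k n0); [trivial|lia].
        - apply Rmult_le_compat_l; trivial; apply Rsum1_le; intros n _; unfold high.
          destruct (lt_dec n n0); [rewrite Cnorm2_0; apply Cnorm2_pos|lra]. }
      lra.
Qed.

(** * Direct inequality, and inverse inequality for the tail *)

(** Merges the two regimes of (H4) into one factor; at n = n' the decaying value is taken. *)
Definition weight (nu : R) (n' n : nat) : R :=
  if le_dec n' n then Rpower (INR n) (- nu) else 1.

Lemma weight_bounds (nu : R) (n' n : nat) : 0 < nu -> (1 <= n)%nat -> 0 < weight nu n' n <= 1.
Proof.
  intros Hnu Hn; unfold weight; destruct (le_dec n' n); [|lra]; split; [apply exp_pos|].
  unfold Rpower; rewrite <- exp_0; apply exp_le.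
  assert (0 <= ln (INR n)).
  { rewrite <- ln_1; pose proof (INR_pos1 n Hn) as [H|H]; [apply Rlt_le, ln_increasing; lra|].
    rewrite <- H; lra. }
  nra.
Qed.

(** Comparison of a power with its integral, done with exponentials: 1 - 1/x <= e^(- 1/x) gives ln x
    - ln (x - 1) >= 1/x, and e^y >= 1 + y turns this into the claim. *)
Lemma Rpower_telescope (p : R) (n : nat) : 0 < p -> (2 <= n)%nat ->
  p * Rpower (INR n) (- p - 1) <= Rpower (INR (n - 1)) (- p) - Rpower (INR n) (- p).
Proof.
  intros Hp Hn; rewrite minus_INR by lia; simpl (INR 1).
  assert (Hx : 2 <= INR n) by (apply (le_INR 2); lia).
  generalize dependent (INR n); intros x Hx.
  assert (Hln : / x <= ln x - ln (x - 1)).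
  { assert (H : ln (x - 1) <= ln (x * exp (- / x))).
    { assert (Hle : x - 1 <= x * exp (- / x)).
      { pose proof (exp_ineq1_le (- / x)) as He.
        apply (Rmult_le_compat_l x) in He; [|lra].
        replace (x * (1 + - / x)) with (x - 1) in He by (field; lra); lra. }
      destruct Hle as [Hlt|Heq]; [apply Rlt_le, ln_increasing; lra|rewrite Heq at 1; lra]. }
    rewrite ln_mult, ln_exp in H; [lra|lra|apply exp_pos]. }
  unfold Rpower.
  replace (- p * ln (x - 1)) with (- p * ln x + p * (ln x - ln (x - 1))) by ring.
  replace ((- p - 1) * ln x) with (- p * ln x + - ln x) by ring.
  rewrite !exp_plus, exp_Ropp, exp_ln by lra.
  set (e := exp (- p * ln x)); assert (He : 0 < e) by apply exp_pos.
  pose proof (exp_ineq1_le (p * (ln x - ln (x - 1)))) as H1.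
  assert (H2 : p * / x <= p * (ln x - ln (x - 1))) by (apply Rmult_le_compat_l; lra).
  assert (H3 : e * (p * / x) <= e * (exp (p * (ln x - ln (x - 1))) - 1))
    by (apply Rmult_le_compat_l; lra).
  lra.
Qed.

(** Here nu > 1/2 enters: p = 2 nu - 1 is positive, so the squared weights n^(- p - 1) are
    summable. *)
Lemma weight_tail (nu : R) (n' : nat) (delta : R) : nu > 1 / 2 -> 0 < delta ->
  exists n0, (1 <= n0)%nat /\ forall n1 N, (n0 <= n1)%nat ->
    Rsum1 (fun n => if lt_dec n n1 then 0 else weight nu n' n * weight nu n' n) N <= delta.
Proof.
  intros Hnu Hd; set (p := 2 * nu - 1); assert (Hp : 0 < p) by (unfold p; lra).
  (* For x above this value x^(- p) / p <= delta. *)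
  destruct (INR_unbounded (exp (- ln (delta * p) / p))) as [k Hk].
  exists (Nat.max 2 (Nat.max n' (k + 1))); split; [lia|]; intros n1 N Hn1.
  (* Frozen below n1 - 1, so that the indices cut off by n1 contribute nothing to the telescoping
     sum. *)
  pose (F n := Rpower (INR (Nat.max n (n1 - 1))) (- p) / p).
  apply Rle_trans with (F 0%nat - F N).
  - apply Rsum1_telescope; intros n Hn; unfold F; destruct (lt_dec n n1) as [Hlt|Hge].
    + rewrite !Nat.max_r by lia; lra.
    + rewrite !Nat.max_l by lia; unfold weight; destruct (le_dec n' n); [|lia].
      rewrite <- Rpower_plus; replace (- nu + - nu) with (- p - 1) by (unfold p; ring).
      pose proof (Rpower_telescope p n Hp ltac:(lia)) as H.
      apply Rmult_le_reg_l with p; trivial.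
      replace (p * (Rpower (INR (n - 1)) (- p) / p - Rpower (INR n) (- p) / p))
        with (Rpower (INR (n - 1)) (- p) - Rpower (INR n) (- p)) by (field; lra); exact H.
  - assert (0 < F N) by (apply Rdiv_lt_0_compat; [apply exp_pos|trivial]).
    assert (F 0%nat <= delta); [|lra].
    unfold F; rewrite Nat.max_r by lia; apply Rle_div_l; trivial.
    assert (Hk1 : INR k <= INR (n1 - 1)) by (apply le_INR; lia).
    unfold Rpower; rewrite <- (exp_ln (delta * p)) by nra; apply exp_le.
    assert (Hln : - ln (delta * p) / p <= ln (INR (n1 - 1))).
    { rewrite <- (ln_exp (- ln (delta * p) / p)).
      pose proof (exp_pos (- ln (delta * p) / p)) as He.
      destruct (Rle_lt_or_eq_dec _ _ (Rle_trans _ _ _ Hk Hk1)) as [Hlt|Heq];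
        [apply Rlt_le, ln_increasing; lra|rewrite Heq; lra]. }
    apply Rle_div_l in Hln; lra.
Qed.

Lemma weight_sum_bounded (nu : R) (n' : nat) : nu > 1 / 2 ->
  exists W, 0 <= W /\ forall N, Rsum1 (fun n => weight nu n' n * weight nu n' n) N <= W.
Proof.
  intros Hnu; destruct (weight_tail nu n' 1 Hnu ltac:(lra)) as [n0 [_ H]].
  exists (INR n0 + 1); split; [pose proof (pos_INR n0); lra|]; intros N.
  specialize (H n0 N (Nat.le_refl _)); pose proof (Rsum1_indicator n0 N) as Hi.
  eapply Rle_trans; [|apply Rplus_le_compat; [exact Hi|exact H]].
  rewrite <- Rsum1_plus; apply Rsum1_le; intros n Hn.
  pose proof (weight_bounds nu n' n ltac:(lra) ltac:(lia)) as Hw.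
  destruct (lt_dec n n0); nra.
Qed.

Definition rho (r Rr : nat -> R) (N : nat) (t : R) : R :=
  Rsum1 (fun n => Rr n * exp (r n * t)) N.

Lemma cont_rho (r Rr : nat -> R) (N : nat) : cont (rho r Rr N).
Proof. unfold rho; auto 10 with cont. Qed.
#[export] Hint Resolve cont_rho : cont.

(** The real exponents accumulate at [chi] and have no gap, so the sum is bounded pointwise:
    Cauchy-Schwarz separates the square-summable weights from the coefficients. [w] is left free
    because the tail estimate uses weights cut off below n0, whose sum is small. *)
Lemma rho_sqr_le (r Rr w x : nat -> R) (K T mu : R) (N : nat) (t : R) :
  (forall n, Rabs (r n) <= K) -> 0 <= t <= T -> 0 <= mu ->
  (forall n, (1 <= n)%nat -> 0 <= w n) -> (forall n, (1 <= n)%nat -> 0 <= x n) ->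
  (forall n, (1 <= n)%nat -> Rabs (Rr n) <= mu * w n * sqrt (x n)) ->
  rho r Rr N t * rho r Rr N t
  <= mu * mu * exp (2 * K * T) * Rsum1 (fun n => w n * w n) N * Rsum1 x N.
Proof.
  intros HK Ht Hmu Hw Hx HR.
  set (S := Rsum1 (fun n => w n * sqrt (x n)) N).
  assert (HS : 0 <= S).
  { apply Rsum1_nonneg; intros n Hn; apply Rmult_le_pos; [apply Hw; lia|apply sqrt_pos]. }
  assert (HSS : S * S <= Rsum1 (fun n => w n * w n) N * Rsum1 x N).
  { eapply Rle_trans; [apply Rsum1_cauchy_schwarz|]; apply Req_le; f_equal.
    apply Rsum1_ext; intros n Hn; apply sqrt_sqrt, Hx; lia. }
  assert (He : 0 < exp (K * T)) by apply exp_pos.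
  assert (H : Rabs (rho r Rr N t) <= mu * exp (K * T) * S).
  { eapply Rle_trans; [apply Rsum1_abs|]; unfold S; rewrite <- Rsum1_scal.
    apply Rsum1_le; intros n Hn; rewrite Rabs_mult, (Rabs_right (exp _)) by
      (apply Rle_ge, Rlt_le, exp_pos).
    replace (mu * exp (K * T) * (w n * sqrt (x n))) with (mu * w n * sqrt (x n) * exp (K * T)) by ring.
    apply Rmult_le_compat; [apply Rabs_pos|apply Rlt_le, exp_pos|apply HR; lia|].
    specialize (HK n); apply Rabs_le_between in HK; apply exp_le.
    apply Rle_trans with (K * t); [apply Rmult_le_compat_r|apply Rmult_le_compat_l]; lra. }
  replace (2 * K * T) with (K * T + K * T) by ring; rewrite exp_plus.
  apply Rle_trans with ((mu * exp (K * T) * S) * (mu * exp (K * T) * S)).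
  - apply Rabs_le_between in H; nra.
  - replace (mu * exp (K * T) * S * (mu * exp (K * T) * S))
      with (mu * mu * (exp (K * T) * exp (K * T)) * (S * S)) by ring.
    rewrite (Rmult_assoc (_ * (exp _ * exp _))); apply Rmult_le_compat_l; trivial.
    apply Rmult_le_pos; nra.
Qed.

Definition U1 (om ze : nat -> Cpx) (r : nat -> R) (Cc Dd : nat -> Cpx) (Rr : nat -> R)
  (N : nat) (t : R) : R :=
  fam Cc om N t + (fam Dd ze N t + rho r Rr N t).

Definition U2 (om ze c d : nat -> Cpx) (eta : R) (Cc Dd : nat -> Cpx) (E : R)
  (N : nat) (t : R) : R :=
  fam (fun n => Cmul (d n) (Dd n)) ze N t
  + (fam (fun n => Cmul (c n) (Cc n)) om N t + E * exp (- eta * t)).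

Lemma cont_U1 om ze r Cc Dd Rr N : cont (U1 om ze r Cc Dd Rr N).
Proof. unfold U1; auto with cont. Qed.
Lemma cont_U2 om ze c d eta Cc Dd E N : cont (U2 om ze c d eta Cc Dd E N).
Proof. unfold U2; auto 10 with cont. Qed.
#[export] Hint Resolve cont_U1 cont_U2 : cont.

Lemma conj_pair_osc (a l : Cpx) (t : R) :
  Cadd (Cmul a (Cexp (Cmul Ci (Cmul l (RtoC t)))))
    (Cmul (Cconj a) (Cexp (Copp (Cmul Ci (Cmul (Cconj l) (RtoC t)))))) = (osc a l t, 0).
Proof.
  destruct a as [x y], l as [p q]; unfold osc, wave, Cexp, Cadd, Cmul; simpl.
  replace (0 * (p * t - q * 0) - 1 * (p * 0 + q * t)) with (- (q * t)) by ring.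
  replace (- (0 * (p * t - - q * 0) - 1 * (p * 0 + - q * t))) with (- (q * t)) by ring.
  replace (0 * (p * 0 + q * t) + 1 * (p * t - q * 0)) with (p * t) by ring.
  replace (- (0 * (p * 0 + - q * t) + 1 * (p * t - - q * 0))) with (- (p * t)) by ring.
  rewrite cos_neg, sin_neg; f_equal; ring.
Qed.

Lemma Cadd_assoc (a b c : Cpx) : Cadd a (Cadd b c) = Cadd (Cadd a b) c.
Proof. unfold Cadd; simpl; f_equal; ring. Qed.

Lemma u1_N_eq om ze Cc Dd r Rr N t :
  u1_N om ze Cc Dd r Rr N t = (U1 om ze r Cc Dd Rr N t, 0).
Proof.
  unfold u1_N, U1, fam, rho; rewrite <- !Rsum1_plus; induction N as [|N IH]; trivial; simpl.
  rewrite IH; unfold u1_term.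
  rewrite (Cadd_assoc (Cmul (Cc (S N)) _) (Cmul (Cconj (Cc (S N))) _)), !conj_pair_osc.
  unfold Cadd, RtoC; simpl; f_equal; ring.
Qed.

Lemma u2_N_eq om ze c d Cc Dd E eta N t :
  u2_N om ze c d Cc Dd E eta N t = (U2 om ze c d eta Cc Dd E N t, 0).
Proof.
  unfold u2_N, U2, fam; rewrite <- Rplus_assoc, <- Rsum1_plus.
  match goal with |- Cadd ?a _ = (?b + _, 0) => assert (H : a = (b, 0)) end.
  { induction N as [|N IH]; trivial; simpl; rewrite IH; unfold u2_term.
    rewrite (Cadd_assoc (Cmul (Cmul (d (S N)) _) _) (Cmul (Cconj (Cmul (d (S N)) _)) _)), !conj_pair_osc.
    unfold Cadd; simpl; f_equal; ring. }
  rewrite H; unfold Cadd, RtoC; simpl; f_equal; ring.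
Qed.

Definition admissible (mu nu : R) (n' : nat) (d Cc Dd : nat -> Cpx) (Rr : nat -> R) : Prop :=
  forall n, (1 <= n)%nat -> Rabs (Rr n) <= mu * weight nu n' n * sqrt (coef2 d Cc Dd n).

Definition energy om ze c d r eta T Cc Dd Rr E N : R :=
  Int (fun t => U1 om ze r Cc Dd Rr N t * U1 om ze r Cc Dd Rr N t
    + U2 om ze c d eta Cc Dd E N t * U2 om ze c d eta Cc Dd E N t) 0 T.

Lemma coef2_pos d Cc Dd n : 0 <= coef2 d Cc Dd n.
Proof. apply Rplus_le_le_0_compat; apply Cnorm2_pos. Qed.

Lemma Cnorm2_le_coef2 d Cc Dd n : Cnorm2 (Cc n) <= coef2 d Cc Dd n.
Proof. unfold coef2; pose proof (Cnorm2_pos (Cmul (d n) (Dd n))); lra. Qed.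

(** All six constituents of [U1] and [U2] are estimated separately. [Kd] converts |D_n|^2 into |d_n
    D_n|^2 and [Kc] bounds |c_n|^2. The term E^2 is kept apart, so the inequality applies to tails
    with E = 0 as well. *)
Lemma energy_direct om ze c d r gamma alpha T mu nu n' eta K Kc Kd :
  0 < T -> 2 * PI / T < gamma -> 0 <= alpha -> 0 <= mu -> nu > 1 / 2 -> 0 <= Kc -> 0 <= Kd ->
  liminf_eq (fun n => Cre (om (S n)) - Cre (om n)) gamma ->
  liminf_eq (fun n => Cre (ze (S n)) - Cre (ze n)) gamma ->
  Un_cv (fun n => Cim (om n)) alpha -> Un_cv (fun n => Cim (ze n)) 0 ->
  (forall n, Rabs (r n) <= K) ->
  (forall n, (1 <= n)%nat -> 1 <= Kd * Cnorm2 (d n)) ->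
  (forall n, (1 <= n)%nat -> Cnorm2 (c n) <= Kc) ->
  exists B, 0 <= B /\ forall Cc Dd Rr E N, admissible mu nu n' d Cc Dd Rr ->
    energy om ze c d r eta T Cc Dd Rr E N <= B * (Rsum1 (coef2 d Cc Dd) N + E * E).
Proof.
  intros HT HTg Hal Hmu Hnu HKc HKd L1 L2 V1 V2 HK Hd Hc.
  destruct (fam_estimates om gamma alpha T HT HTg Hal L1 V1) as (_ & _ & B1 & _ & _ & HB1 & _ & U1o).
  destruct (fam_estimates ze gamma 0 T HT HTg ltac:(lra) L2 V2) as (_ & _ & B2 & _ & _ & HB2 & _ & U2o).
  destruct (weight_sum_bounded nu n' Hnu) as [W [HW0 HW]].
  pose proof (exp_pos (2 * K * T)) as HeK; pose proof (exp_pos (2 * Rabs eta * T)) as HeE.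
  set (B3 := mu * mu * exp (2 * K * T) * W).
  assert (HB3 : 0 <= B3) by (unfold B3; repeat apply Rmult_le_pos; lra).
  exists (3 * B1 + 3 * (B2 * Kd) + 3 * (T * B3) + 3 * B2 + 3 * (B1 * Kc)
          + 3 * (T * exp (2 * Rabs eta * T))).
  assert (Hp1 : 0 <= B2 * Kd) by (apply Rmult_le_pos; lra).
  assert (Hp2 : 0 <= T * B3) by (apply Rmult_le_pos; lra).
  assert (Hp3 : 0 <= B1 * Kc) by (apply Rmult_le_pos; lra).
  assert (Hp4 : 0 <= T * exp (2 * Rabs eta * T)) by (apply Rmult_le_pos; lra).
  split; [lra|]; intros Cc Dd Rr E N HR.
  set (S := Rsum1 (coef2 d Cc Dd) N).
  assert (HS : 0 <= S) by (apply Rsum1_nonneg; intros; apply coef2_pos).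
  assert (E1 : Int (fun t => fam Cc om N t * fam Cc om N t) 0 T <= B1 * S).
  { eapply Rle_trans; [apply U1o|]; apply Rmult_le_compat_l; trivial.
    apply Rsum1_le; intros; apply Cnorm2_le_coef2. }
  assert (E2 : Int (fun t => fam Dd ze N t * fam Dd ze N t) 0 T <= B2 * Kd * S).
  { eapply Rle_trans; [apply U2o|]; rewrite Rmult_assoc; apply Rmult_le_compat_l; trivial.
    unfold S; rewrite <- Rsum1_scal; apply Rsum1_le; intros n Hn; unfold coef2.
    rewrite Cnorm2_mul; specialize (Hd n ltac:(lia)).
    pose proof (Cnorm2_pos (Cc n)); pose proof (Cnorm2_pos (Dd n)).
    assert (0 <= Kd * Cnorm2 (Cc n)) by now apply Rmult_le_pos.
    assert (1 * Cnorm2 (Dd n) <= Kd * Cnorm2 (d n) * Cnorm2 (Dd n)) by now apply Rmult_le_compat_r.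
    lra. }
  assert (E3 : forall t, 0 <= t <= T -> rho r Rr N t * rho r Rr N t <= B3 * S).
  { intros t Ht; eapply Rle_trans;
      [apply (rho_sqr_le r Rr (weight nu n') (coef2 d Cc Dd) K T mu); trivial|].
    - intros n Hn; apply Rlt_le, weight_bounds; trivial; lra.
    - intros; apply coef2_pos.
    - fold S; apply Rmult_le_compat_r; trivial; unfold B3; apply Rmult_le_compat_l; trivial.
      repeat apply Rmult_le_pos; lra. }
  assert (E4 : Int (fun t => fam (fun n => Cmul (d n) (Dd n)) ze N t
                 * fam (fun n => Cmul (d n) (Dd n)) ze N t) 0 T <= B2 * S).
  { eapply Rle_trans; [apply U2o|]; apply Rmult_le_compat_l; trivial.
    apply Rsum1_le; intros n _; unfold coef2; pose proof (Cnorm2_pos (Cc n)); lra. }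
  assert (E5 : Int (fun t => fam (fun n => Cmul (c n) (Cc n)) om N t
                 * fam (fun n => Cmul (c n) (Cc n)) om N t) 0 T <= B1 * Kc * S).
  { eapply Rle_trans; [apply U1o|]; rewrite Rmult_assoc; apply Rmult_le_compat_l; trivial.
    unfold S; rewrite <- Rsum1_scal; apply Rsum1_le; intros n Hn.
    rewrite Cnorm2_mul; apply Rmult_le_compat; try apply Cnorm2_pos.
    - apply Hc; lia.
    - apply Cnorm2_le_coef2. }
  assert (E6 : forall t, 0 <= t <= T ->
    (E * exp (- eta * t)) * (E * exp (- eta * t)) <= exp (2 * Rabs eta * T) * (E * E)).
  { intros t Ht; replace ((E * exp (- eta * t)) * (E * exp (- eta * t)))
      with (exp (- eta * t + - eta * t) * (E * E)) by (rewrite exp_plus; ring).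
    apply Rmult_le_compat_r; [apply Rle_0_sqr|]; apply exp_le.
    pose proof (Rle_abs (- eta)) as Ha; rewrite Rabs_Ropp in Ha; pose proof (Rabs_pos eta).
    assert (- eta * t <= Rabs eta * t) by (apply Rmult_le_compat_r; lra).
    assert (Rabs eta * t <= Rabs eta * T) by (apply Rmult_le_compat_l; lra); lra. }
  set (kk := 3 * (B3 * S) + 3 * (exp (2 * Rabs eta * T) * (E * E))).
  apply Rle_trans with (Int (fun t => 3 * (fam Cc om N t * fam Cc om N t)
    + 3 * (fam Dd ze N t * fam Dd ze N t)
    + 3 * (fam (fun n => Cmul (d n) (Dd n)) ze N t * fam (fun n => Cmul (d n) (Dd n)) ze N t)
    + 3 * (fam (fun n => Cmul (c n) (Cc n)) om N t * fam (fun n => Cmul (c n) (Cc n)) om N t)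
    + kk) 0 T).
  - unfold energy; apply Int_le; auto 15 with cont; [lra|]; intros t Ht.
    specialize (E3 t Ht); specialize (E6 t Ht); unfold U1, U2.
    assert (H3 : forall x y z, (x + (y + z)) * (x + (y + z)) <= 3 * (x * x) + 3 * (y * y) + 3 * (z * z)).
    { intros x y z; pose proof (Rle_0_sqr (x - y)); pose proof (Rle_0_sqr (y - z));
        pose proof (Rle_0_sqr (x - z)); unfold Rsqr in *; lra. }
    eapply Rle_trans; [apply Rplus_le_compat; apply H3|]; unfold kk; lra.
  - rewrite !Int_plus, !Int_scal, Int_const by auto 15 with cont.
    assert (0 <= E * E) by apply Rle_0_sqr.
    assert (0 <= (B1 + B2 * Kd + T * B3 + B2 + B1 * Kc) * (E * E)) by (apply Rmult_le_pos; lra).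
    assert (0 <= T * exp (2 * Rabs eta * T) * S) by now apply Rmult_le_pos.
    unfold kk; lra.
Qed.

(** The lower bounds for the om-part of [U1] and the ze-part of [U2] give the coefficients. The
    disturbing families carry the factors 1 / |d_n|^2 and |c_n|^2, and [rho] carries a tail of the
    weights; for n0 large each is a small fraction of the main terms. *)
Lemma energy_tail_inverse om ze c d r gamma alpha T mu nu n' eta K :
  0 < T -> 2 * PI / T < gamma -> 0 <= alpha -> 0 <= mu -> nu > 1 / 2 ->
  liminf_eq (fun n => Cre (om (S n)) - Cre (om n)) gamma ->
  liminf_eq (fun n => Cre (ze (S n)) - Cre (ze n)) gamma ->
  Un_cv (fun n => Cim (om n)) alpha -> Un_cv (fun n => Cim (ze n)) 0 ->
  (forall n, Rabs (r n) <= K) ->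
  (forall e, 0 < e -> exists n0, forall n, (n0 <= n)%nat -> 1 <= e * Cnorm2 (d n)) ->
  (forall e, 0 < e -> exists n0, forall n, (n0 <= n)%nat -> Cnorm2 (c n) <= e) ->
  exists n0 A, (1 <= n0)%nat /\ 0 < A /\ forall Cc Dd Rr N, admissible mu nu n' d Cc Dd Rr ->
    (forall k, (k < n0)%nat -> Cc k = (0, 0) /\ Dd k = (0, 0)) ->
    A * Rsum1 (coef2 d Cc Dd) N <= energy om ze c d r eta T Cc Dd Rr 0 N.
Proof.
  intros HT HTg Hal Hmu Hnu L1 L2 V1 V2 HK Hd Hc.
  destruct (fam_estimates om gamma alpha T HT HTg Hal L1 V1)
    as (m1 & c1 & B1 & Hm1 & Hc1 & HB1 & W1 & U1o).
  destruct (fam_estimates ze gamma 0 T HT HTg ltac:(lra) L2 V2)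
    as (m2 & c2 & B2 & _ & Hc2 & HB2 & W2 & U2o).
  set (a := Rmin c1 c2); assert (Ha : 0 < a) by (apply Rmin_glb_lt; trivial).
  assert (Ha1 : a <= c1) by apply Rmin_l; assert (Ha2 : a <= c2) by apply Rmin_r.
  pose proof (exp_pos (2 * K * T)) as HeK.
  set (Q := mu * mu * exp (2 * K * T)).
  assert (HQ : 0 <= Q) by (unfold Q; repeat apply Rmult_le_pos; lra).
  (* Budget: (x + y)^2 >= x^2 / 2 - y^2 leaves a / 2 of the main terms. The disturbing families take
     at most 2 a / 16 and the real exponentials 2 a / 16, so a / 8 is safe. *)
  assert (Hsmall : forall X, 0 <= X -> 0 < a / (16 * (X + 1)) /\ X * (a / (16 * (X + 1))) <= a / 16).
  { intros X HX; split; [apply Rdiv_lt_0_compat; lra|].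
    replace (X * (a / (16 * (X + 1)))) with (a * X / (16 * (X + 1))) by (field; lra).
    apply Rle_div_l; nra. }
  destruct (Hsmall B2 HB2) as [P1 P1']; destruct (Hsmall B1 HB1) as [P2 P2'].
  destruct (Hsmall (T * Q) ltac:(apply Rmult_le_pos; lra)) as [P3 P3'].
  destruct (Hd _ P1) as [m3 Hm3]; destruct (Hc _ P2) as [m4 Hm4].
  destruct (weight_tail nu n' _ Hnu P3) as [m5 [_ Hm5]].
  set (e1 := a / (16 * (B2 + 1))) in *; set (e2 := a / (16 * (B1 + 1))) in *;
    set (e3 := a / (16 * (T * Q + 1))) in *.
  set (n0 := Nat.max m1 (Nat.max m2 (Nat.max m3 (Nat.max m4 m5)))).
  exists n0, (a / 8); split; [lia|split; [lra|]]; intros Cc Dd Rr N HR Hz.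
  set (S := Rsum1 (coef2 d Cc Dd) N).
  assert (HS : 0 <= S) by (apply Rsum1_nonneg; intros; apply coef2_pos).
  set (SC := Rsum1 (fun n => Cnorm2 (Cc n)) N).
  set (SD := Rsum1 (fun n => Cnorm2 (Cmul (d n) (Dd n))) N).
  assert (HSS : S = SC + SD) by (unfold S, SC, SD; rewrite <- Rsum1_plus; reflexivity).
  assert (HSC : 0 <= SC) by (apply Rsum1_nonneg; intros; apply Cnorm2_pos).
  assert (HSD : 0 <= SD) by (apply Rsum1_nonneg; intros; apply Cnorm2_pos).
  assert (HdD0 : forall k, (k < n0)%nat -> Cmul (d k) (Dd k) = (0, 0)).
  { intros k Hk; rewrite (proj2 (Hz k Hk)); unfold Cmul; simpl; f_equal; ring. }
  assert (E1 : c1 * SC <= Int (fun t => fam Cc om N t * fam Cc om N t) 0 T).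
  { apply W1; intros k Hk; apply Hz; lia. }
  assert (E4 : c2 * SD <= Int (fun t => fam (fun n => Cmul (d n) (Dd n)) ze N t
                 * fam (fun n => Cmul (d n) (Dd n)) ze N t) 0 T).
  { apply (W2 (fun n => Cmul (d n) (Dd n))); intros k Hk; apply HdD0; lia. }
  assert (E2 : Int (fun t => fam Dd ze N t * fam Dd ze N t) 0 T <= B2 * e1 * SD).
  { eapply Rle_trans; [apply U2o|]; rewrite Rmult_assoc; apply Rmult_le_compat_l; trivial.
    unfold SD; rewrite <- Rsum1_scal; apply Rsum1_le; intros n Hn.
    destruct (Nat.lt_ge_cases n n0) as [Hlt|Hge].
    - rewrite (HdD0 n Hlt), (proj2 (Hz n Hlt)), Cnorm2_0; lra.
    - rewrite Cnorm2_mul; specialize (Hm3 n ltac:(lia)); pose proof (Cnorm2_pos (Dd n)).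
      assert (1 * Cnorm2 (Dd n) <= e1 * Cnorm2 (d n) * Cnorm2 (Dd n)) by now apply Rmult_le_compat_r.
      lra. }
  assert (E5 : Int (fun t => fam (fun n => Cmul (c n) (Cc n)) om N t
                 * fam (fun n => Cmul (c n) (Cc n)) om N t) 0 T <= B1 * e2 * SC).
  { eapply Rle_trans; [apply U1o|]; rewrite Rmult_assoc; apply Rmult_le_compat_l; trivial.
    unfold SC; rewrite <- Rsum1_scal; apply Rsum1_le; intros n Hn; rewrite Cnorm2_mul.
    destruct (Nat.lt_ge_cases n n0) as [Hlt|Hge].
    - rewrite (proj1 (Hz n Hlt)), Cnorm2_0; lra.
    - apply Rmult_le_compat_r; [apply Cnorm2_pos|]; apply Hm4; lia. }
  assert (E3 : forall t, 0 <= t <= T -> rho r Rr N t * rho r Rr N t <= Q * e3 * S).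
  (* Below n0 the coefficients vanish, hence so does [Rr] by admissibility, and the weight may be
     replaced by 0 there. *)
  { intros t Ht; pose (w n := if lt_dec n n0 then 0 else weight nu n' n).
    assert (Hw : forall n, (1 <= n)%nat -> 0 <= w n).
    { intros n Hn; unfold w; destruct (lt_dec n n0); [lra|].
      apply Rlt_le, weight_bounds; trivial; lra. }
    eapply Rle_trans; [apply (rho_sqr_le r Rr w (coef2 d Cc Dd) K T mu); trivial|].
    - intros; apply coef2_pos.
    - intros n Hn; specialize (HR n Hn); unfold w; destruct (lt_dec n n0) as [Hlt|Hge]; trivial.
      unfold coef2 in *; rewrite (HdD0 n Hlt), (proj1 (Hz n Hlt)), Cnorm2_0, Rplus_0_r, sqrt_0 in *; lra.
    - fold Q S; apply Rmult_le_compat_r; trivial; apply Rmult_le_compat_l; trivial.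
      eapply Rle_trans; [|apply (Hm5 n0 N); lia]; apply Req_le, Rsum1_ext; intros n _.
      unfold w; destruct (lt_dec n n0); ring. }
  set (kk := -2 * (Q * e3 * S)).
  apply Rle_trans with (Int (fun t => / 2 * (fam Cc om N t * fam Cc om N t)
    + / 2 * (fam (fun n => Cmul (d n) (Dd n)) ze N t * fam (fun n => Cmul (d n) (Dd n)) ze N t)
    + (-2) * (fam Dd ze N t * fam Dd ze N t)
    + (-1) * (fam (fun n => Cmul (c n) (Cc n)) om N t * fam (fun n => Cmul (c n) (Cc n)) om N t)
    + kk) 0 T).
  - rewrite !Int_plus, !Int_scal, Int_const by auto 15 with cont.
    assert (a * SC <= c1 * SC) by now apply Rmult_le_compat_r.
    assert (a * SD <= c2 * SD) by now apply Rmult_le_compat_r.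
    assert (B2 * e1 * SD <= a / 16 * SD) by now apply Rmult_le_compat_r.
    assert (B1 * e2 * SC <= a / 16 * SC) by now apply Rmult_le_compat_r.
    assert (T * Q * e3 * S <= a / 16 * S) by now apply Rmult_le_compat_r.
    assert (0 <= a * SC) by (apply Rmult_le_pos; lra).
    assert (0 <= a * SD) by (apply Rmult_le_pos; lra).
    assert (a * S = a * SC + a * SD) by (rewrite HSS; ring).
    unfold kk; lra.
  - unfold energy; apply Int_le; auto 15 with cont; [lra|]; intros t Ht.
    specialize (E3 t Ht); unfold U1, U2; rewrite Rmult_0_l, Rplus_0_r.
    assert (H2 : forall x y, / 2 * (x * x) - y * y <= (x + y) * (x + y)).
    { intros x y; pose proof (Rle_0_sqr (x + 2 * y)); unfold Rsqr in *; lra. }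
    pose proof (sqr_plus_le (fam Dd ze N t) (rho r Rr N t)).
    eapply Rle_trans; [|apply Rplus_le_compat; apply H2]; unfold kk; lra.
Qed.

(** * Killing exponents by averaging *)

Lemma Cmul_assoc (a b c : Cpx) : Cmul a (Cmul b c) = Cmul (Cmul a b) c.
Proof. unfold Cmul; simpl; f_equal; ring. Qed.
Lemma Cmul_comm (a b : Cpx) : Cmul a b = Cmul b a.
Proof. unfold Cmul; simpl; f_equal; ring. Qed.
Lemma Cmul_1_l (a : Cpx) : Cmul (1, 0) a = a.
Proof. destruct a; unfold Cmul; simpl; f_equal; ring. Qed.
Lemma Cmul_0_l (a : Cpx) : Cmul (0, 0) a = (0, 0).
Proof. unfold Cmul; simpl; f_equal; ring. Qed.
Lemma Cmul_0_r (a : Cpx) : Cmul a (0, 0) = (0, 0).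
Proof. unfold Cmul; simpl; f_equal; ring. Qed.
Lemma Cconj_mul (a b : Cpx) : Cconj (Cmul a b) = Cmul (Cconj a) (Cconj b).
Proof. unfold Cmul, Cconj; simpl; f_equal; ring. Qed.
Lemma Cconj_invol (a : Cpx) : Cconj (Cconj a) = a.
Proof. destruct a; unfold Cconj; simpl; f_equal; ring. Qed.
Lemma Cexp_add (a b : Cpx) : Cexp (Cadd a b) = Cmul (Cexp a) (Cexp b).
Proof.
  unfold Cexp, Cadd, Cmul; simpl; rewrite exp_plus, cos_plus, sin_plus; f_equal; ring.
Qed.
Lemma Cnorm2_exp (z : Cpx) : Cnorm2 (Cexp z) = exp (2 * Cre z).
Proof.
  unfold Cnorm2, Cexp; simpl; replace (2 * Cre z) with (Cre z + Cre z) by ring.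
  rewrite exp_plus; pose proof (sin2_cos2 (Cim z)) as H; unfold Rsqr in H.
  replace (_ + _) with (exp (Cre z) * exp (Cre z) *
    (sin (Cim z) * sin (Cim z) + cos (Cim z) * cos (Cim z))) by ring.
  rewrite H; ring.
Qed.
Lemma Cnorm2_eq0 (a : Cpx) : Cnorm2 a = 0 -> a = (0, 0).
Proof. destruct a as [x y]; unfold Cnorm2; simpl; intros H; f_equal; nra. Qed.
Lemma Cnorm2_neq0 (a : Cpx) : a <> (0, 0) -> 0 < Cnorm2 a.
Proof.
  intros H; destruct (Cnorm2_pos a) as [Hp|Hp]; trivial; now destruct H; apply Cnorm2_eq0.
Qed.

(* [sym Z = 1 - \int_0^1 e^(Z s) ds]: subtracting from [u t] the average of
   [e^(- l d s) u (t + d s)] over [0 <= s <= 1] multiplies [e^(z t)] by [sym (d (z - l))]. *)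
Definition sym (Z : Cpx) : Cpx :=
  (1 - Int (fun s => exp (Cre Z * s) * cos (Cim Z * s)) 0 1,
   - Int (fun s => exp (Cre Z * s) * sin (Cim Z * s)) 0 1).

Lemma sym_0 : sym (0, 0) = (0, 0).
Proof.
  unfold sym; simpl; f_equal.
  - rewrite (Int_ext _ (fun _ => 1)), Int_const; [ring|].
    intros; rewrite !Rmult_0_l, exp_0, cos_0; ring.
  - rewrite (Int_ext _ (fun _ => 0)), Int_const; [ring|].
    intros; rewrite !Rmult_0_l, exp_0, sin_0; ring.
Qed.

Lemma sym_conj (Z : Cpx) : sym (Cconj Z) = Cconj (sym Z).
Proof.
  unfold sym, Cconj; simpl; f_equal.
  - f_equal; apply Int_ext; intros s.
    replace (- Cim Z * s) with (- (Cim Z * s)) by ring; now rewrite cos_neg.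
  - f_equal; rewrite (Int_ext _ (fun s => -1 * (exp (Cre Z * s) * sin (Cim Z * s)))).
    + rewrite Int_scal; [ring|auto 10 with cont].
    + intros s; replace (- Cim Z * s) with (- (Cim Z * s)) by ring; rewrite sin_neg; ring.
Qed.

Lemma exp_sub_1_le (y : R) : Rabs y <= 1 -> Rabs (exp y - 1) <= 3 * Rabs y.
Proof.
  intros H; pose proof (exp_ineq1_le y); pose proof (exp_ineq1_le (- y)) as H1.
  pose proof (exp_pos y) as He; pose proof exp_le_3 as H3.
  assert (exp y <= 3).
  { apply Rle_trans with (exp 1); trivial; apply exp_le; apply Rabs_le_between in H; lra. }
  rewrite exp_Ropp in H1.
  assert (exp y - 1 <= y * exp y).
  { apply (Rmult_le_compat_l (exp y)) in H1; [|lra]; rewrite Rinv_r in H1 by lra; lra. }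
  pose proof (Rle_abs y); pose proof (Rle_abs (- y)) as Hn; rewrite Rabs_Ropp in Hn.
  apply Rabs_le; split; nra.
Qed.

(** [sym] at a real x is the average of 1 - e^(x s), hence at most 3 |x| in modulus. This smallness
    near a killed real exponent is what damps the r_n close to [chi]. *)
Lemma sym_real_upper (x : R) : Rabs x <= 1 -> Cnorm2 (sym (RtoC x)) <= 9 * (x * x).
Proof.
  intros Hx; unfold sym, RtoC, Cnorm2; simpl.
  assert (E2 : Int (fun s => exp (x * s) * sin (0 * s)) 0 1 = 0).
  { rewrite (Int_ext _ (fun _ => 0)), Int_const; [ring|].
    intros; rewrite Rmult_0_l, sin_0; ring. }
  rewrite E2.
  assert (Hb : forall s, 0 <= s <= 1 ->
    1 - 3 * Rabs x <= exp (x * s) * cos (0 * s) <= 1 + 3 * Rabs x).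
  { intros s Hs; rewrite Rmult_0_l, cos_0, Rmult_1_r; pose proof (Rabs_pos x).
    assert (Ha : Rabs (x * s) <= Rabs x) by (rewrite Rabs_mult, (Rabs_right s); nra).
    pose proof (exp_sub_1_le (x * s) ltac:(lra)) as H1; apply Rabs_le_between in H1; lra. }
  assert (Hl : Int (fun _ => 1 - 3 * Rabs x) 0 1 <= Int (fun s => exp (x * s) * cos (0 * s)) 0 1).
  { apply Int_le; auto 10 with cont; [lra|]; intros; now apply Hb. }
  assert (Hu : Int (fun s => exp (x * s) * cos (0 * s)) 0 1 <= Int (fun _ => 1 + 3 * Rabs x) 0 1).
  { apply Int_le; auto 10 with cont; [lra|]; intros; now apply Hb. }
  rewrite Int_const in Hl, Hu.
  assert (HA : Rabs x * Rabs x = x * x) by (rewrite <- Rabs_mult; apply Rabs_right; nra).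
  rewrite <- HA; nra.
Qed.

Lemma sym_upper (K : R) (Z : Cpx) : Rabs (Cre Z) <= K ->
  Cnorm2 (sym Z) <= (1 + exp K) * (1 + exp K) + exp K * exp K.
Proof.
  intros HK; unfold sym, Cnorm2; simpl; pose proof (exp_pos K) as HeK.
  apply Rabs_le_between in HK.
  assert (Hb : forall s, 0 <= s <= 1 -> 0 < exp (Cre Z * s) <= exp K)
    by (intros s Hs; split; [apply exp_pos|apply exp_le; nra]).
  assert (B1 : forall f, cont f -> (forall s, -1 <= f s <= 1) ->
    - exp K <= Int (fun s => exp (Cre Z * s) * f s) 0 1 <= exp K).
  { intros f Hf Hfb; split.
    - apply Rle_trans with (Int (fun _ => - exp K) 0 1); [rewrite Int_const; lra|].
      apply Int_le; auto 10 with cont; [lra|]; intros s Hs; specialize (Hb s Hs);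
        specialize (Hfb s); nra.
    - apply Rle_trans with (Int (fun _ => exp K) 0 1); [|rewrite Int_const; lra].
      apply Int_le; auto 10 with cont; [lra|]; intros s Hs; specialize (Hb s Hs);
        specialize (Hfb s); nra. }
  pose proof (B1 (fun s => cos (Cim Z * s)) ltac:(auto with cont) ltac:(intros; apply COS_bound)).
  pose proof (B1 (fun s => sin (Cim Z * s)) ltac:(auto with cont) ltac:(intros; apply SIN_bound)).
  cbv beta in *; nra.
Qed.

(* Integration by parts: [sym Z = - Z \int_0^1 (1 - s) e^(Z s) ds]. *)
Lemma sym_factor (x y : R) :
  let Pr := Int (fun s => (1 - s) * (exp (x * s) * cos (y * s))) 0 1 in
  let Pi := Int (fun s => (1 - s) * (exp (x * s) * sin (y * s))) 0 1 in
  Cnorm2 (sym (x, y)) = (x * x + y * y) * (Pr * Pr + Pi * Pi).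
Proof.
  intros Pr Pi; unfold sym, Cnorm2; simpl.
  set (Ar := Int (fun s => exp (x * s) * cos (y * s)) 0 1).
  set (Ai := Int (fun s => exp (x * s) * sin (y * s)) 0 1).
  assert (H1 : - Ar + (x * Pr - y * Pi) = -1).
  { assert (H : Int (fun s => -1 * (exp (x * s) * cos (y * s))
        + (x * ((1 - s) * (exp (x * s) * cos (y * s)))
           - y * ((1 - s) * (exp (x * s) * sin (y * s))))) 0 1
      = (1 - 1) * (exp (x * 1) * cos (y * 1)) - (1 - 0) * (exp (x * 0) * cos (y * 0))).
    { apply (Int_derive (fun s => (1 - s) * (exp (x * s) * cos (y * s)))); [auto 20 with cont|].
      intros s; auto_derive; [trivial|ring]. }
    rewrite Int_plus, Int_minus, !Int_scal in H by auto 20 with cont.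
    fold Ar Pr Pi in H; rewrite !Rmult_0_r, exp_0, cos_0 in H; lra. }
  assert (H2 : - Ai + (x * Pi + y * Pr) = 0).
  { assert (H : Int (fun s => -1 * (exp (x * s) * sin (y * s))
        + (x * ((1 - s) * (exp (x * s) * sin (y * s)))
           + y * ((1 - s) * (exp (x * s) * cos (y * s))))) 0 1
      = (1 - 1) * (exp (x * 1) * sin (y * 1)) - (1 - 0) * (exp (x * 0) * sin (y * 0))).
    { apply (Int_derive (fun s => (1 - s) * (exp (x * s) * sin (y * s)))); [auto 20 with cont|].
      intros s; auto_derive; [trivial|ring]. }
    rewrite !Int_plus, !Int_scal in H by auto 20 with cont.
    fold Ai Pr Pi in H; rewrite !Rmult_0_r, exp_0, sin_0 in H; lra. }
  replace (1 - Ar) with (- (x * Pr - y * Pi)) by lra.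
  replace Ai with (x * Pi + y * Pr) by lra; ring.
Qed.

(** For |Im Z| <= PI / 3 the integral factor of [sym_factor] has real part at least 1/8, so [sym Z]
    is comparable with Z. For larger |Im Z| the average of cos (y s) is sin y / y <= 3 / PI < 1, so
    the real part of [sym Z] stays positive. The strip is essential: [sym] also vanishes at the
    nonzero roots of e^Z = 1 + Z, which lie away from the imaginary axis. *)
Lemma sym_lower : exists eps c, 0 < eps /\ 0 < c /\ forall Z, Rabs (Cre Z) <= eps ->
  c * Rmin 1 (Cnorm2 Z) <= Cnorm2 (sym Z).
Proof.
  assert (HPI : 3 < PI) by (pose proof PI2_3_2; lra).
  (* The room left by sin y / y <= 3 / PI. Half of it is spent on replacing e^(x s) by 1, which
     needs |x| <= k / 6. *)
  set (k := 1 - 3 / PI).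
  assert (Hk : 0 < k < 1).
  { unfold k; assert (0 < 3 / PI) by (apply Rdiv_lt_0_compat; lra).
    assert (3 / PI < 1) by (apply Rlt_div_l; lra); lra. }
  exists (k / 6), (Rmin (/ 64) (k * k / 4)); split; [lra|].
  split; [apply Rmin_glb_lt; [lra|nra]|].
  intros [x y] Hx; simpl in Hx.
  set (c := Rmin _ _); assert (Hc1 : c <= / 64) by apply Rmin_l.
  assert (Hc2 : c <= k * k / 4) by apply Rmin_r.
  assert (Hc0 : 0 < c) by (apply Rmin_glb_lt; [lra|nra]).
  assert (Hexp : forall s, 0 <= s <= 1 -> Rabs (exp (x * s) - 1) <= k / 2).
  { intros s Hs; assert (Rabs (x * s) <= k / 6).
    { rewrite Rabs_mult, (Rabs_right s) by lra; pose proof (Rabs_pos x); nra. }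
    pose proof (exp_sub_1_le (x * s) ltac:(lra)); lra. }
  destruct (Rle_dec (Rabs y) (PI / 3)) as [Hy|Hy].
  - rewrite sym_factor.
    set (Pr := Int (fun s => (1 - s) * (exp (x * s) * cos (y * s))) 0 1).
    assert (HPr : / 8 <= Pr).
    { apply Rle_trans with (Int (fun s => (1 - s) * / 4) 0 1).
      - rewrite (Int_derive (fun s => (s - s * s / 2) * / 4)).
        + lra.
        + auto 10 with cont.
        + intros s; auto_derive; [trivial|field].
      - apply Int_le; auto 10 with cont; [lra|]; intros s Hs; apply Rmult_le_compat_l; [lra|].
        specialize (Hexp s Hs); apply Rabs_le_between in Hexp.
        assert (Hcos : / 2 <= cos (y * s)).
        { assert (Ha : Rabs (y * s) <= PI / 3).
          { rewrite Rabs_mult, (Rabs_right s) by lra; pose proof (Rabs_pos y); nra. }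
          replace (cos (y * s)) with (cos (Rabs (y * s))).
          - replace (/ 2) with (cos (PI / 3)) by (rewrite cos_PI3; lra).
            apply cos_decr_1; pose proof (Rabs_pos (y * s)); lra.
          - unfold Rabs; destruct (Rcase_abs (y * s)); [apply cos_neg|trivial]. }
        nra. }
    pose proof (Rmin_r 1 (Cnorm2 (x, y))) as Hm; unfold Cnorm2 in Hm at 2; simpl in Hm.
    set (m := Rmin _ _) in *.
    assert (0 <= x * x + y * y) by nra.
    match goal with |- _ <= _ * (_ + ?q * ?q) => pose proof (Rle_0_sqr q) as Hq; unfold Rsqr in Hq;
      generalize dependent (q * q); intros q2 Hq2 end.
    assert (/ 64 <= Pr * Pr + q2) by nra.
    apply Rle_trans with (c * (x * x + y * y)); [apply Rmult_le_compat_l; lra|].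
    rewrite Rmult_comm; apply Rmult_le_compat_l; lra.
  - assert (Hy0 : PI / 3 < Rabs y) by lra.
    assert (Hyn : y <> 0) by (intros ->; rewrite Rabs_R0 in Hy0; lra).
    assert (HA : Int (fun s => exp (x * s) * cos (y * s)) 0 1 <= 1 - k / 2).
    { apply Rle_trans with (Int (fun s => cos (y * s) + k / 2) 0 1).
      - apply Int_le; auto 10 with cont; [lra|]; intros s Hs; specialize (Hexp s Hs).
        apply Rabs_le_between in Hexp; pose proof (COS_bound (y * s)); nra.
      - rewrite Int_plus, Int_const by auto with cont.
        rewrite (Int_derive (fun s => sin (y * s) / y)).
        + rewrite Rmult_0_r, sin_0.
          assert (sin (y * 1) / y <= 3 / PI).
          { apply Rle_trans with (Rabs (sin (y * 1) / y)); [apply Rle_abs|].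
            unfold Rdiv; rewrite Rabs_mult, Rabs_inv.
            apply Rle_trans with (1 * / (PI / 3)).
            - apply Rmult_le_compat; [apply Rabs_pos| | |].
              + apply Rlt_le, Rinv_0_lt_compat; lra.
              + apply Rabs_le, SIN_bound.
              + apply Rinv_le_contravar; lra.
            - apply Req_le; field; lra. }
          unfold k in *; lra.
        + auto with cont.
        + intros s; auto_derive; [trivial|field; trivial]. }
    pose proof (Rmin_l 1 (Cnorm2 (x, y))) as Hm; set (m := Rmin _ _) in *.
    apply Rle_trans with (k * k / 4).
    + apply Rle_trans with (c * 1); [apply Rmult_le_compat_l|]; lra.
    + unfold sym, Cnorm2; simpl.
      match goal with |- _ <= _ + - ?q * - ?q => pose proof (Rle_0_sqr q) as Hq; unfold Rsqr in Hq end.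
      nra.
Qed.

(** * Exponential sums under averaging operators *)

Definition expsum : Type := list (Cpx * Cpx).

Definition ev (L : expsum) (t : R) : Cpx :=
  fold_right (fun p acc => Cadd (Cmul (fst p) (Cexp (Cmul (snd p) (RtoC t)))) acc) (0, 0) L.

Lemma ev_app (L L' : expsum) (t : R) : ev (L ++ L') t = Cadd (ev L t) (ev L' t).
Proof.
  induction L as [|p L IH]; simpl.
  - destruct (ev L' t); unfold Cadd; simpl; f_equal; ring.
  - rewrite IH; unfold Cadd; simpl; f_equal; ring.
Qed.

Lemma cont_ev (L : expsum) : cont (fun t => Cre (ev L t)) /\ cont (fun t => Cim (ev L t)).
Proof.
  induction L as [|[a z] L [IH1 IH2]]; simpl; [split; auto with cont|].
  split; simpl; auto 25 with cont.
Qed.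

Definition cont_ev_re L := proj1 (cont_ev L).
Definition cont_ev_im L := proj2 (cont_ev L).
#[export] Hint Resolve cont_ev_re cont_ev_im : cont.

Lemma cont_Cnorm2_ev (L : expsum) : cont (fun t => Cnorm2 (ev L t)).
Proof. unfold Cnorm2; auto with cont. Qed.
#[export] Hint Resolve cont_Cnorm2_ev : cont.

Definition scaleL (g : Cpx -> Cpx) (L : expsum) : expsum :=
  map (fun p => (Cmul (g (snd p)) (fst p), snd p)) L.

(** A pair (d, l) encodes one averaging operator: [d] is its step, the length of time it consumes,
    and [l] the exponent it kills. *)
Definition msym (w : R * Cpx) (z : Cpx) : Cpx :=
  sym (fst w * (Cre z - Cre (snd w)), fst w * (Cim z - Cim (snd w))).

Definition twist (w : R * Cpx) (s : R) : Cpx := Cexp (Cmul (snd w) (RtoC (- (fst w * s)))).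

Lemma cont_twist (w : R * Cpx) : cont (fun s => Cre (twist w s)) /\ cont (fun s => Cim (twist w s)).
Proof. unfold twist, Cexp, Cmul, RtoC; simpl; split; auto 25 with cont. Qed.
Definition cont_twist_re w := proj1 (cont_twist w).
Definition cont_twist_im w := proj2 (cont_twist w).
#[export] Hint Resolve cont_twist_re cont_twist_im : cont.

Lemma cont_affine (f : R -> R) (t d : R) : cont f -> cont (fun s => f (t + d * s)).
Proof. intros Hf; apply cont_comp; auto with cont. Qed.

Lemma cont_ev_affine (L : expsum) (t d : R) :
  cont (fun s => Cre (ev L (t + d * s))) /\ cont (fun s => Cim (ev L (t + d * s))).
Proof.
  split; [apply (cont_affine (fun t => Cre (ev L t)))|apply (cont_affine (fun t => Cim (ev L t)))];
    auto with cont.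
Qed.
Definition cont_ev_affine_re L t d := proj1 (cont_ev_affine L t d).
Definition cont_ev_affine_im L t d := proj2 (cont_ev_affine L t d).
#[export] Hint Resolve cont_ev_affine_re cont_ev_affine_im : cont.

Lemma twist_exp (w : R * Cpx) (z : Cpx) (t s : R) :
  Cmul (twist w s) (Cexp (Cmul z (RtoC (t + fst w * s)))) =
  Cmul (Cexp (Cmul z (RtoC t)))
    (Cexp (fst w * (Cre z - Cre (snd w)) * s, fst w * (Cim z - Cim (snd w)) * s)).
Proof.
  unfold twist; rewrite <- !Cexp_add; f_equal; destruct w as [d [p q]], z as [x y].
  unfold Cadd, Cmul, RtoC; simpl; f_equal; ring.
Qed.

(** Scaling the coefficients by the multiplier is the same as subtracting a twisted average of
    values on [t, t + d]. This form makes the scaled sum controllable by the energy of the original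
    one, whatever its exponents are. *)
Lemma ev_scale_msym (w : R * Cpx) (L : expsum) (t : R) :
  ev (scaleL (msym w) L) t =
  (Cre (ev L t) - Int (fun s => Cre (Cmul (twist w s) (ev L (t + fst w * s)))) 0 1,
   Cim (ev L t) - Int (fun s => Cim (Cmul (twist w s) (ev L (t + fst w * s)))) 0 1).
Proof.
  induction L as [|[a z] L IH].
  - assert (H0 : forall f, (forall s, f s = 0) -> Int f 0 1 = 0).
    { intros f Hf; rewrite (Int_ext _ (fun _ => 0)), Int_const by trivial; ring. }
    simpl; rewrite !H0 by (intros; simpl; ring); f_equal; ring.
  - change (ev (scaleL (msym w) ((a, z) :: L)) t) with
      (Cadd (Cmul (Cmul (msym w z) a) (Cexp (Cmul z (RtoC t)))) (ev (scaleL (msym w) L) t)).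
    rewrite IH; clear IH.
    change (ev ((a, z) :: L) t) with (Cadd (Cmul a (Cexp (Cmul z (RtoC t)))) (ev L t)).
    set (b := Cmul a (Cexp (Cmul z (RtoC t)))).
    set (X := fst w * (Cre z - Cre (snd w))); set (Y := fst w * (Cim z - Cim (snd w))).
    assert (HE : forall s, Cmul (twist w s) (ev ((a, z) :: L) (t + fst w * s))
      = Cadd (Cmul b (Cexp (X * s, Y * s))) (Cmul (twist w s) (ev L (t + fst w * s)))).
    { intros s.
      change (ev ((a, z) :: L) (t + fst w * s)) with
        (Cadd (Cmul a (Cexp (Cmul z (RtoC (t + fst w * s))))) (ev L (t + fst w * s))).
      unfold b; rewrite <- Cmul_assoc; unfold X, Y; rewrite <- twist_exp.
      unfold Cadd, Cmul; simpl; f_equal; ring. }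
    replace (Cmul (Cmul (msym w z) a) (Cexp (Cmul z (RtoC t)))) with (Cmul (msym w z) b)
      by (unfold b; now rewrite Cmul_assoc).
    unfold msym; fold X Y; unfold sym; simpl (Cre (X, Y)); simpl (Cim (X, Y)).
    set (cr := fun s => exp (X * s) * cos (Y * s)); set (ci := fun s => exp (X * s) * sin (Y * s)).
    assert (Hcr : cont cr) by (unfold cr; auto 10 with cont).
    assert (Hci : cont ci) by (unfold ci; auto 10 with cont).
    assert (Hre : cont (fun s => Cre (Cmul (twist w s) (ev L (t + fst w * s)))))
      by (simpl; auto 10 with cont).
    assert (Him : cont (fun s => Cim (Cmul (twist w s) (ev L (t + fst w * s)))))
      by (simpl; auto 10 with cont).
    set (fr := fun s => Cre (Cmul (twist w s) (ev L (t + fst w * s)))) in *.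
    set (fi := fun s => Cim (Cmul (twist w s) (ev L (t + fst w * s)))) in *.
    rewrite (Int_ext (fun s => Cre _) (fun s => (Cre b * cr s - Cim b * ci s) + fr s)).
    2: { intros s; rewrite HE; reflexivity. }
    rewrite (Int_ext (fun s => Cim _) (fun s => (Cre b * ci s + Cim b * cr s) + fi s)).
    2: { intros s; rewrite HE; reflexivity. }
    rewrite !Int_plus, Int_minus, !Int_scal by auto 10 with cont.
    unfold Cadd, Cmul; simpl; f_equal; ring.
Qed.

Definition enL (T : R) (L : expsum) : R := Int (fun t => Cnorm2 (ev L t)) 0 T.

(** The squared average is at most the average of squares, and the substitution t + d s turns that
    into 1 / d times an energy on [t, t + d], inside [0, T]; the twist costs e^(2 |Re l| d). K is
    uniform in T <= T0, and it does not depend on the list. *)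
Lemma enL_scale_msym (w : R * Cpx) (T0 : R) : 0 < fst w ->
  exists K, 0 <= K /\ forall T L, fst w <= T -> T <= T0 ->
    enL (T - fst w) (scaleL (msym w) L) <= K * enL T L.
Proof.
  destruct w as [d l]; simpl; intros Hd.
  set (k := exp (2 * (Rabs (Cre l) * d))); assert (Hk : 0 < k) by apply exp_pos.
  exists (2 + 2 * (Rabs T0 * (k * / d))).
  assert (Hdi : 0 < / d) by now apply Rinv_0_lt_compat.
  assert (Hkd : 0 < k * / d) by now apply Rmult_lt_0_compat.
  split; [pose proof (Rmult_le_pos _ _ (Rabs_pos T0) (Rlt_le _ _ Hkd)); lra|].
  intros T L HdT HT; unfold enL.
  set (NT := Int (fun t => Cnorm2 (ev L t)) 0 T).
  assert (HN : 0 <= NT).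
  { apply Int_nonneg; auto with cont; [lra|]; intros; apply Cnorm2_pos. }
  apply Rle_trans with (Int (fun t => 2 * Cnorm2 (ev L t) + 2 * (k * / d * NT)) 0 (T - d)).
  - apply Int_le; auto 10 with cont; [lra|]; intros t Ht; rewrite ev_scale_msym; simpl fst.
    set (fr := fun s => Cre (Cmul (twist (d, l) s) (ev L (t + d * s)))).
    set (fi := fun s => Cim (Cmul (twist (d, l) s) (ev L (t + d * s)))).
    assert (Hre : cont fr) by (unfold fr; simpl; auto 10 with cont).
    assert (Him : cont fi) by (unfold fi; simpl; auto 10 with cont).
    pose proof (cont_ev_affine_re L t d) as Cr; pose proof (cont_ev_affine_im L t d) as Ci'.
    assert (Hc : cont (fun s => Cnorm2 (ev L (t + d * s)))) by (unfold Cnorm2; auto with cont).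
    assert (HI : Int fr 0 1 * Int fr 0 1 + Int fi 0 1 * Int fi 0 1 <= k * / d * NT).
    { apply Rle_trans with (Int (fun s => fr s * fr s + fi s * fi s) 0 1).
      - rewrite Int_plus by auto with cont; apply Rplus_le_compat; now apply Int_sqr_le.
      - apply Rle_trans with (Int (fun s => k * / d * (d * Cnorm2 (ev L (d * s + t)))) 0 1).
        + assert (Hc' : cont (fun s => Cnorm2 (ev L (d * s + t)))).
          { apply (cont_ext (fun s => Cnorm2 (ev L (t + d * s)))); trivial.
            intros s; f_equal; f_equal; ring. }
          apply Int_le; auto 10 with cont; [lra|]; intros s Hs.
          change (fr s * fr s + fi s * fi s) with
            (Cnorm2 (Cmul (twist (d, l) s) (ev L (t + d * s)))).
          rewrite Cnorm2_mul; unfold twist; rewrite Cnorm2_exp; simpl.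
          replace (k * / d * (d * Cnorm2 (ev L (d * s + t)))) with (k * Cnorm2 (ev L (d * s + t)))
            by (field; lra).
          replace (d * s + t) with (t + d * s) by ring.
          apply Rmult_le_compat_r; [apply Cnorm2_pos|]; apply exp_le.
          pose proof (Rle_abs (- Cre l)) as Ha; rewrite Rabs_Ropp in Ha.
          assert (- Cre l * (d * s) <= Rabs (Cre l) * (d * s)) by (apply Rmult_le_compat_r; nra).
          assert (Rabs (Cre l) * (d * s) <= Rabs (Cre l) * d)
            by (apply Rmult_le_compat_l; [apply Rabs_pos|nra]).
          lra.
        + rewrite Int_scal.
          2: { apply cont_mult; auto with cont.
               apply (cont_ext (fun s => Cnorm2 (ev L (t + d * s)))); trivial.
               intros s; f_equal; f_equal; ring. }
          apply Rmult_le_compat_l; [lra|].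
          rewrite (Int_shift (fun t => Cnorm2 (ev L t)) d t 0 1) by auto with cont.
          apply Int_sub; auto with cont; try lra; intros; apply Cnorm2_pos. }
    pose proof (sqr_plus_le (Cre (ev L t)) (- Int fr 0 1)).
    pose proof (sqr_plus_le (Cim (ev L t)) (- Int fi 0 1)).
    unfold Cnorm2; simpl; lra.
  - set (kk := 2 * (k * / d * NT)).
    rewrite Int_plus, Int_scal, Int_const by auto with cont.
    assert (Int (fun t => Cnorm2 (ev L t)) 0 (T - d) <= NT).
    { apply Int_sub; auto with cont; try lra; intros; apply Cnorm2_pos. }
    assert (HT0 : T - d - 0 <= Rabs T0) by (pose proof (Rle_abs T0); lra).
    assert (Hkk : 0 <= kk) by (unfold kk; nra).
    pose proof (Rmult_le_compat_r _ _ _ Hkk HT0).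
    replace ((2 + 2 * (Rabs T0 * (k * / d))) * NT) with (2 * NT + Rabs T0 * kk)
      by (unfold kk; ring).
    lra.
Qed.

Definition Msym (W : list (R * Cpx)) (z : Cpx) : Cpx :=
  fold_right (fun w acc => Cmul (msym w z) acc) (1, 0) W.

Definition duration (W : list (R * Cpx)) : R := fold_right (fun w acc => fst w + acc) 0 W.

Lemma duration_pos W : (forall w, In w W -> 0 < fst w) -> 0 <= duration W.
Proof.
  induction W as [|w W IH]; intros H; simpl; [lra|].
  pose proof (H w (or_introl eq_refl)); specialize (IH (fun v Hv => H v (or_intror Hv))); lra.
Qed.

Lemma enL_scale_Msym (W : list (R * Cpx)) (T : R) :
  (forall w, In w W -> 0 < fst w) -> duration W <= T ->
  exists K, 0 <= K /\ forall L, enL (T - duration W) (scaleL (Msym W) L) <= K * enL T L.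
Proof.
  induction W as [|w W IH]; intros HW HT; simpl in *.
  - exists 1; split; [lra|]; intros L; rewrite Rminus_0_r, Rmult_1_l.
    assert (H : scaleL (Msym []) L = L).
    { induction L as [|[a z] L IH]; trivial; simpl in *; now rewrite Cmul_1_l, IH. }
    rewrite H; lra.
  - assert (Hw : 0 < fst w) by auto.
    assert (HW' : forall v, In v W -> 0 < fst v) by auto.
    pose proof (duration_pos W HW').
    destruct (IH HW' ltac:(lra)) as [K1 [HK1 H1]].
    destruct (enL_scale_msym w T Hw) as [K2 [HK2 H2]].
    exists (K2 * K1); split; [now apply Rmult_le_pos|]; intros L.
    assert (HL : scaleL (Msym (w :: W)) L = scaleL (msym w) (scaleL (Msym W) L)).
    { unfold scaleL; rewrite map_map; apply map_ext; intros [a z]; simpl; now rewrite Cmul_assoc. }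
    rewrite HL; specialize (H2 (T - duration W) (scaleL (Msym W) L) ltac:(lra) ltac:(lra)).
    replace (T - (fst w + duration W)) with (T - duration W - fst w) by ring.
    eapply Rle_trans; [exact H2|]; rewrite Rmult_assoc; apply Rmult_le_compat_l; trivial.
Qed.

Lemma Msym_app W W' z : Msym (W ++ W') z = Cmul (Msym W z) (Msym W' z).
Proof.
  induction W as [|w W IH]; simpl; [now rewrite Cmul_1_l|now rewrite IH, Cmul_assoc].
Qed.

Lemma Msym_kill W d z : In (d, z) W -> Msym W z = (0, 0).
Proof.
  induction W as [|w W IH]; simpl; [easy|]; intros [->|H].
  - unfold msym; simpl; replace (d * (Cre z - Cre z)) with 0 by ring.
    replace (d * (Cim z - Cim z)) with 0 by ring; rewrite sym_0; apply Cmul_0_l.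
  - rewrite (IH H); apply Cmul_0_r.
Qed.

Lemma msym_conj w z : msym (fst w, Cconj (snd w)) (Cconj z) = Cconj (msym w z).
Proof.
  unfold msym; simpl; rewrite <- sym_conj; f_equal; unfold Cconj; simpl; f_equal; ring.
Qed.

(** With the conjugate exponents included, the multiplier commutes with conjugation. It then maps
    conjugate pairs to conjugate pairs and keeps real coefficients real, so the scaled components
    have the original form. The price is a doubled duration. *)
Definition symmetrize (W : list (R * Cpx)) : list (R * Cpx) :=
  W ++ map (fun w => (fst w, Cconj (snd w))) W.

Lemma Msym_map_conj W z :
  Msym (map (fun w => (fst w, Cconj (snd w))) W) (Cconj z) = Cconj (Msym W z).
Proof.
  induction W as [|w W IH]; simpl.
  - unfold Cconj; simpl; f_equal; ring.
  - now rewrite IH, Cconj_mul, <- msym_conj.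
Qed.

Lemma Msym_symmetrize_conj W z : Msym (symmetrize W) (Cconj z) = Cconj (Msym (symmetrize W) z).
Proof.
  unfold symmetrize; rewrite !Msym_app, Cconj_mul, Msym_map_conj, Cmul_comm; f_equal.
  rewrite <- (Cconj_invol z) at 2; rewrite Msym_map_conj; now rewrite Cconj_invol.
Qed.

Lemma duration_app W W' : duration (W ++ W') = duration W + duration W'.
Proof. induction W as [|w W IH]; simpl; [ring|rewrite IH; ring]. Qed.

Lemma duration_symmetrize W : duration (symmetrize W) = 2 * duration W.
Proof.
  unfold symmetrize; rewrite duration_app.
  replace (duration (map _ W)) with (duration W); [ring|].
  induction W as [|w W IH]; simpl; [trivial|now rewrite IH].
Qed.

(** * Multipliers *)

(** Provides one averaging step that meets several smallness requirements at once. *)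
Lemma small_solution (l : list (R * R)) : (forall p, In p l -> 0 < snd p) ->
  exists d, 0 < d /\ forall p, In p l -> d * fst p <= snd p.
Proof.
  induction l as [|[a b] l IH]; intros H; [exists 1; split; [lra|easy]|].
  destruct IH as [d [Hd Hl]]; [intros p Hp; apply H; now right|].
  pose proof (H (a, b) (or_introl eq_refl)) as Hb; simpl in Hb; pose proof (Rabs_pos a) as Ha.
  assert (Hq : 0 < b / (Rabs a + 1)) by (apply Rdiv_lt_0_compat; lra).
  exists (Rmin d (b / (Rabs a + 1))); split; [now apply Rmin_glb_lt|].
  pose proof (Rmin_l d (b / (Rabs a + 1))) as M1; pose proof (Rmin_r d (b / (Rabs a + 1))) as M2.
  assert (M0 : 0 < Rmin d (b / (Rabs a + 1))) by now apply Rmin_glb_lt.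
  set (e := Rmin _ _) in *; intros p [<-|Hp]; simpl.
  - apply Rle_trans with (e * (Rabs a + 1)).
    + pose proof (Rle_abs a); apply Rmult_le_compat_l; lra.
    + apply Rle_div_r in M2; lra.
  - specialize (Hl p Hp); specialize (H p (or_intror Hp)).
    destruct (Rle_dec 0 (fst p)); [|nra]; apply Rle_trans with (d * fst p); trivial.
    now apply Rmult_le_compat_r.
Qed.

Lemma list_bound {A : Type} (f : A -> R) (l : list A) :
  exists K, 0 <= K /\ forall x, In x l -> f x <= K.
Proof.
  induction l as [|y l [K [HK H]]]; [exists 0; split; [lra|easy]|].
  exists (Rmax K (f y)); split; [eapply Rle_trans; [exact HK|apply Rmax_l]|].
  intros x [<-|Hx]; [apply Rmax_r|]; eapply Rle_trans; [now apply H|apply Rmax_l].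
Qed.

Lemma seq_lower_bound (u : nat -> R) (n0 n1 : nat) (c : R) :
  0 < c -> (forall n, (n0 <= n)%nat -> 0 < u n) -> (forall n, (n1 <= n)%nat -> c <= u n) ->
  exists k, 0 < k /\ forall n, (n0 <= n)%nat -> k <= u n.
Proof.
  intros Hc H0; revert c Hc; induction n1 as [|n1 IH]; intros c Hc H.
  - exists c; split; trivial; intros; apply H; lia.
  - destruct (le_dec n0 n1) as [Hle|Hgt].
    + apply (IH (Rmin c (u n1))); [apply Rmin_glb_lt; auto|].
      intros n Hn; destruct (Nat.eq_dec n n1) as [->|Hne]; [apply Rmin_r|].
      eapply Rle_trans; [apply Rmin_l|]; apply H; lia.
    + exists c; split; trivial; intros; apply H; lia.
Qed.

Definition sqdist (z l : Cpx) : R := Cnorm2 (Cre z - Cre l, Cim z - Cim l).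

Lemma sqdist_pos (z l : Cpx) : z <> l -> 0 < sqdist z l.
Proof.
  intros H; apply Cnorm2_neq0; intros E; apply H; destruct z as [x y], l as [p q]; simpl in E.
  injection E; intros; f_equal; lra.
Qed.

Lemma msym_lower : exists eps c, 0 < eps /\ 0 < c /\ forall w z, 0 < fst w ->
  fst w * Rabs (Cre z - Cre (snd w)) <= eps ->
  c * Rmin 1 (fst w * fst w * sqdist z (snd w)) <= Cnorm2 (msym w z).
Proof.
  destruct sym_lower as (eps & c & Heps & Hc & H); exists eps, c; repeat split; trivial.
  intros w z Hw Hz; unfold msym.
  replace (fst w * fst w * sqdist z (snd w)) with
    (Cnorm2 (fst w * (Cre z - Cre (snd w)), fst w * (Cim z - Cim (snd w))))
    by (unfold sqdist, Cnorm2; simpl; ring).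
  apply H; simpl; rewrite Rabs_mult, (Rabs_right (fst w)); lra.
Qed.

Lemma Rmin_1_pos (x : R) : 0 < x -> 0 < Rmin 1 x.
Proof. intros; apply Rmin_glb_lt; lra. Qed.

Lemma Cnorm2_Msym_pos (W : list (R * Cpx)) (z : Cpx) :
  (forall w, In w W -> 0 < Cnorm2 (msym w z)) -> 0 < Cnorm2 (Msym W z).
Proof.
  induction W as [|w W IH]; intros H; simpl; [unfold Cnorm2; simpl; lra|].
  rewrite Cnorm2_mul; apply Rmult_lt_0_compat; [apply H; now left|].
  apply IH; intros v Hv; apply H; now right.
Qed.

Definition Ceq_dec (a b : Cpx) : {a = b} + {a <> b}.
Proof.
  destruct a as [x y], b as [x' y'].
  destruct (Req_EM_T x x') as [->|H]; [|right; congruence].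
  destruct (Req_EM_T y y') as [->|H]; [now left|right; congruence].
Defined.

(** Exponents may be repeated in a list, so the coefficient of z0 is the sum over all its
    occurrences. *)
Definition coefsum (z0 : Cpx) (L : expsum) : Cpx :=
  fold_right (fun p acc => if Ceq_dec (snd p) z0 then Cadd (fst p) acc else acc) (0, 0) L.

Lemma duration_map (dl : R) (Zl : list Cpx) :
  duration (map (fun l => (dl, l)) Zl) = dl * INR (length Zl).
Proof.
  induction Zl as [|l Zl IH]; [simpl; ring|].
  change (length (l :: Zl)) with (S (length Zl)); rewrite S_INR; simpl; rewrite IH; ring.
Qed.

(** Kill every listed exponent other than z0 in at most half of the interval. What survives is one
    exponential with coefficient M(z0) [coefsum z0 L], where M(z0) is nonzero, and its energy on the
    remaining half is explicit. K depends on the exponents only. *)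
Lemma exponentials_independent (Zl : list Cpx) (z0 : Cpx) (T : R) : 0 < T ->
  exists K, 0 <= K /\ forall L, (forall p, In p L -> In (snd p) Zl) ->
    Cnorm2 (coefsum z0 L) <= K * enL T L.
Proof.
  intros HT; destruct msym_lower as (eps & c & Heps & Hc & Hlow).
  destruct (list_bound (fun l => Rabs (Cre z0 - Cre l)) Zl) as [K1 [HK1 Hb]].
  set (Zf := filter (fun l => if Ceq_dec l z0 then false else true) Zl).
  (* The first condition puts all dl (z0 - l) into the strip of [sym_lower], the second keeps the
     total duration below T / 2. *)
  destruct (small_solution [(K1, eps); (INR (length Zf), T / 2)]) as [dl [Hdl Hs]].
  { intros p [<-|[<-|[]]]; simpl; lra. }
  pose proof (Hs _ (or_introl eq_refl)) as Hs1.
  pose proof (Hs _ (or_intror (or_introl eq_refl))) as Hs2; simpl in Hs1, Hs2.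
  set (W := map (fun l => (dl, l)) Zf).
  assert (HWin : forall w, In w W -> fst w = dl /\ In (snd w) Zl /\ snd w <> z0).
  { intros w Hw; apply in_map_iff in Hw; destruct Hw as [l [<- Hl]]; simpl.
    apply filter_In in Hl; destruct (Ceq_dec l z0); [now destruct Hl|tauto]. }
  assert (HWp : forall w, In w W -> 0 < fst w).
  { intros w Hw; now destruct (HWin w Hw) as [-> _]. }
  assert (HD : duration W = dl * INR (length Zf)) by apply duration_map.
  destruct (enL_scale_Msym W T HWp ltac:(lra)) as [K [HK HE]].
  set (m := Cnorm2 (Msym W z0)).
  assert (Hm : 0 < m).
  { apply Cnorm2_Msym_pos; intros w Hw; destruct (HWin w Hw) as [H1 [H2 H3]].
    eapply Rlt_le_trans; [|apply Hlow; [now apply HWp|]].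
    - apply Rmult_lt_0_compat, Rmin_1_pos; trivial.
      rewrite H1; apply Rmult_lt_0_compat; [nra|now apply sqdist_pos, not_eq_sym].
    - rewrite H1; eapply Rle_trans; [apply Rmult_le_compat_l; [lra|apply Hb, H2]|trivial]. }
  set (e := exp (- (2 * Rabs (Cre z0) * T))); assert (He : 0 < e) by apply exp_pos.
  assert (Hpos : 0 < m * e * (T / 2)) by (repeat apply Rmult_lt_0_compat; lra).
  exists (K / (m * e * (T / 2))); split.
  { apply Rmult_le_pos; trivial; now apply Rlt_le, Rinv_0_lt_compat. }
  intros L HL; specialize (HE L).
  assert (Hev : forall t, ev (scaleL (Msym W) L) t
    = Cmul (Cmul (Msym W z0) (coefsum z0 L)) (Cexp (Cmul z0 (RtoC t)))).
  { intros t; clear HE; induction L as [|[a z] L IH].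
    - simpl; now rewrite Cmul_0_r, Cmul_0_l.
    - change (ev (scaleL (Msym W) ((a, z) :: L)) t) with
        (Cadd (Cmul (Cmul (Msym W z) a) (Cexp (Cmul z (RtoC t)))) (ev (scaleL (Msym W) L) t)).
      rewrite IH by (intros; apply HL; now right); simpl.
      destruct (Ceq_dec z z0) as [->|Hne].
      + unfold Cmul, Cadd; simpl; f_equal; ring.
      + rewrite (Msym_kill W dl z), !Cmul_0_l.
        * unfold Cadd; simpl; now rewrite !Rplus_0_l.
        * apply in_map_iff; exists z; split; trivial; apply filter_In; split.
          -- apply (HL (a, z)); now left.
          -- now destruct (Ceq_dec z z0). }
  set (X := Cnorm2 (coefsum z0 L)); assert (HX : 0 <= X) by apply Cnorm2_pos.
  assert (Hfin : m * e * (T / 2) * X <= K * enL T L).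
  { eapply Rle_trans; [|exact HE]; unfold enL at 1.
    apply Rle_trans with (Int (fun _ => m * X * e) 0 (T - duration W)).
    - rewrite Int_const; replace (m * e * (T / 2) * X) with (T / 2 * (m * X * e)) by ring.
      apply Rmult_le_compat_r; [|lra]; repeat apply Rmult_le_pos; lra.
    - apply Int_le; auto with cont; [lra|]; intros t Ht; rewrite Hev, !Cnorm2_mul; fold m X.
      apply Rmult_le_compat_l; [apply Rmult_le_pos; lra|].
      rewrite Cnorm2_exp; apply exp_le; simpl.
      assert (HdW : 0 <= duration W) by now apply duration_pos.
      pose proof (Rle_abs (- Cre z0)) as Ha; rewrite Rabs_Ropp in Ha; pose proof (Rabs_pos (Cre z0)).
      assert (- Cre z0 * t <= Rabs (Cre z0) * t) by (apply Rmult_le_compat_r; lra).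
      assert (Rabs (Cre z0) * t <= Rabs (Cre z0) * T) by (apply Rmult_le_compat_l; lra).
      lra. }
  replace (K / (m * e * (T / 2)) * enL T L) with (K * enL T L / (m * e * (T / 2))) by (field; lra).
  apply Rle_div_r; trivial; lra.
Qed.

Lemma Cnorm2_Msym_upper (W : list (R * Cpx)) (K : R) :
  exists U, 0 < U /\ forall z, Rabs (Cre z) <= K -> Cnorm2 (Msym W z) <= U.
Proof.
  induction W as [|w W [U [HU H]]]; simpl.
  - exists 1; split; [lra|]; intros; unfold Cnorm2; simpl; lra.
  - set (k := Rabs (fst w) * (K + Rabs (Cre (snd w)))).
    pose proof (exp_pos k) as Hk.
    set (V := (1 + exp k) * (1 + exp k) + exp k * exp k).
    assert (HV : 0 < V) by (unfold V; nra).
    exists (V * U); split; [now apply Rmult_lt_0_compat|]; intros z Hz; rewrite Cnorm2_mul.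
    apply Rmult_le_compat; try apply Cnorm2_pos; [|now apply H].
    apply sym_upper; simpl; rewrite Rabs_mult; apply Rmult_le_compat_l; [apply Rabs_pos|].
    unfold Rminus; eapply Rle_trans; [apply Rabs_triang|]; rewrite Rabs_Ropp; lra.
Qed.

(** Applied to z_n = i om_n and z_n = i ze_n, whose imaginary parts are the real parts of om_n and
    ze_n. *)
Definition escapes (z : nat -> Cpx) : Prop :=
  forall P, exists n1, forall n, (n1 <= n)%nat -> P <= Cim (z n).

(** Once z_n is at distance at least 1 / d from a killed exponent, that factor is at least c; the
    finitely many earlier factors are positive because z_n is not killed. The bound for one factor
    is exported with the same [eps] and [c], since the damping argument needs it quantitatively. *)
Lemma Cnorm2_Msym_lower : exists eps c, 0 < eps /\ 0 < c /\
  (forall w z, 0 < fst w -> fst w * Rabs (Cre z - Cre (snd w)) <= eps ->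
    c * Rmin 1 (fst w * fst w * sqdist z (snd w)) <= Cnorm2 (msym w z)) /\
  forall (W : list (R * Cpx)) (z : nat -> Cpx) (n0 : nat), escapes z ->
    (forall w n, In w W -> (n0 <= n)%nat ->
       0 < fst w /\ fst w * Rabs (Cre (z n) - Cre (snd w)) <= eps /\ z n <> snd w) ->
    exists k, 0 < k /\ forall n, (n0 <= n)%nat -> k <= Cnorm2 (Msym W (z n)).
Proof.
  destruct msym_lower as (eps & c & Heps & Hc & Hlow); exists eps, c; repeat split; trivial.
  intros W z n0 Hz; induction W as [|w W IH]; intros H.
  - exists 1; split; [lra|]; intros; unfold Cnorm2; simpl; lra.
  - destruct IH as [k [Hk IH]]; [intros; apply H; simpl; auto|].
    assert (Hw : 0 < fst w) by now apply (H w n0 (or_introl eq_refl)).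
    destruct (Hz (Rabs (Cim (snd w)) + / fst w)) as [n1 Hn1].
    destruct (seq_lower_bound (fun n => Cnorm2 (msym w (z n))) n0 (Nat.max n0 n1) c Hc) as [k' [Hk' IH']].
    + intros n Hn; destruct (H w n (or_introl eq_refl) Hn) as [_ [H2 H3]].
      eapply Rlt_le_trans; [|now apply Hlow].
      apply Rmult_lt_0_compat, Rmin_1_pos; trivial.
      apply Rmult_lt_0_compat; [nra|now apply sqdist_pos].
    + intros n Hn; destruct (H w n (or_introl eq_refl) ltac:(lia)) as [_ [H2 H3]].
      eapply Rle_trans; [|now apply Hlow].
      rewrite Rmin_left; [lra|].
      specialize (Hn1 n ltac:(lia)).
      pose proof (Rle_abs (Cim (snd w))) as Ha.
      assert (Hi : 0 < / fst w) by now apply Rinv_0_lt_compat.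
      assert (Hd : / fst w * / fst w <= sqdist (z n) (snd w)).
      { unfold sqdist, Cnorm2; simpl; pose proof (Rle_0_sqr (Cre (z n) - Cre (snd w))) as Hq.
        unfold Rsqr in Hq; nra. }
      apply Rle_trans with (fst w * fst w * (/ fst w * / fst w)); [apply Req_le; field; lra|].
      apply Rmult_le_compat_l; nra.
    + exists (k' * k); split; [now apply Rmult_lt_0_compat|]; intros n Hn; simpl.
      rewrite Cnorm2_mul; apply Rmult_le_compat; try lra; auto.
Qed.

Lemma Cnorm2_Msym_repeat (w : R * Cpx) (k : nat) (z : Cpx) :
  Cnorm2 (Msym (repeat w k) z) = Cnorm2 (msym w z) ^ k.
Proof.
  induction k as [|k IH]; simpl; [unfold Cnorm2; simpl; ring|now rewrite Cnorm2_mul, IH].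
Qed.

Lemma duration_repeat (w : R * Cpx) (k : nat) : duration (repeat w k) = fst w * INR k.
Proof.
  induction k as [|k IH]; [simpl; ring|]; rewrite S_INR; simpl; rewrite IH; ring.
Qed.

Lemma symmetrize_repeat (d x : R) (k : nat) :
  symmetrize (repeat (d, RtoC x) k) = repeat (d, RtoC x) (k + k).
Proof.
  unfold symmetrize; rewrite repeat_app; f_equal.
  induction k as [|k IH]; simpl; trivial; rewrite IH; f_equal.
  unfold Cconj, RtoC; simpl; now rewrite Ropp_0.
Qed.

Lemma Msym_symmetrize_app (W W' : list (R * Cpx)) (z : Cpx) :
  Msym (symmetrize (W ++ W')) z = Cmul (Msym (symmetrize W) z) (Msym (symmetrize W') z).
Proof.
  unfold symmetrize; rewrite map_app, !Msym_app, !Cmul_assoc; f_equal.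
  rewrite <- !Cmul_assoc; f_equal; apply Cmul_comm.
Qed.

Lemma in_symmetrize (W : list (R * Cpx)) (w : R * Cpx) : In w (symmetrize W) ->
  exists v, In v W /\ fst w = fst v /\ (snd w = snd v \/ snd w = Cconj (snd v)).
Proof.
  intros H; apply in_app_or in H; destruct H as [H|H]; [now exists w; auto|].
  apply in_map_iff in H; destruct H as [v [<- Hv]]; exists v; simpl; auto.
Qed.

Lemma sqdist_real_lower (z : Cpx) (x P : R) : 0 <= P -> P <= Cim z -> P * P <= sqdist z (RtoC x).
Proof.
  intros HP Hz; unfold sqdist, Cnorm2; simpl.
  pose proof (Rle_0_sqr (Cre z - x)) as Hq; unfold Rsqr in Hq; nra.
Qed.

(* The multiplier kills the finitely many exponents [Lam], is bounded below on both tails, and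
   damps the tail of the real exponents at least as much as the oscillating ones: killing [chi]
   many times costs a factor 1/4 on [r n] relative to [z n] each time, which absorbs the bounded
   ratio created by killing [Lam]. *)
Lemma killing_multiplier (K : R) : 0 <= K -> exists P, 0 <= P /\
  forall (z1 z2 : nat -> Cpx) (r : nat -> R) (chi : R) (Lam : list Cpx) (n0 : nat) (s : R),
  0 < s -> escapes z1 -> escapes z2 ->
  (forall n, Rabs (Cre (z1 n)) <= K /\ Rabs (Cre (z2 n)) <= K /\ Rabs (r n) <= K) -> Rabs chi <= K ->
  (forall n, (n0 <= n)%nat -> P <= Cim (z1 n) /\ P <= Cim (z2 n)) ->
  (forall n l, (n0 <= n)%nat -> In l Lam ->
     (z1 n <> l /\ z1 n <> Cconj l) /\ (z2 n <> l /\ z2 n <> Cconj l)) ->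
  (forall n, (n0 <= n)%nat -> 0 < Cim (z1 n) /\ 0 < Cim (z2 n)) ->
  exists W k, (forall w, In w (symmetrize W) -> 0 < fst w) /\ duration (symmetrize W) <= s /\
    (forall l, In l Lam -> Msym (symmetrize W) l = (0, 0)) /\ 0 < k /\
    forall n, (n0 <= n)%nat ->
      let q1 := Cnorm2 (Msym (symmetrize W) (z1 n)) in
      let q2 := Cnorm2 (Msym (symmetrize W) (z2 n)) in
      let qr := Cnorm2 (Msym (symmetrize W) (RtoC (r n))) in
      k <= q1 /\ k <= q2 /\ qr <= q1 /\ qr <= q2.
Proof.
  intros HK; destruct Cnorm2_Msym_lower as (eps & c & Heps & Hc & Hlow & HWlow).
  (* 144 = 4 * 9 * 4: the gain 4, the constant 9 of [sym_real_upper], and |x - chi|^2 <= 4 K^2. The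
     threshold is 1 + P2 because its square dominates P2. It involves neither the step nor the
     killed list, so it is available before both. *)
  set (P2 := 144 * (K * K) / c).
  assert (HP2 : 0 <= P2) by (apply Rmult_le_pos; [nra|now apply Rlt_le, Rinv_0_lt_compat]).
  exists (1 + P2); split; [lra|].
  intros z1 z2 r chi Lam n0 s Hs He1 He2 HbK Hchi HP Hne Hpos.
  destruct (list_bound (fun l => Rabs (Cre l)) Lam) as [KL [HKL HL]].
  (* Strip condition for killing [Lam], and a quarter of the allowed duration, since symmetrizing
     doubles it. *)
  destruct (small_solution [(K + KL, eps); (INR (length Lam), s / 4)]) as [d1 [Hd1 Hd1s]].
  { intros p [<-|[<-|[]]]; simpl; lra. }
  pose proof (Hd1s _ (or_introl eq_refl)) as D1.
  pose proof (Hd1s _ (or_intror (or_introl eq_refl))) as D2; simpl in D1, D2.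
  set (W1 := map (fun l => (d1, l)) Lam).
  assert (HW1 : forall w, In w (symmetrize W1) ->
    fst w = d1 /\ exists l, In l Lam /\ Rabs (Cre (snd w)) <= KL /\ (snd w = l \/ snd w = Cconj l)).
  { intros w Hw; destruct (in_symmetrize _ _ Hw) as [v [Hv [-> Hor]]].
    apply in_map_iff in Hv; destruct Hv as [l [<- Hl]]; simpl in *; split; trivial.
    exists l; repeat split; trivial; pose proof (HL l Hl); destruct Hor as [->| ->]; simpl; trivial. }
  assert (Hlow1 : forall z, escapes z -> (forall n, Rabs (Cre (z n)) <= K) ->
    (forall n l, (n0 <= n)%nat -> In l Lam -> z n <> l /\ z n <> Cconj l) ->
    exists k, 0 < k /\ forall n, (n0 <= n)%nat -> k <= Cnorm2 (Msym (symmetrize W1) (z n))).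
  { intros z Hz HzK Hzne; apply HWlow; trivial; intros w n Hw Hn.
    destruct (HW1 w Hw) as [Hf [l [Hl [HlK Hor]]]]; rewrite Hf; repeat split; trivial.
    - eapply Rle_trans; [|exact D1]; apply Rmult_le_compat_l; [lra|].
      specialize (HzK n); unfold Rminus; eapply Rle_trans; [apply Rabs_triang|].
      rewrite Rabs_Ropp; lra.
    - destruct (Hzne n l Hn Hl); destruct Hor as [->| ->]; trivial. }
  destruct (Hlow1 z1 He1 ltac:(apply HbK) ltac:(intros; now apply Hne)) as [k1 [Hk1 Hq1]].
  destruct (Hlow1 z2 He2 ltac:(apply HbK) ltac:(intros; now apply Hne)) as [k2 [Hk2 Hq2]].
  destruct (Cnorm2_Msym_upper (symmetrize W1) K) as [U [HU HUb]].
  set (k0 := Rmin k1 k2); assert (Hk0 : 0 < k0) by now apply Rmin_glb_lt.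
  (* U / k0 is the worst ratio left by killing [Lam]. The base is 16 = 4 * 4 because symmetrizing
     the real exponent [chi] applies its factor 2 j times. *)
  destruct (Pow_x_infinity 16 ltac:(rewrite Rabs_right; lra) (U / k0)) as [j Hj].
  specialize (Hj j (Nat.le_refl _)); rewrite Rabs_right in Hj by (apply Rle_ge, pow_le; lra).
  assert (Hj' : U <= k0 * 16 ^ j).
  { apply Rge_le in Hj; apply Rle_div_l in Hj; lra. }
  (* In order: strip condition at [chi], duration, the case where the minimum with 1 in the lower
     bound is 1, range of [sym_real_upper], and d2 <= 1 for d2^2 <= d2. *)
  destruct (small_solution [(2 * K, eps); (INR j, s / 4); (144 * (K * K), c); (2 * K, 1); (1, 1)])
    as [d2 [Hd2 Hd2s]].
  { intros p [<-|[<-|[<-|[<-|[<-|[]]]]]]; simpl; lra. }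
  pose proof (Hd2s _ (or_introl eq_refl)) as F1.
  pose proof (Hd2s _ (or_intror (or_introl eq_refl))) as F2.
  pose proof (Hd2s _ (or_intror (or_intror (or_introl eq_refl)))) as F3.
  pose proof (Hd2s _ (or_intror (or_intror (or_intror (or_introl eq_refl))))) as F4.
  pose proof (Hd2s _ (or_intror (or_intror (or_intror (or_intror (or_introl eq_refl)))))) as F5.
  simpl in F1, F2, F3, F4, F5.
  set (w2 := (d2, RtoC chi)).
  assert (HsW : forall w, In w (symmetrize (W1 ++ repeat w2 j)) -> In w (symmetrize W1) \/ w = w2).
  { intros w Hw; unfold symmetrize in *; rewrite map_app in Hw.
    assert (Hc2 : (fst w2, Cconj (snd w2)) = w2).
    { unfold w2, Cconj, RtoC; simpl; now rewrite Ropp_0. }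
    rewrite !in_app_iff in *; destruct Hw as [[Hw|Hw]|[Hw|Hw]]; auto.
    - right; now apply repeat_spec in Hw.
    - right; apply in_map_iff in Hw; destruct Hw as [v [<- Hv]]; apply repeat_spec in Hv; now subst v. }
  assert (Hchid : forall x, Rabs x <= K -> Rabs (x - chi) <= 2 * K).
  { intros x Hx; unfold Rminus; eapply Rle_trans; [apply Rabs_triang|]; rewrite Rabs_Ropp; lra. }
  assert (HlowW : forall z, escapes z -> (forall n, Rabs (Cre (z n)) <= K) ->
    (forall n, (n0 <= n)%nat -> 0 < Cim (z n)) ->
    (forall n l, (n0 <= n)%nat -> In l Lam -> z n <> l /\ z n <> Cconj l) ->
    exists k, 0 < k /\ forall n, (n0 <= n)%nat ->
      k <= Cnorm2 (Msym (symmetrize (W1 ++ repeat w2 j)) (z n))).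
  { intros z Hz HzK Hzp Hzne; apply HWlow; trivial; intros w n Hw Hn.
    destruct (HsW w Hw) as [Hw'| ->].
    - destruct (HW1 w Hw') as [Hf [l [Hl [HlK Hor]]]]; rewrite Hf; repeat split; trivial.
      + eapply Rle_trans; [|exact D1]; apply Rmult_le_compat_l; [lra|].
        specialize (HzK n); unfold Rminus; eapply Rle_trans; [apply Rabs_triang|].
        rewrite Rabs_Ropp; lra.
      + destruct (Hzne n l Hn Hl); destruct Hor as [->| ->]; trivial.
    - unfold w2; simpl; repeat split; trivial.
      + eapply Rle_trans; [apply Rmult_le_compat_l; [lra|now apply Hchid]|trivial].
      + intros E; specialize (Hzp n Hn); rewrite E in Hzp; simpl in Hzp; lra. }
  destruct (HlowW z1 He1 ltac:(apply HbK) ltac:(apply Hpos) ltac:(intros; now apply Hne)) as [h1 [Hh1 Hg1]].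
  destruct (HlowW z2 He2 ltac:(apply HbK) ltac:(apply Hpos) ltac:(intros; now apply Hne)) as [h2 [Hh2 Hg2]].
  assert (Hdamp : forall z x, Rabs (Cre z) <= K -> 1 + P2 <= Cim z -> Rabs x <= K ->
    k0 <= Cnorm2 (Msym (symmetrize W1) z) ->
    Cnorm2 (Msym (symmetrize (W1 ++ repeat w2 j)) (RtoC x))
    <= Cnorm2 (Msym (symmetrize (W1 ++ repeat w2 j)) z)).
  { intros z x HzK Hz Hx Hk.
    rewrite !Msym_symmetrize_app, !Cnorm2_mul; unfold w2; rewrite symmetrize_repeat.
    fold w2; rewrite !Cnorm2_Msym_repeat.
    set (a := Cnorm2 (msym w2 (RtoC x))); set (q := Cnorm2 (msym w2 z)).
    assert (Ha : 0 <= a) by apply Cnorm2_pos.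
    specialize (Hchid x Hx).
    assert (Hxx : (x - chi) * (x - chi) <= 4 * (K * K)) by (apply Rabs_le_between in Hchid; nra).
    (* One application at [chi] gains the factor 4: at x the squared symbol is at most 9 d2^2 (x -
       chi)^2, while at z it is at least c times the minimum of 1 and d2^2 |z - chi|^2, with z far
       up. *)
    assert (Haq : 4 * a <= q).
    { assert (Hy : 4 * a <= 36 * (d2 * (x - chi) * (d2 * (x - chi)))).
      { assert (Ea : msym w2 (RtoC x) = sym (RtoC (d2 * (x - chi)))).
        { unfold msym, w2, RtoC; simpl; do 2 f_equal; ring. }
        unfold a; rewrite Ea.
        assert (Hx1 : Rabs (d2 * (x - chi)) <= 1).
        { rewrite Rabs_mult, (Rabs_right d2) by lra.
          apply Rle_trans with (d2 * (2 * K)); [now apply Rmult_le_compat_l; [lra|]|trivial]. }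
        pose proof (sym_real_upper _ Hx1); lra. }
      assert (Hzx : Rabs (Cre z - chi) <= 2 * K).
      { unfold Rminus; eapply Rle_trans; [apply Rabs_triang|]; rewrite Rabs_Ropp; lra. }
      eapply Rle_trans; [exact Hy|]; unfold q; eapply Rle_trans; [|apply Hlow; simpl; trivial].
      2: { eapply Rle_trans; [|exact F1]; apply Rmult_le_compat_l; lra. }
      simpl; assert (Hd22 : d2 * d2 <= d2) by nra.
      assert (Hd2p : 0 <= d2 * d2) by nra.
      unfold Rmin; destruct (Rle_dec _ _).
      - assert (d2 * d2 * ((x - chi) * (x - chi)) <= d2 * (4 * (K * K))).
        { apply Rmult_le_compat; trivial; apply Rle_0_sqr. }
        lra.
      - pose proof (sqdist_real_lower z chi (1 + P2) ltac:(lra) Hz) as Hsd.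
        assert (HcP : c * P2 = 144 * (K * K)) by (unfold P2; field; lra).
        assert (c * P2 <= c * sqdist z (RtoC chi)) by (apply Rmult_le_compat_l; [lra|nra]).
        assert (d2 * d2 * (36 * ((x - chi) * (x - chi))) <= d2 * d2 * (c * sqdist z (RtoC chi)))
          by (apply Rmult_le_compat_l; lra).
        lra. }
    assert (Hpow : (4 * a) ^ (j + j) <= q ^ (j + j)) by (apply pow_incr; lra).
    rewrite Rpow_mult_distr, pow_add in Hpow.
    replace (4 ^ j * 4 ^ j) with (16 ^ j) in Hpow
      by (rewrite <- Rpow_mult_distr; f_equal; ring).
    assert (Hap : 0 <= a ^ (j + j)) by (apply pow_le; trivial).
    assert (Hqp : 0 <= q ^ (j + j)) by (apply pow_le; lra).
    apply Rle_trans with (U * a ^ (j + j)); [apply Rmult_le_compat_r; trivial; apply HUb; trivial|].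
    apply Rle_trans with (k0 * 16 ^ j * a ^ (j + j)); [now apply Rmult_le_compat_r|].
    apply Rle_trans with (k0 * q ^ (j + j)).
    - rewrite Rmult_assoc; apply Rmult_le_compat_l; lra.
    - now apply Rmult_le_compat_r. }
  exists (W1 ++ repeat w2 j), (Rmin h1 h2); repeat split.
  - intros w Hw; destruct (HsW w Hw) as [Hw'| ->]; [now destruct (HW1 w Hw') as [-> _]|trivial].
  - rewrite duration_symmetrize, duration_app, duration_repeat; unfold W1; rewrite duration_map.
    simpl; lra.
  - intros l Hl; rewrite Msym_symmetrize_app; unfold symmetrize at 1; rewrite Msym_app.
    rewrite (Msym_kill W1 d1 l), !Cmul_0_l; trivial.
    apply in_map_iff; now exists l.
  - now apply Rmin_glb_lt.
  - eapply Rle_trans; [apply Rmin_l|now apply Hg1].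
  - eapply Rle_trans; [apply Rmin_r|now apply Hg2].
  - apply Hdamp; try apply HbK; try (now apply HP).
    apply Rle_trans with k1; [apply Rmin_l|now apply Hq1].
  - apply Hdamp; try apply HbK; try (now apply HP).
    apply Rle_trans with k2; [apply Rmin_r|now apply Hq2].
Qed.

(** * The two components as exponential sums *)

Definition pairL (a l : Cpx) : expsum := [(a, Cmul Ci l); (Cconj a, Cconj (Cmul Ci l))].
Definition realL (x y : R) : expsum := [(RtoC x, RtoC y)].

(** A fixed layout in which the exponents do not depend on the coefficients: a multiplier changes
    the coefficients only, and the independence constant can be chosen before them. *)
Fixpoint L1 (om ze : nat -> Cpx) (r : nat -> R) (Cc Dd : nat -> Cpx) (Rr : nat -> R) (N : nat)
  : expsum :=
  match N with
  | O => []
  | S k => (pairL (Cc N) (om N) ++ pairL (Dd N) (ze N) ++ realL (Rr N) (r N))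
             ++ L1 om ze r Cc Dd Rr k
  end.

Fixpoint L2 (om ze c d : nat -> Cpx) (eta : R) (Cc Dd : nat -> Cpx) (E : R) (N : nat) : expsum :=
  match N with
  | O => realL E (- eta)
  | S k => (pairL (Cmul (d N) (Dd N)) (ze N) ++ pairL (Cmul (c N) (Cc N)) (om N))
             ++ L2 om ze c d eta Cc Dd E k
  end.

Lemma ev_pairL (a l : Cpx) (t : R) : ev (pairL a l) t = (osc a l t, 0).
Proof.
  rewrite <- conj_pair_osc; simpl; rewrite Cmul_assoc.
  replace (Copp (Cmul Ci (Cmul (Cconj l) (RtoC t)))) with (Cmul (Cconj (Cmul Ci l)) (RtoC t)).
  - unfold Cadd at 2; simpl; unfold Cadd; simpl; f_equal; ring.
  - unfold Copp, Cmul, Cconj, Ci, RtoC; simpl; f_equal; ring.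
Qed.

Lemma ev_realL (x y t : R) : ev (realL x y) t = (x * exp (y * t), 0).
Proof.
  unfold realL, ev, Cexp, Cmul, Cadd, RtoC; simpl.
  replace (y * 0 + 0 * t) with 0 by ring; replace (y * t - 0 * 0) with (y * t) by ring.
  rewrite cos_0, sin_0; f_equal; ring.
Qed.

Lemma ev_L1 om ze r Cc Dd Rr N t : ev (L1 om ze r Cc Dd Rr N) t = (U1 om ze r Cc Dd Rr N t, 0).
Proof.
  unfold U1, fam, rho; rewrite <- !Rsum1_plus; induction N as [|N IH]; trivial.
  change (L1 om ze r Cc Dd Rr (S N)) with
    ((pairL (Cc (S N)) (om (S N)) ++ pairL (Dd (S N)) (ze (S N)) ++ realL (Rr (S N)) (r (S N)))
      ++ L1 om ze r Cc Dd Rr N).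
  rewrite !ev_app, IH, !ev_pairL, ev_realL, Rsum1_S; unfold Cadd; simpl; f_equal; ring.
Qed.

Lemma ev_L2 om ze c d eta Cc Dd E N t :
  ev (L2 om ze c d eta Cc Dd E N) t = (U2 om ze c d eta Cc Dd E N t, 0).
Proof.
  unfold U2, fam; rewrite <- Rplus_assoc, <- Rsum1_plus; induction N as [|N IH].
  - change (L2 om ze c d eta Cc Dd E 0) with (realL E (- eta)); rewrite ev_realL.
    simpl; f_equal; ring.
  - change (L2 om ze c d eta Cc Dd E (S N)) with
      ((pairL (Cmul (d (S N)) (Dd (S N))) (ze (S N)) ++ pairL (Cmul (c (S N)) (Cc (S N))) (om (S N)))
        ++ L2 om ze c d eta Cc Dd E N).
    rewrite !ev_app, IH, !ev_pairL, Rsum1_S; unfold Cadd; simpl; f_equal; ring.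
Qed.

Lemma enL_L1 om ze r Cc Dd Rr N T : enL T (L1 om ze r Cc Dd Rr N)
  = Int (fun t => U1 om ze r Cc Dd Rr N t * U1 om ze r Cc Dd Rr N t) 0 T.
Proof. apply Int_ext; intros t; rewrite ev_L1; unfold Cnorm2; simpl; ring. Qed.

Lemma energy_enL om ze c d r eta T Cc Dd Rr E N :
  energy om ze c d r eta T Cc Dd Rr E N
  = enL T (L1 om ze r Cc Dd Rr N) + enL T (L2 om ze c d eta Cc Dd E N).
Proof.
  unfold energy; rewrite Int_plus, <- enL_L1 by auto with cont; f_equal.
  apply Int_ext; intros t; rewrite ev_L2; unfold Cnorm2; simpl; ring.
Qed.

Lemma enL_mono (L : expsum) (T T' : R) : 0 <= T' -> T' <= T -> enL T' L <= enL T L.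
Proof. intros; apply Int_sub; auto with cont; try lra; intros; apply Cnorm2_pos. Qed.

Lemma scaleL_app g (L L' : expsum) : scaleL g (L ++ L') = scaleL g L ++ scaleL g L'.
Proof. apply map_app. Qed.

Lemma Cconj_real (x : R) : Cconj (RtoC x) = RtoC x.
Proof. unfold Cconj, RtoC; simpl; f_equal; ring. Qed.

Definition conj_invariant (g : Cpx -> Cpx) : Prop := forall z, g (Cconj z) = Cconj (g z).

Lemma scaleL_pairL g (a l : Cpx) : conj_invariant g ->
  scaleL g (pairL a l) = pairL (Cmul (g (Cmul Ci l)) a) l.
Proof. intros Hg; unfold scaleL, pairL; cbn [map fst snd]; now rewrite Hg, (Cconj_mul (g _)). Qed.

Lemma conj_invariant_real g (y : R) : conj_invariant g -> g (RtoC y) = RtoC (Cre (g (RtoC y))).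
Proof.
  intros Hg; pose proof (Hg (RtoC y)) as H.
  rewrite Cconj_real in H.
  destruct (g (RtoC y)) as [x z]; unfold Cconj, RtoC in *; simpl in *.
  injection H; intros; f_equal; lra.
Qed.

Lemma scaleL_realL g (x y : R) : conj_invariant g ->
  scaleL g (realL x y) = realL (Cre (g (RtoC y)) * x) y.
Proof.
  intros Hg; unfold scaleL, realL; cbn [map fst snd]; rewrite (conj_invariant_real g y Hg).
  unfold Cmul, RtoC; simpl; do 3 f_equal; ring.
Qed.

Lemma scaleL_L1 g om ze r Cc Dd Rr N : conj_invariant g -> scaleL g (L1 om ze r Cc Dd Rr N) =
  L1 om ze r (fun n => Cmul (g (Cmul Ci (om n))) (Cc n)) (fun n => Cmul (g (Cmul Ci (ze n))) (Dd n))
    (fun n => Cre (g (RtoC (r n))) * Rr n) N.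
Proof.
  intros Hg; induction N as [|N IH]; trivial; cbn [L1].
  now rewrite !scaleL_app, IH, !scaleL_pairL, scaleL_realL.
Qed.

Lemma scaleL_L2 g om ze c d eta Cc Dd E N : conj_invariant g -> scaleL g (L2 om ze c d eta Cc Dd E N) =
  L2 om ze c d eta (fun n => Cmul (g (Cmul Ci (om n))) (Cc n))
    (fun n => Cmul (g (Cmul Ci (ze n))) (Dd n)) (Cre (g (RtoC (- eta))) * E) N.
Proof.
  intros Hg; assert (Hsw : forall a b x, Cmul a (Cmul b x) = Cmul b (Cmul a x)).
  { intros a b x; rewrite !Cmul_assoc; f_equal; apply Cmul_comm. }
  induction N as [|N IH]; cbn [L2]; [now apply scaleL_realL|].
  rewrite !scaleL_app, IH, !scaleL_pairL by trivial; now rewrite !(Hsw (g _)).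
Qed.

(** A symmetrized multiplier commutes with d_n and c_n and preserves realness, so the scaled lists
    are again [L1] and [L2] of new coefficients, on an interval shortened by the duration. *)
Lemma energy_multiplier om ze c d r eta T W :
  (forall w, In w (symmetrize W) -> 0 < fst w) -> duration (symmetrize W) <= T ->
  let g := Msym (symmetrize W) in
  exists K, 0 <= K /\ forall Cc Dd Rr E N,
    energy om ze c d r eta (T - duration (symmetrize W))
      (fun n => Cmul (g (Cmul Ci (om n))) (Cc n)) (fun n => Cmul (g (Cmul Ci (ze n))) (Dd n))
      (fun n => Cre (g (RtoC (r n))) * Rr n) (Cre (g (RtoC (- eta))) * E) N
    <= K * energy om ze c d r eta T Cc Dd Rr E N.
Proof.
  intros HW HT g; destruct (enL_scale_Msym (symmetrize W) T HW HT) as [K [HK H]].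
  exists K; split; trivial; intros Cc Dd Rr E N.
  assert (Hg : conj_invariant (Msym (symmetrize W))) by (intros z; apply Msym_symmetrize_conj).
  rewrite !energy_enL; unfold g; rewrite <- scaleL_L1, <- scaleL_L2 by trivial.
  pose proof (H (L1 om ze r Cc Dd Rr N)); pose proof (H (L2 om ze c d eta Cc Dd E N)); lra.
Qed.

(** * Reading off the low coefficients *)

Lemma coefsum_app (z : Cpx) (L L' : expsum) :
  coefsum z (L ++ L') = Cadd (coefsum z L) (coefsum z L').
Proof.
  induction L as [|[a y] L IH]; simpl.
  - destruct (coefsum z L'); unfold Cadd; simpl; f_equal; ring.
  - rewrite IH; destruct (Ceq_dec y z); trivial; apply Cadd_assoc.
Qed.

Lemma coefsum_other (z : Cpx) (L : expsum) :
  (forall p, In p L -> snd p <> z) -> coefsum z L = (0, 0).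
Proof.
  induction L as [|[a y] L IH]; intros H; trivial; simpl.
  destruct (Ceq_dec y z) as [E|E]; [now destruct (H (a, y) (or_introl eq_refl))|].
  apply IH; intros; apply H; now right.
Qed.

Lemma coefsum_pairL (a l : Cpx) : Cre l > 0 -> coefsum (Cmul Ci l) (pairL a l) = a.
Proof.
  intros Hl; unfold pairL; cbn [coefsum fold_right fst snd].
  destruct (Ceq_dec (Cmul Ci l) (Cmul Ci l)) as [_|H]; [|now destruct H].
  destruct (Ceq_dec (Cconj (Cmul Ci l)) (Cmul Ci l)) as [E|_].
  - destruct l as [x y]; unfold Cconj, Cmul in E; simpl in *; injection E; intros; lra.
  - destruct a; unfold Cadd; simpl; f_equal; ring.
Qed.

Lemma pairL_exponents (a l m : Cpx) : Cre l > 0 -> Cre m > 0 -> l <> m ->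
  forall p, In p (pairL a l) -> snd p <> Cmul Ci m.
Proof.
  intros Hl Hm Hlm p Hp E; destruct l as [x y], m as [x' y']; simpl in Hl, Hm.
  destruct Hp as [<-|[<-|[]]]; unfold Cmul, Cconj in E; simpl in E; injection E; intros.
  - apply Hlm; f_equal; lra.
  - lra.
Qed.

Lemma realL_exponents (x y : R) (m : Cpx) : Cre m > 0 ->
  forall p, In p (realL x y) -> snd p <> Cmul Ci m.
Proof.
  intros Hm p [<-|[]] E; destruct m as [x' y']; simpl in Hm.
  unfold RtoC, Cmul in E; simpl in E; injection E; intros; lra.
Qed.

Lemma Cadd_0_l (a : Cpx) : Cadd (0, 0) a = a.
Proof. destruct a; unfold Cadd; simpl; f_equal; ring. Qed.
Lemma Cadd_0_r (a : Cpx) : Cadd a (0, 0) = a.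
Proof. destruct a; unfold Cadd; simpl; f_equal; ring. Qed.

(** The imaginary part of i om_k is Re om_k > 0, which separates it from the real exponents and from
    all conjugated ones; distinctness separates it from the rest. *)
Lemma coefsum_L1_om om ze r Cc Dd Rr N k :
  (forall n, (n >= 1)%nat -> Cre (om n) > 0 /\ Cre (ze n) > 0) ->
  (forall n m, (n >= 1)%nat -> (m >= 1)%nat -> n <> m -> om n <> om m) ->
  (forall n m, (n >= 1)%nat -> (m >= 1)%nat -> om n <> ze m) -> (1 <= k)%nat ->
  coefsum (Cmul Ci (om k)) (L1 om ze r Cc Dd Rr N) = if le_dec k N then Cc k else (0, 0).
Proof.
  intros Hpos Hom Hoz Hk; destruct (Hpos k Hk) as [Hk1 _].
  induction N as [|N IH]; [destruct (le_dec k 0); [lia|trivial]|].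
  cbn [L1]; rewrite !coefsum_app, IH; clear IH.
  destruct (Hpos (S N) ltac:(lia)) as [HN1 HN2].
  rewrite (coefsum_other _ (pairL (Dd (S N)) _)).
  2: { apply pairL_exponents; trivial; apply not_eq_sym, Hoz; lia. }
  rewrite (coefsum_other _ (realL _ _)) by now apply realL_exponents.
  destruct (Nat.eq_dec k (S N)) as [->|Hne].
  - rewrite coefsum_pairL by trivial; destruct (le_dec (S N) (S N)), (le_dec (S N) N); try lia.
    now rewrite !Cadd_0_r.
  - rewrite coefsum_other by (apply pairL_exponents; trivial; apply Hom; lia).
    destruct (le_dec k (S N)), (le_dec k N); try lia; now rewrite !Cadd_0_l.
Qed.

Lemma coefsum_L1_ze om ze r Cc Dd Rr N k :
  (forall n, (n >= 1)%nat -> Cre (om n) > 0 /\ Cre (ze n) > 0) ->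
  (forall n m, (n >= 1)%nat -> (m >= 1)%nat -> n <> m -> ze n <> ze m) ->
  (forall n m, (n >= 1)%nat -> (m >= 1)%nat -> om n <> ze m) -> (1 <= k)%nat ->
  coefsum (Cmul Ci (ze k)) (L1 om ze r Cc Dd Rr N) = if le_dec k N then Dd k else (0, 0).
Proof.
  intros Hpos Hze Hoz Hk; destruct (Hpos k Hk) as [_ Hk1].
  induction N as [|N IH]; [destruct (le_dec k 0); [lia|trivial]|].
  cbn [L1]; rewrite !coefsum_app, IH; clear IH.
  destruct (Hpos (S N) ltac:(lia)) as [HN1 HN2].
  rewrite (coefsum_other _ (pairL (Cc (S N)) _)).
  2: { apply pairL_exponents; trivial; apply Hoz; lia. }
  rewrite (coefsum_other _ (realL _ _)) by now apply realL_exponents.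
  destruct (Nat.eq_dec k (S N)) as [->|Hne].
  - rewrite coefsum_pairL by trivial; destruct (le_dec (S N) (S N)), (le_dec (S N) N); try lia.
    now rewrite !Cadd_0_r, Cadd_0_l.
  - rewrite coefsum_other by (apply pairL_exponents; trivial; apply Hze; lia).
    destruct (le_dec k (S N)), (le_dec k N); try lia; now rewrite !Cadd_0_l.
Qed.

Lemma exponents_L1 om ze r Cc Dd Rr Cc' Dd' Rr' N :
  map snd (L1 om ze r Cc Dd Rr N) = map snd (L1 om ze r Cc' Dd' Rr' N).
Proof. induction N as [|N IH]; trivial; cbn [L1]; rewrite !map_app, IH; reflexivity. Qed.

(** [U1] contains both i om_k and i ze_k, so independence recovers C_k and D_k from it, and
    multiplying by |d_k|^2 gives the second half of [coef2]. The real exponentials may have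
    arbitrary coefficients here. *)
Lemma low_energy_inverse om ze d r T n0 : 0 < T ->
  (forall n, (n >= 1)%nat -> Cre (om n) > 0 /\ Cre (ze n) > 0) ->
  (forall n m, (n >= 1)%nat -> (m >= 1)%nat -> n <> m -> om n <> om m) ->
  (forall n m, (n >= 1)%nat -> (m >= 1)%nat -> n <> m -> ze n <> ze m) ->
  (forall n m, (n >= 1)%nat -> (m >= 1)%nat -> om n <> ze m) ->
  exists Q, 0 <= Q /\ forall Cc Dd Rr,
    Rsum1 (coef2 d Cc Dd) n0 <=
    Q * Int (fun t => U1 om ze r Cc Dd Rr n0 t * U1 om ze r Cc Dd Rr n0 t) 0 T.
Proof.
  intros HT Hpos Hom Hze Hoz.
  assert (H : forall n, (n <= n0)%nat -> exists Q, 0 <= Q /\ forall Cc Dd Rr,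
    Rsum1 (coef2 d Cc Dd) n <= Q * enL T (L1 om ze r Cc Dd Rr n0)).
  { induction n as [|n IH]; intros Hn.
    - exists 0; split; [lra|]; intros; simpl; lra.
    - destruct IH as [Q [HQ IH]]; [lia|].
      (* The exponents are read off from zero coefficients, so that the constants precede the
         coefficients. *)
      set (Zl := map snd (L1 om ze r (fun _ => (0, 0)) (fun _ => (0, 0)) (fun _ => 0) n0)).
      assert (HZl : forall Cc Dd Rr p, In p (L1 om ze r Cc Dd Rr n0) -> In (snd p) Zl).
      { intros Cc Dd Rr p Hp; unfold Zl.
        rewrite (exponents_L1 om ze r _ _ _ Cc Dd Rr); now apply in_map. }
      destruct (exponentials_independent Zl (Cmul Ci (om (S n))) T HT) as [Ka [HKa Ha]].
      destruct (exponentials_independent Zl (Cmul Ci (ze (S n))) T HT) as [Kb [HKb Hb]].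
      exists (Q + (Ka + Cnorm2 (d (S n)) * Kb)); pose proof (Cnorm2_pos (d (S n))) as Hd.
      split; [pose proof (Rmult_le_pos _ _ Hd HKb); lra|]; intros Cc Dd Rr; rewrite Rsum1_S.
      specialize (IH Cc Dd Rr); specialize (Ha _ (HZl Cc Dd Rr)); specialize (Hb _ (HZl Cc Dd Rr)).
      rewrite coefsum_L1_om in Ha by (trivial; lia); rewrite coefsum_L1_ze in Hb by (trivial; lia).
      destruct (le_dec (S n) n0); [|lia].
      unfold coef2 at 2; rewrite Cnorm2_mul.
      apply (Rmult_le_compat_l _ _ _ Hd) in Hb; lra. }
  destruct (H n0 (Nat.le_refl _)) as [Q [HQ H1]]; exists Q; split; trivial.
  intros; rewrite <- enL_L1; apply H1.
Qed.

Definition lowR (n0 : nat) (Rr : nat -> R) (n : nat) : R := if lt_dec n n0 then Rr n else 0.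
Definition highR (n0 : nat) (Rr : nat -> R) (n : nat) : R := if lt_dec n n0 then 0 else Rr n.

Lemma U1_low_high om ze r Cc Dd Rr n0 N t : U1 om ze r Cc Dd Rr N t =
  U1 om ze r (low n0 Cc) (low n0 Dd) (lowR n0 Rr) N t
  + U1 om ze r (high n0 Cc) (high n0 Dd) (highR n0 Rr) N t.
Proof.
  unfold U1; rewrite (fam_low_high n0 Cc), (fam_low_high n0 Dd).
  assert (H : rho r Rr N t = rho r (lowR n0 Rr) N t + rho r (highR n0 Rr) N t).
  { unfold rho; rewrite <- Rsum1_plus; apply Rsum1_ext; intros n _.
    unfold lowR, highR; destruct (lt_dec n n0); ring. }
  rewrite H; ring.
Qed.

Lemma U1_low_cut om ze r Cc Dd Rr n0 N t : (n0 <= N)%nat ->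
  U1 om ze r (low n0 Cc) (low n0 Dd) (lowR n0 Rr) N t
  = U1 om ze r (low n0 Cc) (low n0 Dd) (lowR n0 Rr) n0 t.
Proof.
  intros HN; unfold U1, fam, rho.
  rewrite !(Rsum1_cut _ N n0); trivial; intros n Hn; unfold low, lowR;
    destruct (lt_dec n n0); try lia; try apply osc_0; ring.
Qed.

Lemma coef2_low_high d Cc Dd n0 n :
  coef2 d Cc Dd n = coef2 d (low n0 Cc) (low n0 Dd) n + coef2 d (high n0 Cc) (high n0 Dd) n.
Proof.
  unfold coef2, low, high; destruct (lt_dec n n0); rewrite Cmul_0_r, Cnorm2_0; ring.
Qed.

Lemma admissible_high mu nu n' d Cc Dd Rr n0 : 0 <= mu -> nu > 1 / 2 ->
  admissible mu nu n' d Cc Dd Rr ->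
  admissible mu nu n' d (high n0 Cc) (high n0 Dd) (highR n0 Rr).
Proof.
  intros Hmu Hnu H n Hn; specialize (H n Hn); unfold coef2, high, highR in *.
  destruct (lt_dec n n0); trivial; rewrite Rabs_R0; apply Rmult_le_pos; [|apply sqrt_pos].
  apply Rmult_le_pos; trivial; apply Rlt_le, weight_bounds; trivial; lra.
Qed.

Lemma energy_ext om ze c d r eta T Cc Dd Rr E Cc' Dd' Rr' E' N :
  (forall n, (1 <= n)%nat -> Cc n = Cc' n /\ Dd n = Dd' n /\ Rr n = Rr' n) -> E = E' ->
  energy om ze c d r eta T Cc Dd Rr E N = energy om ze c d r eta T Cc' Dd' Rr' E' N.
Proof.
  intros H ->; apply Int_ext; intros t.
  assert (H1 : U1 om ze r Cc Dd Rr N t = U1 om ze r Cc' Dd' Rr' N t).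
  { unfold U1, fam, rho; f_equal; [|f_equal]; apply Rsum1_ext; intros n Hn;
      destruct (H n ltac:(lia)) as [E1 [E2 E3]]; congruence. }
  assert (H2 : U2 om ze c d eta Cc Dd E' N t = U2 om ze c d eta Cc' Dd' E' N t).
  { unfold U2, fam; f_equal; [|f_equal]; apply Rsum1_ext; intros n Hn;
      destruct (H n ltac:(lia)) as [E1 [E2 E3]]; congruence. }
  now rewrite H1, H2.
Qed.

(** * Inverse inequality *)

Lemma Cre_sqr_le (a : Cpx) : Cre a * Cre a <= Cnorm2 a.
Proof. unfold Cnorm2; nra. Qed.

(** The multiplier removes all low terms and the term with E, and the tail inequality on the shorter
    interval T' bounds the tail coefficients by the full energy. Then the low part of [U1] is the
    whole minus the tail, whose energy is bounded by the direct inequality with E = 0, and the low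
    coefficients follow. As -eta is killed, no bound on E enters. *)
Lemma energy_inverse om ze c d r gamma alpha chi T mu nu n' eta K Kc Kd :
  0 < gamma -> 0 < T -> 2 * PI / T < gamma -> 0 <= alpha -> 0 <= mu -> nu > 1 / 2 ->
  0 <= K -> 0 <= Kc -> 0 <= Kd ->
  liminf_eq (fun n => Cre (om (S n)) - Cre (om n)) gamma ->
  liminf_eq (fun n => Cre (ze (S n)) - Cre (ze n)) gamma ->
  Un_cv (fun n => Cim (om n)) alpha -> Un_cv (fun n => Cim (ze n)) 0 ->
  (forall n, Rabs (Cim (om n)) <= K /\ Rabs (Cim (ze n)) <= K /\ Rabs (r n) <= K) ->
  Rabs chi <= K ->
  (forall e, 0 < e -> exists n0, forall n, (n0 <= n)%nat -> 1 <= e * Cnorm2 (d n)) ->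
  (forall e, 0 < e -> exists n0, forall n, (n0 <= n)%nat -> Cnorm2 (c n) <= e) ->
  (forall n, (1 <= n)%nat -> 1 <= Kd * Cnorm2 (d n)) ->
  (forall n, (1 <= n)%nat -> Cnorm2 (c n) <= Kc) ->
  (forall n, (n >= 1)%nat -> Cre (om n) > 0 /\ Cre (ze n) > 0) ->
  (forall n m, (n >= 1)%nat -> (m >= 1)%nat -> n <> m -> om n <> om m) ->
  (forall n m, (n >= 1)%nat -> (m >= 1)%nat -> n <> m -> ze n <> ze m) ->
  (forall n m, (n >= 1)%nat -> (m >= 1)%nat -> om n <> ze m) ->
  exists A n1, 0 < A /\ forall Cc Dd Rr E N, (n1 <= N)%nat -> admissible mu nu n' d Cc Dd Rr ->
    A * Rsum1 (coef2 d Cc Dd) N <= energy om ze c d r eta T Cc Dd Rr E N.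
Proof.
  intros Hg HT HTg Hal Hmu Hnu HK HKc HKd L1' L2' V1 V2 HbK Hchi Hd Hc Hd' Hc' Hpos Dom Dze Doz.
  (* Still above the threshold 2 PI / gamma, and T - T' is available for the averaging. *)
  set (T' := (T + 2 * PI / gamma) / 2); pose proof PI_RGT_0 as Hpi.
  assert (Hpg : 2 * PI / gamma < T).
  { apply Rlt_div_l in HTg; trivial; apply Rlt_div_l; trivial; lra. }
  assert (Hpg0 : 0 < 2 * PI / gamma) by (apply Rdiv_lt_0_compat; lra).
  assert (HT' : 0 < T') by (unfold T'; lra); assert (HTT : T' < T) by (unfold T'; lra).
  assert (HTg' : 2 * PI / T' < gamma).
  { apply Rlt_div_l; trivial.
    assert (Hlt : 2 * PI / gamma < T') by (unfold T'; lra); apply (proj1 (Rlt_div_l _ _ _ Hg)) in Hlt; lra. }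
  assert (HrK : forall n, Rabs (r n) <= K) by apply HbK.
  destruct (energy_tail_inverse om ze c d r gamma alpha T' mu nu n' eta K HT' HTg' Hal Hmu Hnu
    L1' L2' V1 V2 HrK Hd Hc) as (m0 & A0 & _ & HA0 & Htail).
  destruct (energy_direct om ze c d r gamma alpha T mu nu n' eta K Kc Kd HT HTg Hal Hmu Hnu HKc HKd
    L1' L2' V1 V2 HrK Hd' Hc') as (B & HB & Hdir).
  destruct (killing_multiplier K HK) as (P & HP & Hmult).
  assert (Esc1 : escapes (fun n => Cmul Ci (om n))).
  { intros X; destruct (liminf_unbounded (fun n => Cre (om n)) gamma Hg L1' X) as [k Hk].
    exists k; intros n Hn; specialize (Hk n Hn); simpl; lra. }
  assert (Esc2 : escapes (fun n => Cmul Ci (ze n))).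
  { intros X; destruct (liminf_unbounded (fun n => Cre (ze n)) gamma Hg L2' X) as [k Hk].
    exists k; intros n Hn; specialize (Hk n Hn); simpl; lra. }
  destruct (Esc1 P) as [p1 Hp1]; destruct (Esc2 P) as [p2 Hp2].
  (* n0 uses the height [P] of the multiplier lemma, and the killed list depends on n0; this is why
     [P] is quantified before the list there. *)
  set (n0 := Nat.max 1 (Nat.max m0 (Nat.max p1 p2))).
  set (Lam := RtoC (- eta) :: flat_map (fun m => [Cmul Ci (om m); Cmul Ci (ze m); RtoC (r m)])
                                (seq 1 (n0 - 1))).
  assert (HLam : forall l, In l Lam -> (exists x, l = RtoC x) \/
     exists m, (1 <= m < n0)%nat /\ (l = Cmul Ci (om m) \/ l = Cmul Ci (ze m))).
  { intros l [<-|Hl]; [left; now eexists|].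
    apply in_flat_map in Hl; destruct Hl as [m [Hm Hl]]; apply in_seq in Hm.
    destruct Hl as [<-|[<-|[<-|[]]]].
    - right; exists m; split; [lia|auto].
    - right; exists m; split; [lia|auto].
    - left; now eexists. }
  assert (HLin : forall m, (1 <= m < n0)%nat ->
    In (Cmul Ci (om m)) Lam /\ In (Cmul Ci (ze m)) Lam /\ In (RtoC (r m)) Lam).
  { intros m Hm; repeat split; right; apply in_flat_map; exists m; split;
      try (apply in_seq; lia); simpl; auto. }
  assert (Hsep : forall a, Cre a > 0 -> (forall m, (1 <= m < n0)%nat -> a <> om m /\ a <> ze m) ->
    forall l, In l Lam -> Cmul Ci a <> l /\ Cmul Ci a <> Cconj l).
  { intros [x y] Hx Ha l Hl; simpl in Hx.
    destruct (HLam l Hl) as [[z ->]|[m [Hm Hor]]].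
    - split; intros E; unfold RtoC, Cconj, Cmul in E; simpl in E; injection E; intros; lra.
    - destruct (Ha m Hm) as [Ha1 Ha2]; destruct (Hpos m ltac:(lia)) as [Hq1 Hq2].
      destruct Hor as [->| ->].
      + destruct (om m) as [x' y']; simpl in Hq1; split; intros E; unfold Cconj, Cmul in E;
          simpl in E; injection E; intros; [apply Ha1; f_equal; lra|lra].
      + destruct (ze m) as [x' y']; simpl in Hq2; split; intros E; unfold Cconj, Cmul in E;
          simpl in E; injection E; intros; [apply Ha2; f_equal; lra|lra]. }
  destruct (Hmult (fun n => Cmul Ci (om n)) (fun n => Cmul Ci (ze n)) r chi Lam n0 (T - T')
    ltac:(lra) Esc1 Esc2) as (W & k & HW & HdW & Hkill & Hk & Hq); trivial.
  { intros n; destruct (HbK n) as [H1 [H2 H3]]; repeat split; trivial; simpl.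
    - replace (0 * Cre (om n) - 1 * Cim (om n)) with (- Cim (om n)) by ring; now rewrite Rabs_Ropp.
    - replace (0 * Cre (ze n) - 1 * Cim (ze n)) with (- Cim (ze n)) by ring; now rewrite Rabs_Ropp. }
  { intros n Hn; split; [apply Hp1|apply Hp2]; lia. }
  { intros n l Hn Hl; destruct (Hpos n ltac:(lia)) as [Hn1 Hn2]; split; apply Hsep; trivial.
    - intros m Hm; split; [apply Dom|apply Doz]; lia.
    - intros m Hm; split; [apply not_eq_sym, Doz|apply Dze]; lia. }
  { intros n Hn; destruct (Hpos n ltac:(lia)); simpl; split; lra. }
  set (g := Msym (symmetrize W)) in *; cbv zeta in Hq.
  destruct (energy_multiplier om ze c d r eta T W HW ltac:(lra)) as [K1 [HK1 HE1]].
  cbv zeta in HE1; fold g in HE1.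
  destruct (low_energy_inverse om ze d r T n0 HT Hpos Dom Dze Doz) as [Q [HQ Hlow]].
  set (K2 := K1 / (A0 * k)).
  assert (HAk : 0 < A0 * k) by now apply Rmult_lt_0_compat.
  assert (HK2 : 0 <= K2) by (apply Rmult_le_pos; trivial; now apply Rlt_le, Rinv_0_lt_compat).
  (* Sum of the constants for the tail and for the low part; the 1 makes Z positive. *)
  set (Z := 1 + K2 + Q * (2 + 2 * (B * K2))).
  assert (HQZ : 0 <= Q * (2 + 2 * (B * K2))).
  { apply Rmult_le_pos; trivial; pose proof (Rmult_le_pos _ _ HB HK2); lra. }
  assert (HZ : 0 < Z) by (unfold Z; lra).
  exists (/ Z), n0; split; [now apply Rinv_0_lt_compat|]; intros Cc Dd Rr E N HN HR.
  set (en := energy om ze c d r eta T Cc Dd Rr E N).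
  assert (Hen : 0 <= en).
  { apply Int_nonneg; auto with cont; [lra|]; intros; nra. }
  set (Sh := Rsum1 (coef2 d (high n0 Cc) (high n0 Dd)) N).
  set (Sl := Rsum1 (coef2 d (low n0 Cc) (low n0 Dd)) N).
  assert (HS : Rsum1 (coef2 d Cc Dd) N = Sl + Sh).
  { unfold Sl, Sh; rewrite <- Rsum1_plus; apply Rsum1_ext; intros; apply coef2_low_high. }
  assert (HSh : Sh <= K2 * en).
  { set (C' := fun n => Cmul (g (Cmul Ci (om n))) (Cc n)).
    set (D' := fun n => Cmul (g (Cmul Ci (ze n))) (Dd n)).
    set (R' := fun n => Cre (g (RtoC (r n))) * Rr n).
    assert (Hz : forall n, (1 <= n < n0)%nat -> C' n = (0, 0) /\ D' n = (0, 0) /\ R' n = 0).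
    { intros n Hn; destruct (HLin n Hn) as [I1 [I2 I3]]; unfold C', D', R'.
      rewrite !Hkill by trivial; rewrite !Cmul_0_l; simpl; repeat split; ring. }
    assert (Hcoef : forall n, coef2 d C' D' n =
      Cnorm2 (g (Cmul Ci (om n))) * Cnorm2 (Cc n)
      + Cnorm2 (g (Cmul Ci (ze n))) * Cnorm2 (Cmul (d n) (Dd n))).
    { intros n; unfold coef2, C', D'; rewrite !Cnorm2_mul; ring. }
    (* Scaling preserves admissibility because the multiplier at r_n is dominated by those at i om_n
       and i ze_n. [high n0] also clears index 0, which no sum meets but the tail inequality
       requires to vanish. *)
    assert (HR' : admissible mu nu n' d (high n0 C') (high n0 D') R').
    { intros n Hn; destruct (lt_dec n n0) as [Hlt|Hge].
      - rewrite (proj2 (proj2 (Hz n ltac:(lia)))), Rabs_R0.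
        apply Rmult_le_pos; [|apply sqrt_pos].
        apply Rmult_le_pos; trivial; apply Rlt_le, weight_bounds; trivial; lra.
      - assert (Hco : coef2 d (high n0 C') (high n0 D') n = coef2 d C' D' n).
        { unfold coef2, high; destruct (lt_dec n n0); [easy|trivial]. }
        rewrite Hco, Hcoef; unfold R'.
        destruct (Hq n ltac:(lia)) as (_ & _ & Q1 & Q2).
        set (h := Cnorm2 (g (RtoC (r n)))) in *.
        rewrite Rabs_mult.
        apply Rle_trans with (sqrt h * (mu * weight nu n' n * sqrt (coef2 d Cc Dd n))).
        + apply Rmult_le_compat; try apply Rabs_pos; [|now apply HR].
          rewrite <- sqrt_Rsqr_abs; apply sqrt_le_1_alt, Cre_sqr_le.
        + replace (sqrt h * (mu * weight nu n' n * sqrt (coef2 d Cc Dd n)))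
            with (mu * weight nu n' n * (sqrt h * sqrt (coef2 d Cc Dd n))) by ring.
          apply Rmult_le_compat_l.
          { apply Rmult_le_pos; trivial; apply Rlt_le, weight_bounds; trivial; lra. }
          rewrite <- sqrt_mult by (apply Cnorm2_pos || apply coef2_pos).
          apply sqrt_le_1_alt; unfold coef2 at 1; rewrite Rmult_plus_distr_l.
          apply Rplus_le_compat; apply Rmult_le_compat_r; trivial; apply Cnorm2_pos. }
    specialize (Htail (high n0 C') (high n0 D') R' N HR').
    assert (H0 : forall j, (j < m0)%nat -> high n0 C' j = (0, 0) /\ high n0 D' j = (0, 0)).
    { intros j Hj; unfold high; destruct (lt_dec j n0); [auto|lia]. }
    specialize (Htail H0).
    assert (Hcmp : energy om ze c d r eta T' (high n0 C') (high n0 D') R' 0 N <= K1 * en).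
    { eapply Rle_trans; [|apply HE1]; fold C' D' R'.
      rewrite (Hkill (RtoC (- eta))) by now left.
      rewrite (energy_ext om ze c d r eta T' _ _ _ 0 C' D' R' (Cre (0, 0) * E)).
      - rewrite !energy_enL; apply Rplus_le_compat; apply enL_mono; lra.
      - intros n Hn; unfold high; destruct (lt_dec n n0) as [Hlt|]; auto.
        destruct (Hz n ltac:(lia)) as [-> [-> _]]; auto.
      - simpl; ring. }
    assert (HkS : k * Sh <= Rsum1 (coef2 d (high n0 C') (high n0 D')) N).
    { unfold Sh; rewrite <- Rsum1_scal; apply Rsum1_le; intros n Hn.
      destruct (lt_dec n n0) as [Hlt|Hge].
      - unfold coef2, high; destruct (lt_dec n n0); [|easy]; rewrite Cmul_0_r, Cnorm2_0; lra.
      - assert (Hco : coef2 d (high n0 C') (high n0 D') n = coef2 d C' D' n).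
        { unfold coef2, high; destruct (lt_dec n n0); [easy|trivial]. }
        assert (Hco' : coef2 d (high n0 Cc) (high n0 Dd) n = coef2 d Cc Dd n).
        { unfold coef2, high; destruct (lt_dec n n0); [easy|trivial]. }
        rewrite Hco, Hco', Hcoef; unfold coef2; rewrite Rmult_plus_distr_l.
        destruct (Hq n ltac:(lia)) as (Q1 & Q2 & _ & _).
        apply Rplus_le_compat; apply Rmult_le_compat_r; trivial; apply Cnorm2_pos. }
    assert (Hfin : A0 * k * Sh <= K1 * en).
    { rewrite Rmult_assoc; eapply Rle_trans; [apply Rmult_le_compat_l; [lra|exact HkS]|lra]. }
    unfold K2; replace (K1 / (A0 * k) * en) with (K1 * en / (A0 * k)) by (field; split; lra).
    apply Rle_div_r; trivial; lra. }
  assert (HSl : Sl <= Q * (2 * en + 2 * (B * Sh))).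
  { unfold Sl; rewrite (Rsum1_cut _ N n0); trivial.
    2: { intros n Hn; unfold coef2, low; destruct (lt_dec n n0); [lia|].
         rewrite Cmul_0_r, Cnorm2_0; ring. }
    eapply Rle_trans; [apply (Hlow _ _ (lowR n0 Rr))|]; apply Rmult_le_compat_l; trivial.
    set (u := U1 om ze r Cc Dd Rr N).
    set (v := U1 om ze r (high n0 Cc) (high n0 Dd) (highR n0 Rr) N).
    assert (Hu : cont u) by apply cont_U1; assert (Hv : cont v) by apply cont_U1.
    apply Rle_trans with (Int (fun t => 2 * (u t * u t) + 2 * (v t * v t)) 0 T).
    - apply Int_le; auto 10 with cont; [lra|]; intros t _.
      rewrite <- (U1_low_cut om ze r Cc Dd Rr n0 N t) by trivial.
      pose proof (U1_low_high om ze r Cc Dd Rr n0 N t) as Huv; fold u v in Huv.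
      set (w := U1 om ze r (low n0 Cc) (low n0 Dd) (lowR n0 Rr) N t) in *.
      replace w with (u t + - v t) by (fold u; rewrite Huv; ring).
      pose proof (sqr_plus_le (u t) (- v t)); lra.
    - rewrite Int_plus, !Int_scal by auto with cont.
      assert (Hu2 : Int (fun t => u t * u t) 0 T <= en).
      { apply Int_le; auto with cont; [lra|]; intros t _; fold u.
        pose proof (Rle_0_sqr (U2 om ze c d eta Cc Dd E N t)) as Hsq; unfold Rsqr in Hsq; lra. }
      assert (Hv2 : Int (fun t => v t * v t) 0 T <= B * Sh).
      { pose proof (Hdir _ _ _ 0 N (admissible_high mu nu n' d Cc Dd Rr n0 Hmu Hnu HR)) as Hh.
        fold Sh in Hh; rewrite Rmult_0_l, Rplus_0_r in Hh; eapply Rle_trans; [|exact Hh].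
        apply Int_le; auto with cont; [lra|]; intros t _; fold v.
        match goal with |- _ <= _ + ?x * ?x => pose proof (Rle_0_sqr x) as Hsq end.
        unfold Rsqr in Hsq; lra. }
      lra. }
  assert (Hfin : Rsum1 (coef2 d Cc Dd) N <= Z * en).
  { rewrite HS; assert (HBS : B * Sh <= B * (K2 * en)) by now apply Rmult_le_compat_l.
    assert (Q * (2 * en + 2 * (B * Sh)) <= Q * (2 * en + 2 * (B * (K2 * en))))
      by (apply Rmult_le_compat_l; lra).
    unfold Z; lra. }
  apply Rmult_le_reg_l with Z; trivial.
  rewrite <- Rmult_assoc, Rinv_r, Rmult_1_l by lra; exact Hfin.
Qed.

(** * Convergence of the energies *)

Lemma Un_cv_le_eventually (u v : nat -> R) (l m : R) (n1 : nat) :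
  Un_cv u l -> Un_cv v m -> (forall n, (n1 <= n)%nat -> u n <= v n) -> l <= m.
Proof.
  intros Hu Hv H; destruct (Rle_dec l m) as [|Hn]; trivial; exfalso.
  destruct (Hu ((l - m) / 2) ltac:(lra)) as [a Ha]; destruct (Hv ((l - m) / 2) ltac:(lra)) as [b Hb].
  set (n := Nat.max n1 (Nat.max a b)).
  specialize (Ha n ltac:(lia)); specialize (Hb n ltac:(lia)); specialize (H n ltac:(lia)).
  unfold Rdist in *; apply Rabs_def2 in Ha; apply Rabs_def2 in Hb; lra.
Qed.

(** Cutting at k + 1 keeps exactly the indices above k. *)
Lemma coef2_high_sum d Cc Dd (k N : nat) : (k <= N)%nat ->
  Rsum1 (coef2 d (high (S k) Cc) (high (S k) Dd)) N = Rsum1 (coef2 d Cc Dd) N - Rsum1 (coef2 d Cc Dd) k.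
Proof.
  intros H.
  assert (E : Rsum1 (coef2 d Cc Dd) N = Rsum1 (coef2 d (low (S k) Cc) (low (S k) Dd)) N
    + Rsum1 (coef2 d (high (S k) Cc) (high (S k) Dd)) N).
  { rewrite <- Rsum1_plus; apply Rsum1_ext; intros; apply coef2_low_high. }
  assert (E' : Rsum1 (coef2 d (low (S k) Cc) (low (S k) Dd)) N = Rsum1 (coef2 d Cc Dd) k).
  { rewrite (Rsum1_cut _ N k); trivial.
    - apply Rsum1_ext; intros n Hn; unfold coef2, low; destruct (lt_dec n (S k)); [trivial|lia].
    - intros n Hn; unfold coef2, low; destruct (lt_dec n (S k)); [lia|].
      rewrite Cmul_0_r, Cnorm2_0; ring. }
  lra.
Qed.

Lemma fam_split (a l : nat -> Cpx) (k N : nat) (t : R) : (k <= N)%nat ->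
  fam a l N t = fam a l k t + fam (high (S k) a) l N t.
Proof.
  intros H; rewrite (fam_low_high (S k)); f_equal; unfold fam; rewrite (Rsum1_cut _ N k); trivial.
  - apply Rsum1_ext; intros n Hn; unfold low; destruct (lt_dec n (S k)); [trivial|lia].
  - intros n Hn; unfold low; destruct (lt_dec n (S k)); [lia|apply osc_0].
Qed.

Lemma high_mul (k : nat) (c a : nat -> Cpx) (n : nat) :
  high k (fun n => Cmul (c n) (a n)) n = Cmul (c n) (high k a n).
Proof. unfold high; destruct (lt_dec n k); trivial; now rewrite Cmul_0_r. Qed.

Lemma U1_split om ze r Cc Dd Rr k N t : (k <= N)%nat -> U1 om ze r Cc Dd Rr N t =
  U1 om ze r Cc Dd Rr k t + U1 om ze r (high (S k) Cc) (high (S k) Dd) (highR (S k) Rr) N t.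
Proof.
  intros H; rewrite (U1_low_high om ze r Cc Dd Rr (S k)); f_equal.
  unfold U1, fam, rho; rewrite !(Rsum1_cut _ N k); trivial;
    try (intros n Hn; unfold low, lowR; destruct (lt_dec n (S k)); [lia|]; rewrite ?osc_0; ring).
  f_equal; [|f_equal]; apply Rsum1_ext; intros n Hn; unfold low, lowR;
    destruct (lt_dec n (S k)); trivial; lia.
Qed.

Lemma U2_split om ze c d eta Cc Dd E k N t : (k <= N)%nat -> U2 om ze c d eta Cc Dd E N t =
  U2 om ze c d eta Cc Dd E k t + U2 om ze c d eta (high (S k) Cc) (high (S k) Dd) 0 N t.
Proof.
  intros H; unfold U2; rewrite (fam_split _ ze k N t H), (fam_split _ om k N t H).
  assert (E1 : forall (c a l : nat -> Cpx), fam (high (S k) (fun n => Cmul (c n) (a n))) l N t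
    = fam (fun n => Cmul (c n) (high (S k) a n)) l N t).
  { intros; unfold fam; apply Rsum1_ext; intros; now rewrite high_mul. }
  rewrite !E1; ring.
Qed.

(** Pointwise |(x + y)^2 - x^2| <= tau x^2 + (1 + 1 / tau) y^2 by Young's inequality, with y the
    terms of index above k. The term with E belongs to x alone and drops out of the tail. *)
Lemma energy_increment om ze c d r eta T Cc Dd Rr E k N tau : 0 <= T -> (k <= N)%nat -> 0 < tau ->
  Rabs (energy om ze c d r eta T Cc Dd Rr E N - energy om ze c d r eta T Cc Dd Rr E k)
  <= tau * energy om ze c d r eta T Cc Dd Rr E k + (1 + / tau) *
     energy om ze c d r eta T (high (S k) Cc) (high (S k) Dd) (highR (S k) Rr) 0 N.
Proof.
  intros HT Hk Htau; unfold energy.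
  set (u1 := U1 om ze r Cc Dd Rr k); set (u2 := U2 om ze c d eta Cc Dd E k).
  set (v1 := U1 om ze r (high (S k) Cc) (high (S k) Dd) (highR (S k) Rr) N).
  set (v2 := U2 om ze c d eta (high (S k) Cc) (high (S k) Dd) 0 N).
  assert (H1 : cont u1) by apply cont_U1; assert (H2 : cont u2) by apply cont_U2.
  assert (H3 : cont v1) by apply cont_U1; assert (H4 : cont v2) by apply cont_U2.
  rewrite (Int_ext (fun t => U1 om ze r Cc Dd Rr N t * _ + _)
    (fun t => (u1 t + v1 t) * (u1 t + v1 t) + (u2 t + v2 t) * (u2 t + v2 t))).
  2: { intros t; rewrite (U1_split om ze r Cc Dd Rr k N t Hk).
       now rewrite (U2_split om ze c d eta Cc Dd E k N t Hk). }
  assert (Hti : 0 < / tau) by now apply Rinv_0_lt_compat.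
  assert (Hp : forall x y, Rabs ((x + y) * (x + y) - x * x) <= tau * (x * x) + (1 + / tau) * (y * y)).
  { intros x y.
    assert (Hsq : forall s, s * s = 1 -> 0 <= tau * (x * x) + / tau * (y * y) + 2 * s * (x * y)).
    { intros s Hs; replace (tau * (x * x) + / tau * (y * y) + 2 * s * (x * y)) with
        (/ tau * ((tau * x + s * y) * (tau * x + s * y)) + / tau * (y * y) * (1 - s * s))
        by (field; lra).
      rewrite Hs; pose proof (Rle_0_sqr (tau * x + s * y)) as Hq; unfold Rsqr in Hq.
      pose proof (Rmult_le_pos _ _ (Rlt_le _ _ Hti) Hq); lra. }
    pose proof (Hsq 1 ltac:(lra)); pose proof (Hsq (-1) ltac:(lra)).
    pose proof (Rle_0_sqr y) as Hy; unfold Rsqr in Hy; apply Rabs_le; split; lra. }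
  rewrite <- Int_minus, <- !Int_scal, <- Int_plus by auto 20 with cont.
  apply Rabs_le; split.
  - rewrite <- (Rmult_1_l (Int (fun t => tau * _ + _) 0 T)), Ropp_mult_distr_l.
    rewrite <- Int_scal by auto 20 with cont.
    apply Int_le; auto 20 with cont; intros t _.
    pose proof (Hp (u1 t) (v1 t)) as P1; pose proof (Hp (u2 t) (v2 t)) as P2.
    apply Rabs_le_between in P1; apply Rabs_le_between in P2; lra.
  - apply Int_le; auto 20 with cont; intros t _.
    pose proof (Hp (u1 t) (v1 t)) as P1; pose proof (Hp (u2 t) (v2 t)) as P2.
    apply Rabs_le_between in P1; apply Rabs_le_between in P2; lra.
Qed.

(** The direct inequality bounds all energies by [Y] and the tail energies by B times the tail of
    the series S, so increments are small once tau is fixed and k is large. *)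
Lemma energy_converges om ze c d r eta T mu nu n' B Cc Dd Rr E S :
  0 <= T -> 0 <= mu -> nu > 1 / 2 -> 0 <= B ->
  (forall Cc Dd Rr E N, admissible mu nu n' d Cc Dd Rr ->
    energy om ze c d r eta T Cc Dd Rr E N <= B * (Rsum1 (coef2 d Cc Dd) N + E * E)) ->
  admissible mu nu n' d Cc Dd Rr -> Un_cv (Rsum1 (coef2 d Cc Dd)) S ->
  exists I, Un_cv (fun N => energy om ze c d r eta T Cc Dd Rr E N) I.
Proof.
  intros HT Hmu Hnu HB Hdir HR HS.
  set (en := fun N => energy om ze c d r eta T Cc Dd Rr E N).
  assert (HSN : forall N, Rsum1 (coef2 d Cc Dd) N <= S)
    by (apply Rsum1_le_of_cv; trivial; intros; apply coef2_pos).
  assert (HS0 : 0 <= S) by apply (HSN 0%nat).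
  set (Y := B * (S + E * E)).
  assert (HY : 0 <= Y) by (apply Rmult_le_pos; trivial; pose proof (Rle_0_sqr E) as H;
    unfold Rsqr in H; lra).
  assert (HenY : forall N, en N <= Y).
  { intros N; eapply Rle_trans; [now apply Hdir|]; apply Rmult_le_compat_l; trivial.
    specialize (HSN N); lra. }
  assert (HC : Cauchy_crit en).
  { intros eps Heps.
    (* Both parts of an increment from k0 are at most eps / 8, so two energies beyond k0 differ by
       at most eps / 2. *)
    set (tau := eps / (8 * (Y + 1))).
    assert (Htau : 0 < tau) by (apply Rdiv_lt_0_compat; lra).
    assert (HtY : tau * Y <= eps / 8).
    { unfold tau; replace (eps / (8 * (Y + 1)) * Y) with (eps * Y / (8 * (Y + 1))) by (field; lra).
      apply Rle_div_l; nra. }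
    assert (Hti : 0 < / tau) by now apply Rinv_0_lt_compat.
    set (F := (1 + / tau) * B); assert (HF : 0 <= F) by (apply Rmult_le_pos; lra).
    destruct (HS (eps / (8 * (F + 1)))) as [k0 Hk0]; [apply Rdiv_lt_0_compat; lra|].
    specialize (Hk0 k0 (Nat.le_refl _)); unfold Rdist in Hk0; apply Rabs_def2 in Hk0.
    assert (Hinc : forall N, (k0 <= N)%nat -> Rabs (en N - en k0) <= eps / 4).
    { intros N HN; eapply Rle_trans; [apply (energy_increment _ _ _ _ _ _ _ _ _ _ _ _ _ tau); trivial|].
      pose proof (Hdir _ _ _ 0 N (admissible_high mu nu n' d Cc Dd Rr (Datatypes.S k0) Hmu Hnu HR)) as Hh.
      rewrite coef2_high_sum, Rmult_0_l, Rplus_0_r in Hh by trivial.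
      assert (H1 : tau * en k0 <= tau * Y) by (apply Rmult_le_compat_l; [lra|apply HenY]).
      apply (Rmult_le_compat_l (1 + / tau)) in Hh; [|lra].
      rewrite <- Rmult_assoc in Hh; fold F in Hh.
      assert (H2 : F * (Rsum1 (coef2 d Cc Dd) N - Rsum1 (coef2 d Cc Dd) k0)
                   <= F * (eps / (8 * (F + 1)))).
      { apply Rmult_le_compat_l; trivial; specialize (HSN N); lra. }
      assert (H3 : F * (eps / (8 * (F + 1))) <= eps / 8).
      { replace (F * (eps / (8 * (F + 1)))) with (eps * F / (8 * (F + 1))) by (field; lra).
        apply Rle_div_l; nra. }
      unfold en in H1; lra. }
    exists k0; intros n m Hn Hm; unfold Rdist.
    pose proof (Hinc n Hn) as Pn; pose proof (Hinc m Hm) as Pm.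
    apply Rabs_le_between in Pn; apply Rabs_le_between in Pm; apply Rabs_def1; lra. }
  destruct (Rcomplete.R_complete en HC) as [I HI]; now exists I.
Qed.

Lemma integral_energy om ze c d r eta T Cc Dd Rr E N :
  integral (fun t => Cnorm2 (u1_N om ze Cc Dd r Rr N t)
    + Cnorm2 (u2_N om ze c d Cc Dd E eta N t)) 0 T
  = energy om ze c d r eta T Cc Dd Rr E N.
Proof.
  assert (H : forall t, U1 om ze r Cc Dd Rr N t * U1 om ze r Cc Dd Rr N t
    + U2 om ze c d eta Cc Dd E N t * U2 om ze c d eta Cc Dd E N t
    = Cnorm2 (u1_N om ze Cc Dd r Rr N t) + Cnorm2 (u2_N om ze c d Cc Dd E eta N t)).
  { intros t; rewrite u1_N_eq, u2_N_eq; unfold Cnorm2; simpl; ring. }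
  rewrite integral_Int.
  - apply Int_ext; intros t; now rewrite <- H.
  - apply (cont_ext _ _ H); auto with cont.
Qed.

(** * Consequences of the hypotheses and the final estimate *)

Lemma Cmod_le_sqr (a b : Cpx) (k : R) : 0 <= k -> k * Cmod a <= Cmod b ->
  k * k * Cnorm2 a <= Cnorm2 b.
Proof.
  intros Hk H; unfold Cmod in H.
  rewrite <- (sqrt_sqrt _ (Cnorm2_pos a)), <- (sqrt_sqrt _ (Cnorm2_pos b)).
  pose proof (sqrt_pos (Cnorm2 a)); pose proof (sqrt_pos (Cnorm2 b)).
  replace (k * k * _) with ((k * sqrt (Cnorm2 a)) * (k * sqrt (Cnorm2 a))) by ring.
  apply Rmult_le_compat; trivial; now apply Rmult_le_pos.
Qed.

Lemma Cmod_le_div_sqr (a b : Cpx) (k : R) : 0 <= k -> b <> (0, 0) -> Cmod a <= k / Cmod b ->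
  Cnorm2 a <= k * k / Cnorm2 b.
Proof.
  intros Hk Hb H; apply Cnorm2_neq0 in Hb; unfold Cmod in H.
  assert (Hs : 0 < sqrt (Cnorm2 b)) by now apply sqrt_lt_R0.
  rewrite <- (sqrt_sqrt _ (Cnorm2_pos a)), <- (sqrt_sqrt (Cnorm2 b)) by lra.
  replace (k * k / _) with ((k / sqrt (Cnorm2 b)) * (k / sqrt (Cnorm2 b))) by (field; lra).
  pose proof (sqrt_pos (Cnorm2 a)); apply Rmult_le_compat; trivial.
Qed.

Lemma Cnorm2_unbounded (u : nat -> Cpx) (g : R) : 0 < g ->
  liminf_eq (fun n => Cre (u (S n)) - Cre (u n)) g ->
  forall P, exists n0, forall n, (n0 <= n)%nat -> P <= Cnorm2 (u n).
Proof.
  intros Hg H P; destruct (liminf_unbounded (fun n => Cre (u n)) g Hg H (Rmax 1 P)) as [n0 Hn0].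
  exists n0; intros n Hn; specialize (Hn0 n Hn); cbv beta in Hn0.
  pose proof (Rmax_l 1 P); pose proof (Rmax_r 1 P); unfold Cnorm2; nra.
Qed.

(** The square root is positive because gamma > 4 alpha, and it is at most gamma. *)
Lemma sqrt_threshold (gamma alpha T : R) : 0 < alpha -> gamma > 4 * alpha ->
  T > 2 * PI / sqrt (gamma ^ 2 - 16 * alpha ^ 2) -> 0 < T /\ 2 * PI / T < gamma.
Proof.
  intros Ha Hg HT; pose proof PI_RGT_0 as Hpi.
  set (q := sqrt (gamma ^ 2 - 16 * alpha ^ 2)) in *.
  assert (Hq : 0 < q) by (apply sqrt_lt_R0; nra).
  assert (Hqg : q <= gamma).
  { rewrite <- (sqrt_Rsqr gamma) by lra; apply sqrt_le_1_alt; unfold Rsqr; nra. }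
  assert (Hpq : 0 < 2 * PI / q) by (apply Rdiv_lt_0_compat; lra).
  assert (HT0 : 0 < T) by lra; split; trivial.
  apply Rgt_lt, (proj1 (Rlt_div_l _ _ _ Hq)) in HT.
  apply Rlt_div_l; trivial; apply Rlt_le_trans with (T * q); trivial.
  rewrite Rmult_comm; apply Rmult_le_compat_r; lra.
Qed.

Theorem theorem5p16
  (om ze c d : nat -> Cpx) (r : nat -> R)
  (gamma alpha chi : R) (n' : nat) (mu nu M c1 c2 eta : R)
  (Hgamma : gamma > 0) (Halpha : alpha > 0) (Hchi : chi < 0)
  (Hmu : mu > 0) (Hnu : nu > 1/2) (HM : M > 0)
  (Hc1 : 0 < c1) (Hc12 : c1 <= c2)
  (* (H1) *)
  (H1om : liminf_eq (fun n => Cre (om (S n)) - Cre (om n)) gamma)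
  (H1ze : liminf_eq (fun n => Cre (ze (S n)) - Cre (ze n)) gamma)
  (* (H2) *)
  (H2om : Un_cv (fun n => Cim (om n)) alpha)
  (H2r : Un_cv r chi)
  (H2ze : Un_cv (fun n => Cim (ze n)) 0)
  (* (H3) *)
  (H3om : forall n, (n >= 1)%nat -> om n <> (0, 0))
  (H3ze : forall n, (n >= 1)%nat -> ze n <> (0, 0))
  (H3d : forall n, (n >= 1)%nat ->
     c1 * Cmod (ze n) <= Cmod (d n) /\ Cmod (d n) <= c2 * Cmod (ze n))
  (H3c : forall n, (n >= 1)%nat -> Cmod (c n) <= M / Cmod (om n))
  (* (D) on the fixed sequences *)
  (Dom : forall n m, (n >= 1)%nat -> (m >= 1)%nat -> n <> m -> om n <> om m)
  (Dr : forall n m, (n >= 1)%nat -> (m >= 1)%nat -> n <> m -> r n <> r m)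
  (Dze : forall n m, (n >= 1)%nat -> (m >= 1)%nat -> n <> m -> ze n <> ze m)
  (Domze : forall n m, (n >= 1)%nat -> (m >= 1)%nat ->
     om n <> ze m /\ om n <> Cconj (ze m))
  (Dr_i : forall n m, (n >= 1)%nat -> (m >= 1)%nat ->
     RtoC (r n) <> Cmul Ci (om m) /\ RtoC (r n) <> Cmul Ci (ze m))
  (Dr_eta : forall n, (n >= 1)%nat -> r n <> - eta)
  (Dpos : forall n, (n >= 1)%nat -> Cre (om n) > 0 /\ Cre (ze n) > 0)
  (Hgap : gamma > 4 * alpha) :
  forall T : R, T > 2 * PI / sqrt (gamma ^ 2 - 16 * alpha ^ 2) ->
  exists A B : R, 0 < A /\ A <= B /\
    forall (Cc Dd : nat -> Cpx) (Rr : nat -> R) (E S : R),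
      (* (H4) *)
      (forall n, (n >= n')%nat -> (n >= 1)%nat ->
         Rabs (Rr n) <= mu * Rpower (INR n) (- nu) * sqrt (coef2 d Cc Dd n)) ->
      (forall n, (n <= n')%nat -> (n >= 1)%nat ->
         Rabs (Rr n) <= mu * sqrt (coef2 d Cc Dd n)) ->
      (* (H5): S = sum_{n>=1} (|C_n|^2 + |d_n D_n|^2) *)
      Un_cv (Rsum1 (coef2 d Cc Dd)) S ->
      (* bound on E *)
      E ^ 2 <= M * S ->
      exists I : R,
        Un_cv (fun N => integral (fun t =>
                  Cnorm2 (u1_N om ze Cc Dd r Rr N t)
                  + Cnorm2 (u2_N om ze c d Cc Dd E eta N t)) 0 T) I /\
        A * S <= I /\ I <= B * S.
Proof.
  intros T HT.
  destruct (sqrt_threshold gamma alpha T Halpha Hgap HT) as [HT0 HTg].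
  destruct (Un_cv_bounded _ _ H2om) as [Ko [HKo Hbo]].
  destruct (Un_cv_bounded _ _ H2ze) as [Kz [HKz Hbz]].
  destruct (Un_cv_bounded _ _ H2r) as [Kr [HKr Hbr]].
  set (K := Ko + Kz + Kr + Rabs chi); pose proof (Rabs_pos chi) as Hchi0.
  assert (HbK : forall n, Rabs (Cim (om n)) <= K /\ Rabs (Cim (ze n)) <= K /\ Rabs (r n) <= K).
  { intros n; specialize (Hbo n); specialize (Hbz n); specialize (Hbr n); unfold K.
    repeat split; lra. }
  assert (Hdz : forall n, (1 <= n)%nat -> c1 * c1 * Cnorm2 (ze n) <= Cnorm2 (d n)).
  { intros n Hn; apply Cmod_le_sqr; [lra|]; now apply H3d. }
  assert (Hco : forall n, (1 <= n)%nat -> Cnorm2 (c n) <= M * M / Cnorm2 (om n)).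
  { intros n Hn; apply Cmod_le_div_sqr; [lra|now apply H3om|now apply H3c]. }
  pose proof (Cnorm2_unbounded ze gamma Hgamma H1ze) as Uz.
  pose proof (Cnorm2_unbounded om gamma Hgamma H1om) as Uo.
  assert (Hc1s : 0 < c1 * c1) by nra.
  assert (Hd : forall e, 0 < e -> exists n0, forall n, (n0 <= n)%nat -> 1 <= e * Cnorm2 (d n)).
  { intros e He; destruct (Uz (/ (e * (c1 * c1)))) as [n0 Hn0]; exists (Nat.max 1 n0); intros n Hn.
    specialize (Hn0 n ltac:(lia)); specialize (Hdz n ltac:(lia)).
    apply Rle_trans with (e * (c1 * c1 * / (e * (c1 * c1)))); [apply Req_le; field; lra|].
    apply Rmult_le_compat_l; [lra|]; eapply Rle_trans; [|exact Hdz].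
    apply Rmult_le_compat_l; lra. }
  assert (Hc : forall e, 0 < e -> exists n0, forall n, (n0 <= n)%nat -> Cnorm2 (c n) <= e).
  { intros e He; destruct (Uo (M * M / e)) as [n0 Hn0]; exists (Nat.max 1 n0); intros n Hn.
    specialize (Hn0 n ltac:(lia)); specialize (Hco n ltac:(lia)).
    assert (Hon : 0 < Cnorm2 (om n)) by (apply Cnorm2_neq0, H3om; lia).
    eapply Rle_trans; [exact Hco|]; apply Rle_div_l; trivial.
    apply (proj1 (Rle_div_l _ _ _ He)) in Hn0; lra. }
  destruct (Uz 1) as [nz Hnz]; destruct (Uo 1) as [no Hno].
  destruct (seq_lower_bound (fun n => Cnorm2 (ze n)) 1 nz 1 ltac:(lra)
    ltac:(intros; now apply Cnorm2_neq0, H3ze) Hnz) as [kz [Hkz Hlz]].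
  destruct (seq_lower_bound (fun n => Cnorm2 (om n)) 1 no 1 ltac:(lra)
    ltac:(intros; now apply Cnorm2_neq0, H3om) Hno) as [ko [Hko Hlo]].
  set (Kd := / (c1 * c1 * kz)); set (Kc := M * M / ko).
  assert (HKd : 0 <= Kd) by (apply Rlt_le, Rinv_0_lt_compat, Rmult_lt_0_compat; trivial).
  assert (HKc : 0 <= Kc) by (apply Rmult_le_pos; [nra|now apply Rlt_le, Rinv_0_lt_compat]).
  assert (Hd' : forall n, (1 <= n)%nat -> 1 <= Kd * Cnorm2 (d n)).
  { intros n Hn; specialize (Hdz n Hn); specialize (Hlz n Hn); cbv beta in Hlz.
    apply Rle_trans with (Kd * (c1 * c1 * kz)); [apply Req_le; unfold Kd; field; lra|].
    apply Rmult_le_compat_l; trivial; eapply Rle_trans; [|exact Hdz].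
    apply Rmult_le_compat_l; lra. }
  assert (Hc' : forall n, (1 <= n)%nat -> Cnorm2 (c n) <= Kc).
  { intros n Hn; eapply Rle_trans; [now apply Hco|]; apply Rmult_le_compat_l; [nra|].
    apply Rinv_le_contravar; trivial; now apply Hlo. }
  assert (Doz : forall n m, (n >= 1)%nat -> (m >= 1)%nat -> om n <> ze m)
    by (intros; now apply Domze).
  assert (HKp : 0 <= K) by (unfold K; lra).
  assert (HchiK : Rabs chi <= K) by (unfold K; lra).
  destruct (energy_direct om ze c d r gamma alpha T mu nu n' eta K Kc Kd HT0 HTg
    ltac:(lra) ltac:(lra) Hnu HKc HKd H1om H1ze H2om H2ze ltac:(apply HbK) Hd' Hc') as [B0 [HB0 Hdir]].
  destruct (energy_inverse om ze c d r gamma alpha chi T mu nu n' eta K Kc Kd Hgamma HT0 HTg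
    ltac:(lra) ltac:(lra) Hnu HKp HKc HKd H1om H1ze H2om H2ze HbK HchiK Hd Hc Hd' Hc'
    Dpos Dom Dze Doz) as (A & n1 & HA & Hinv).
  (* E^2 <= M S turns the direct bound B0 (S + E^2) into B0 (1 + M) S; the maximum secures A <=
     B. *)
  exists A, (Rmax A (B0 * (1 + M))); split; [trivial|split; [apply Rmax_l|]].
  intros Cc Dd Rr E S H4 H4' H5 HE.
  assert (HR : admissible mu nu n' d Cc Dd Rr).
  { intros n Hn; unfold weight; destruct (le_dec n' n) as [Hle|Hgt]; [now apply H4|].
    rewrite Rmult_1_r; apply H4'; lia. }
  assert (HSN : forall N, Rsum1 (coef2 d Cc Dd) N <= S)
    by (apply Rsum1_le_of_cv; trivial; intros; apply coef2_pos).
  assert (HS0 : 0 <= S) by apply (HSN 0%nat).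
  destruct (energy_converges om ze c d r eta T mu nu n' B0 Cc Dd Rr E S ltac:(lra) ltac:(lra) Hnu HB0
    Hdir HR H5) as [I HI].
  exists I; split; [|split].
  - intros e He; destruct (HI e He) as [n0 Hn0]; exists n0; intros n Hn.
    rewrite integral_energy; now apply Hn0.
  - assert (HAS : Un_cv (fun N => A * Rsum1 (coef2 d Cc Dd) N) (A * S)).
    { apply (CV_mult (fun _ => A)); trivial; intros e He; exists 0%nat; intros.
      unfold Rdist; rewrite Rminus_diag, Rabs_R0; exact He. }
    apply (Un_cv_le_eventually _ _ _ _ n1 HAS HI); intros n Hn; now apply Hinv.
  - apply Rle_trans with (B0 * (1 + M) * S).
    + assert (Hcst : Un_cv (fun _ => B0 * (1 + M) * S) (B0 * (1 + M) * S)).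
      { intros e He; exists 0%nat; intros; unfold Rdist; rewrite Rminus_diag, Rabs_R0; exact He. }
      apply (Un_cv_le_eventually _ _ _ _ 0 HI Hcst); intros n _.
      eapply Rle_trans; [now apply Hdir|]; rewrite Rmult_assoc; apply Rmult_le_compat_l; trivial.
      specialize (HSN n); simpl in HE; lra.
    + apply Rmult_le_compat_r; trivial; apply Rmax_r.
Qed.
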